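(* Let $\mathcal G$ be a locally finite, connected metric graph with finite volume $|\mathcal G|>0$, let $\mathfrak V\subset V\cup\mathfrak C(\mathcal G)$ be a set of vertices and ends of $\mathcal G$, and assume $\mathfrak V\neq\emptyset$. Then the lowest eigenvalue $\lambda_1(\mathcal G,\mathfrak V)$ of the mixed Friedrichs–Neumann realisation $\mathcal H_{\mathfrak V}$ of the Laplacian on $\mathcal G$ satisfies $$\lambda_1(\mathcal G,\mathfrak V)\ge\frac{\pi^2}{4|\mathcal G|^2}.$$ Equality is attained if and only if $\mathcal G$ is isometrically isomorphic to an interval of length $|\mathcal G|$ with mixed Dirichlet–Neumann conditions (that is, $\mathfrak V$ consists of exactly one of the two endpoints of the interval).
   Context: A metric graph $\mathcal G$ is given by finite or countably infinite sets $V$ of vertices and $E$ of edges, each edge $e$ having a length $\ell_e\in(0,\infty)$; it is obtained from the disjoint union of intervals $[0,\ell_e]$ by gluing endpoints at the vertices (loops and parallel edges allowed). It carries the shortest-path metric and the sum of the Lebesgue measures on the edges; its volume is $|\mathcal G|=\sum_e\ell_e$. It is locally finite if every vertex has finite degree. Ends: consider sequences $(U_n)$ of non-empty open connected subsets of $\mathcal G$ with compact boundary, $U_{n+1}\subset U_n$, $\bigcap_n\overline{U_n}=\emptyset$. Two sequences $(U_n),(U_n')$ are equivalent if for each $n$ there are $j,k$ with $U_j'\subset U_n$ and $U_k\subset U_n'$. An end is an equivalence class; $\mathfrak C(\mathcal G)$ is the set of ends. When $|\mathcal G|<\infty$, ends correspond bijectively to the points of $\overline{\mathcal G}\setminus\mathcal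 G$, where $\overline{\mathcal G}$ is the metric completion. $H^1(\mathcal G)$ is the space of continuous $f$ on $\mathcal G$ with $f_e\in H^1(0,\ell_e)$ for every edge and $\sum_e\|f_e\|^2_{H^1(0,\ell_e)}<\infty$; each such $f$ has a value $f(\gamma)$ at each end $\gamma$, namely $f(\gamma)=\lim f(x_n)$ for any $x_n\in U_n$ with $(U_n)$ representing $\gamma$. Set $H^1_0(\mathcal G;\mathfrak V)=\{f\in H^1(\mathcal G): f(v)=0\ \forall v\in\mathfrak V\}$. $\mathcal H_{\mathfrak V}$ is the self-adjoint operator on $L^2(\mathcal G)$ associated with $f\mapsto\int_{\mathcal G}|f'|^2dx$ on $H^1_0(\mathcal G;\mathfrak V)$; for finite volume it has compact resolvent, and $\lambda_1(\mathcal G,\mathfrak V)$ is the minimum of $\int|f'|^2/\int|f|^2$ over $0\ne f\in H_0^1(\mathcal G;\mathfrak V)$. Graphs are considered up to insertion or deletion of vertices of degree two, and in ''interval'' an endpoint may be either a vertex or an end of $\mathcal G$. *)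

(* Defs.v *)
From HB Require Import structures.
From mathcomp Require Import all_boot all_order all_algebra.
From mathcomp Require Import all_classical all_reals all_analysis.

Set Implicit Arguments.
Unset Strict Implicit.
Unset Printing Implicit Defensive.

Import Order.TTheory GRing.Theory Num.Theory.
Import numFieldNormedType.Exports.

Local Open Scope classical_set_scope.
Local Open Scope ring_scope.

(* Loops and parallel edges are allowed; the orientation of an edge by its
   source and target is arbitrary. *)
Record metric_graph (R : realType) := MetricGraph {
  vertex : countType;
  edge : countType;
  source : edge -> vertex;
  target : edge -> vertex;
  len : edge -> R;
  len_gt0 : forall e, 0 < len e }.

(* The disjoint union of the intervals [0, len e] with their endpoints glued
   at the vertices: a point is a vertex, or is interior to a unique edge. *)
Definition gpoint (R : realType) (G : metric_graph R) : Type :=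
  (vertex G + {p : edge G * R | 0 < p.2 < len p.1})%type.

HB.instance Definition _ (R : realType) (G : metric_graph R) :=
  Choice.copy (gpoint G)
    (vertex G + {p : edge G * R | 0 < p.2 < len p.1})%type.

Definition vpoint (R : realType) (G : metric_graph R) (v : vertex G) :
  gpoint G := inl v.

(* The gluing map [0, len e] -> G; its values for s outside of [0, len e]
   are never used. *)
Definition on_edge (R : realType) (G : metric_graph R) (e : edge G) (s : R) :
    gpoint G :=
  if insub (e, s) is Some p then inr p
  else vpoint (if s <= 0 then source e else target e).

(* walk y x l: there is a path from x to y of length l, that is, a finite
   concatenation of segments of edges of total length l. *)
Inductive walk (R : realType) (G : metric_graph R) (y : gpoint G) :
    gpoint G -> R -> Prop :=
| walk_nil : walk y y 0
| walk_cons (e : edge G) (s t : R) (l : R) :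
    s \in `[0, len e] -> t \in `[0, len e] ->
    walk y (on_edge e t) l -> walk y (on_edge e s) (`|s - t| + l).

(* The value is +oo when x and y lie in different components. *)
Definition gdist (R : realType) (G : metric_graph R) (x y : gpoint G) :
    \bar R :=
  ereal_inf [set l%:E | l in walk y x].

Lemma walk_ge0 (R : realType) (G : metric_graph R) (x y : gpoint G) l :
  walk y x l -> 0 <= l.
Proof. by elim=> // e s t {}l _ _ _ l0; rewrite addr_ge0. Qed.

Lemma walk_cat (R : realType) (G : metric_graph R) (x y z : gpoint G) l k :
  walk y x l -> walk z y k -> walk z x (l + k).
Proof.
by move=> xy yz; elim: xy => [|e s t {}l sI tI _ IH];
  rewrite ?add0r// -addrA; exact: walk_cons.
Qed.

Lemma walk_sym (R : realType) (G : metric_graph R) (x y : gpoint G) l :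
  walk y x l -> walk x y l.
Proof.
elim=> [|e s t {}l sI tI _ IH]; first exact: walk_nil.
rewrite addrC distrC; apply: (walk_cat IH); rewrite -[`|_|]addr0.
by apply: walk_cons => //; exact: walk_nil.
Qed.

Definition gball (R : realType) (G : metric_graph R) (x : gpoint G) (r : R)
  (y : gpoint G) : Prop := (gdist x y < r%:E)%E.

Lemma gballP (R : realType) (G : metric_graph R) (x y : gpoint G) r :
  gball x r y <-> exists2 l, walk y x l & l < r.
Proof.
split=> [/ereal_inf_lt[_ [l xy <-]]|[l xy lr]].
  by rewrite lte_fin => lr; exists l.
apply: le_lt_trans (_ : l%:E < r%:E)%E; last by rewrite lte_fin.
by apply: ereal_inf_lbound; exists l.
Qed.

Lemma gball_center (R : realType) (G : metric_graph R) (x : gpoint G) (e : R) :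
  0 < e -> gball x e x.
Proof. by move=> e0; apply/gballP; exists 0 => //; exact: walk_nil. Qed.

Lemma gball_sym (R : realType) (G : metric_graph R) (x y : gpoint G) (e : R) :
  gball x e y -> gball y e x.
Proof.
by move=> /gballP[l xy le]; apply/gballP; exists l => //; exact: walk_sym.
Qed.

Lemma gball_triangle (R : realType) (G : metric_graph R) (x y z : gpoint G)
  (e1 e2 : R) : gball x e1 y -> gball y e2 z -> gball x (e1 + e2) z.
Proof.
move=> /gballP[l xy le] /gballP[k yz ke]; apply/gballP.
by exists (l + k); [exact: walk_cat xy yz|exact: ltrD].
Qed.

HB.instance Definition _ (R : realType) (G : metric_graph R) :=
  hasNbhs.Build (gpoint G) (nbhs_ (entourage_ (@gball R G))).

HB.instance Definition _ (R : realType) (G : metric_graph R) :=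
  Nbhs_isPseudoMetric.Build R (gpoint G) erefl (@gball_center R G)
    (@gball_sym R G) (@gball_triangle R G) erefl.

Definition volume (R : realType) (G : metric_graph R) : \bar R :=
  \esum_(e in [set: edge G]) (len e)%:E.

Definition locally_finite (R : realType) (G : metric_graph R) : Prop :=
  forall v : vertex G, finite_set [set e | source e = v \/ target e = v].

Definition end_seq (R : realType) (G : metric_graph R)
    (U : nat -> set (gpoint G)) : Prop :=
  [/\ forall n, [/\ U n !=set0, open (U n), connected (U n) &
                    compact (closure (U n) `\` (U n)°)],
      forall n, U n.+1 `<=` U n &
      \bigcap_n closure (U n) = set0].

Definition end_equiv (R : realType) (G : metric_graph R)
    (U U' : nat -> set (gpoint G)) : Prop :=
  forall n, exists j k, U' j `<=` U n /\ U k `<=` U' n.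

(* Ends are the equivalence classes themselves. *)
Definition graph_end (R : realType) (G : metric_graph R) : Type :=
  {C : set (nat -> set (gpoint G)) | exists2 U, end_seq U &
    C = [set U' | end_seq U' /\ end_equiv U U']}.

Definition has_value_at (R : realType) (G : metric_graph R)
    (f : gpoint G -> R) (p : vertex G + graph_end G) (a : R) : Prop :=
  match p with
  | inl v => f (vpoint v) = a
  | inr c => forall U, sval c U -> forall x : nat -> gpoint G,
      (forall n, U n (x n)) -> (f \o x) n @[n --> \oo] --> a
  end.

Definition sqnorm (R : realType) (l : R) (h : R -> R) : \bar R :=
  (\int[@lebesgue_measure R]_(x in `[0%R, l]) (h x ^+ 2)%:E)%E.

Definition in_L2 (R : realType) (l : R) (h : R -> R) : Prop :=
  measurable_fun `[0, l] h /\ (sqnorm l h < +oo)%E.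

(* f is the continuous representative of an element of H^1(0, l) with weak
   derivative g: f is absolutely continuous, f' = g a.e., and f, g are in L^2.
   The derivative g is determined by f up to a null set only. *)
Definition in_H1 (R : realType) (l : R) (f g : R -> R) : Prop :=
  [/\ in_L2 l f, in_L2 l g &
      forall x, x \in `[0, l] ->
        f x = f 0 + \int[@lebesgue_measure R]_(t in `[0, x]) g t].

Definition graph_sqnorm (R : realType) (G : metric_graph R)
    (h : edge G -> R -> R) : \bar R :=
  \esum_(e in [set: edge G]) sqnorm (len e) (h e).

Definition graph_H1 (R : realType) (G : metric_graph R) (f : gpoint G -> R)
    (f' : edge G -> R -> R) : Prop :=
  [/\ continuous f,
      forall e, in_H1 (len e) (fun s => f (on_edge e s)) (f' e) &
      (\esum_(e in [set: edge G])
         (sqnorm (len e) (fun s => f (on_edge e s)) +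
          sqnorm (len e) (f' e)) < +oo)%E].

Definition graph_H10 (R : realType) (G : metric_graph R)
    (VV : set (vertex G + graph_end G)) (f : gpoint G -> R)
    (f' : edge G -> R -> R) : Prop :=
  graph_H1 f f' /\ forall p, VV p -> has_value_at f p 0.

Definition rayleigh (R : realType) (G : metric_graph R) (f : gpoint G -> R)
    (f' : edge G -> R -> R) : R :=
  fine (graph_sqnorm f') / fine (graph_sqnorm (fun e s => f (on_edge e s))).

(* The lowest eigenvalue of the self-adjoint operator associated with the form
   \int |f'|^2 on H^1_0(G; VV), given as the minimum of the Rayleigh quotient.
   When the volume is finite the infimum is attained. Real-valued functions
   suffice: the form is invariant under complex conjugation. *)
Definition lambda1 (R : realType) (G : metric_graph R)
    (VV : set (vertex G + graph_end G)) : R :=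
  inf [set r | exists (f : gpoint G -> R) (f' : edge G -> R -> R),
    [/\ graph_H10 VV f f', exists x, f x != 0 & r = rayleigh f f']].

(* phi is an isometry onto one of [0, L], [0, L[, ]0, L] and ]0, L[. A missing
   endpoint of the interval is an end of G, and VV is the singleton of the
   vertex or end sitting at 0 or at L. *)
Definition mixed_interval (R : realType) (G : metric_graph R)
    (VV : set (vertex G + graph_end G)) (L : R) : Prop :=
  exists phi : gpoint G -> R,
    [/\ forall x y, gdist x y = `|phi x - phi y|%:E,
        [set` `]0, L[] `<=` range phi,
        range phi `<=` [set` `[0, L]] &
        exists p, VV = [set p] /\
          (has_value_at phi p 0 \/ has_value_at phi p L)].

(* Main.v *)
(* A function on an edge satisfies Picone's inequality
     \int f'^2 - k^2 \int f^2 >= k tan(a) f(w)^2 - k tan(a + k len) f(u)^2,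
   where u and w are the endpoints.  A finite connected subgraph is stripped
   off edge by edge, chords being cut in the middle; every vertex carries the
   load tan(a), where the phase a is k times the length already stripped off
   there.  Loads add up and phases can only decrease when they merge, since
   tan(a) + tan(b) <= tan(a + b).  At the last vertex, where f vanishes (or is
   small, near an end), the phase is at most k |G|, and k |G| < pi/2 yields
   \int f'^2 >= k^2 \int f^2.
   If two branches meet at a vertex other than the Dirichlet point, if the
   Dirichlet vertex has degree at least two, or if there is a second Dirichlet
   vertex, then the phase drops by a fixed amount and some k > pi/(2|G|) is
   still admissible.  So in the case of equality all degrees are at most two
   and G, not being a cycle, is exhausted by lines; these glue to an isometry
   onto an interval, and Picone's inequality along it excludes two Dirichlet
   ends.  Conversely, sin(pi x / (2|G|)) is a test function on the interval. *)
Require Import Defs.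
From mathcomp Require Import all_boot all_order all_algebra.
From mathcomp Require Import all_classical all_reals all_analysis.
From mathcomp Require Import measurable_realfun ring lra.

Set Implicit Arguments.
Unset Strict Implicit.
Unset Printing Implicit Defensive.

Import Order.TTheory GRing.Theory Num.Theory.
Import numFieldNormedType.Exports.

Local Open Scope classical_set_scope.
Local Open Scope ring_scope.

(** * Trigonometry *)

(** No minimiser is ever used. Every bound is an inequality for all functions in the form domain,
    and the equality case is contrapositive: any deviation from the interval produces a single k >
    pi/(2|G|) that works for all functions at once. The obstacle is that G may have infinitely many
    edges and that the Dirichlet point may be an end. Finite subgraphs only approximate G, so a gain
    of phase must not depend on them: it is expressed by k and a lower bound for the edges at one
    vertex, positive by local finiteness. The growth is therefore arranged so that the decisive
    edges are added as soon as their vertex is reached; being stripped in reverse order, they come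
    after everything added later has turned into loads. Raising k makes k |G| exceed pi/2, but a
    phase counts only stripped length, and the decisive edges, still unstripped, leave the necessary
    room. Near an end the function is merely small. The root is then a vertex close to the end,
    depending on the function and on the error; the remainder k tan(b) f(root)^2 can be made
    arbitrarily small because b < pi/2 is fixed in advance. *)

Section trigonometry.
Variable R : realType.
Implicit Types a b h s t x y : R.

Lemma mulr_cos_le_sin h : 0 <= h <= pi -> h * cos h <= sin h.
Proof.
move=> /andP[h0 hpi].
pose F := fun x : R => sin x - x * cos x.
have dF (x : R) : is_derive x (1 : R) F (x * sin x).
  rewrite /F; apply: is_derive_eq.
  by rewrite /GRing.scale/=; ring.
have [c cI] := @MVT_segment R F (fun x => x * sin x) 0 h h0 (fun x _ => dF x)
  (@derivable_within_continuous _ _ F _ (fun x _ => @ex_derive _ _ _ _ _ _ _ (dF x))).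
rewrite /F sin0 mul0r !subr0 => e; rewrite -subr_ge0 e.
move: cI; rewrite in_itv/= => /andP[c0 ch].
rewrite !mulr_ge0//; apply: sin_ge0_pi; rewrite c0/=; exact: le_trans hpi.
Qed.

(** A version of tan' = 1 + tan^2 for increments. Multiplied by cos a cos b it reads h cos h <= sin
    h with h = a - b. *)
Lemma tanB_ge a b : - (pi / 2) < b -> b <= a -> a < pi / 2 ->
  (a - b) * (1 + tan a * tan b) <= tan a - tan b.
Proof.
move=> b0 ba a0.
have ca : 0 < cos a by apply: cos_gt0_pihalf; rewrite a0 (lt_le_trans b0).
have cb : 0 < cos b by apply: cos_gt0_pihalf; rewrite b0 (le_lt_trans ba).
have -> : 1 + tan a * tan b = cos (a - b) / (cos a * cos b).
  by rewrite cosB /tan; field; rewrite !gt_eqF.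
have -> : tan a - tan b = sin (a - b) / (cos a * cos b).
  by rewrite sinB /tan; field; rewrite !gt_eqF.
rewrite mulrA ler_pM2r ?invr_gt0 ?mulr_gt0//.
apply: mulr_cos_le_sin; lra.
Qed.

(** Concavity of [atan] on the half-line: z |-> atan z - atan (z + s) has a nonnegative derivative
    there. *)
Lemma atanB_le x y s : 0 <= x -> x <= y -> 0 <= s ->
  atan (y + s) - atan (x + s) <= atan y - atan x.
Proof.
move=> x0 xy s0.
pose F := fun z : R => atan z - atan (z + s).
pose dF := fun z : R => (1 + z ^+ 2)^-1 - (1 + (z + s) ^+ 2)^-1.
have FdF (z : R) : is_derive z (1 : R) F (dF z).
  rewrite /F /dF; apply: is_deriveB => //.
  have h : is_derive z (1 : R) (fun z : R => z + s) 1.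
    by apply: is_derive_eq; rewrite addr0.
  by rewrite -[X in is_derive _ _ _ X]mulr1; apply: is_derive1_comp.
have [c cI] := @MVT_segment R F dF x y xy (fun x _ => FdF x)
  (@derivable_within_continuous _ _ F _ (fun x _ => @ex_derive _ _ _ _ _ _ _ (FdF x))).
rewrite /F => e.
suff : 0 <= dF c * (y - x) by rewrite -e; lra.
move: cI; rewrite in_itv/= => /andP[xc cy].
rewrite mulr_ge0 ?subr_ge0// /dF lef_pV2 ?posrE; [nra| |]; nra.
Qed.

Lemma atanD_le x y : 0 <= x -> 0 <= y -> atan (x + y) <= atan x + atan y.
Proof.
move=> x0 y0; have := @atanB_le 0 x y (lexx _) x0 y0.
by rewrite add0r atan0; lra.
Qed.

Lemma atan_ge0 x : 0 <= x -> 0 <= atan x.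
Proof. by move=> x0; rewrite -[leLHS](@atan0 R); exact: le_atan. Qed.

(** Trivial if the right-hand side reaches pi/2; otherwise compare tangents, 2t < 2t / (1 - t^2). *)
Lemma atan_double_lt t : 0 < t -> atan (t + t) < atan t + atan t.
Proof.
move=> t0.
have m x : -(pi/2) < atan x < pi/2 by rewrite atan_gtNpi2 atan_ltpi2.
have [h|h] := leP (pi/2) (atan t + atan t).
  by apply: lt_le_trans h; exact: atan_ltpi2.
have a0 : 0 < atan t by rewrite -(@atan0 R) lt_atan.
have pi0 := @pi_gt0 R.
have inI : atan t + atan t \in `](-(pi/2)), (pi/2)[.
  by rewrite in_itv/= h andbT; lra.
have ct : cos (atan t) != 0 by rewrite gt_eqF// cos_gt0_pihalf//; exact: m.
rewrite -ltr_tan//; last by rewrite in_itv/=; exact: m.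
rewrite atanK tanD// atanK.
have h1 : 0 < 1 - t * t.
  have c0 : 0 < cos (atan t) by apply: cos_gt0_pihalf; exact: m.
  have : 0 < cos (atan t + atan t).
    by apply: cos_gt0_pihalf; move: inI; rewrite in_itv.
  have sE : sin (atan t) = t * cos (atan t).
    by rewrite -{2}[t]atanK /tan mulfVK.
  rewrite cosD sE (_ : _ - _ = (1 - t * t) * cos (atan t) ^+ 2); last by ring.
  by rewrite pmulr_lgt0// exprn_gt0.
have t3 : 0 < t * t * t by rewrite !mulr_gt0.
by rewrite ltr_pdivlMr//; nra.
Qed.

(* By concavity of [atan] on [0, +oo[, this much phase is lost when two phases
   with tangents at least [t] merge. *)
Definition atan_gap t := atan t + atan t - atan (t + t).

Lemma atan_gap_gt0 t : 0 < t -> 0 < atan_gap t.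
Proof. by move=> t0; rewrite subr_gt0 atan_double_lt. Qed.

(** By concavity the loss can only shrink when first [y] and then [x] is lowered to [t]. *)
Lemma atanD_le_gap t x y : 0 < t -> t <= x -> t <= y ->
  atan (x + y) <= atan x + atan y - atan_gap t.
Proof.
move=> t0 tx ty; have x0 := le_trans (ltW t0) tx.
have h1 := @atanB_le t y x (ltW t0) ty x0.
have h2 := @atanB_le t x t (ltW t0) tx (ltW t0).
by move: h1 h2; rewrite /atan_gap [y + x]addrC [t + x]addrC; lra.
Qed.

End trigonometry.

(** * Integrals and Picone's inequality on an edge *)

Section edge_calculus.
Variable R : realType.
Notation mu := (@lebesgue_measure R).
Implicit Types (f g h : R -> R) (l k x y : R).

Lemma in_L2_integrable_sqr l h : in_L2 l h ->
  mu.-integrable `[0, l] (EFin \o (fun x => h x ^+ 2)).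
Proof.
move=> [mh h2]; apply/integrableP; split.
  by apply/measurable_EFinP; exact: measurable_realfun.measurable_funX.
under eq_integral do rewrite /= ger0_norm ?sqr_ge0//.
exact: h2.
Qed.

Lemma integrable_cst_itv (c l : R) (b0 b1 : bool) x y :
  mu.-integrable [set` Interval (BSide b0 x) (BSide b1 y)] (EFin \o cst c).
Proof.
apply/integrableP; split => /=; first exact/measurable_EFinP/measurable_cst.
have muE := lebesgue_measure_itv (Interval (BSide b0 x) (BSide b1 y)).
rewrite integral_cst// [X in (_ * X)%E]muE /=.
by case: ifPn => _; rewrite ?mule0// -EFinB -EFinM ltry.
Qed.

Lemma in_L2_integrable l h : in_L2 l h -> mu.-integrable `[0, l] (EFin \o h).
Proof.
move=> hL2; have [mh _] := hL2.
have i1 := @integrable_cst_itv 1 l true false 0 l.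
have i2 := in_L2_integrable_sqr hL2.
apply: (le_integrable _ _ _ (integrableD _ i1 i2)) => //.
  by apply/measurable_EFinP.
move=> x _ /=; rewrite lee_fin [leRHS]ger0_norm ?addr_ge0 ?sqr_ge0//.
rewrite -[h x ^+ 2]real_normK ?num_real//.
by have := normr_ge0 (h x); set z := `|h x|; nra.
Qed.

Lemma Rintegral_subitv l h x y : mu.-integrable `[0, l] (EFin \o h) ->
  0 <= x -> x <= y -> y <= l ->
  \int[mu]_(t in `[0, y]) h t - \int[mu]_(t in `[0, x]) h t =
  \int[mu]_(t in `]x, y]) h t.
Proof.
move=> ih x0 xy yl; apply: Rintegral_itvB; rewrite ?bnd_simp//.
by apply: integrableS ih => //; apply: subset_itvl; rewrite bnd_simp.
Qed.

Lemma integrable_subitv l h x y : mu.-integrable `[0, l] (EFin \o h) ->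
  0 <= x -> y <= l -> mu.-integrable `]x, y] (EFin \o h).
Proof.
move=> ih x0 yl; apply: integrableS ih => // z /=; rewrite !in_itv/=.
by move=> /andP[xz zy]; rewrite (le_trans x0 (ltW xz)) (le_trans zy).
Qed.

Lemma Rintegral_cst_itv x y (c : R) : x <= y ->
  \int[mu]_(t in `]x, y]) c = c * (y - x).
Proof.
move=> xy; have muE := lebesgue_measure_itv `]x, y].
rewrite Rintegral_cst// [X in fine X]muE /= lte_fin.
by case: ltP => [//|yx]; rewrite (le_anti (introT andP (conj xy yx))) subrr.
Qed.

(** Expansion of the integral of (g - c)^2 >= 0. Being linear in the integral of [g], the bound
    turns into one on increments of f, with [c] free to be chosen. *)
Lemma Rintegral_sqr_ge l g x y (c : R) : in_L2 l g ->
  0 <= x -> x <= y -> y <= l ->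
  2 * c * \int[mu]_(t in `]x, y]) g t - c ^+ 2 * (y - x) <=
  \int[mu]_(t in `]x, y]) (g t ^+ 2).
Proof.
move=> gL2 x0 xy yl.
have ig := integrable_subitv (in_L2_integrable gL2) x0 yl.
have ig2 := integrable_subitv (in_L2_integrable_sqr gL2) x0 yl.
have iz : mu.-integrable `]x, y] (EFin \o (fun z => 2 * c * g z)).
  apply: (eq_integrable _ _ _ _ (@integrableZl _ _ _ mu _ _ (2 * c) _ ig)) => //.
have ic := integrable_cst_itv (c ^+ 2) l false false x y.
rewrite -Rintegral_cst_itv// -RintegralZl// -RintegralB//.
apply: le_Rintegral => //.
  by apply: (eq_integrable _ _ _ _ (@integrableB _ _ _ mu _ _ _ _ iz ic)) => // z _ /=.

by move=> t _; have := sqr_ge0 (g t - c); nra.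
Qed.

Lemma in_H1_sub l f g x y : in_H1 l f g -> 0 <= x -> x <= y -> y <= l ->
  f y - f x = \int[mu]_(t in `]x, y]) g t.
Proof.
move=> [_ gL2 fE] x0 xy yl.
rewrite -(Rintegral_subitv (in_L2_integrable gL2) x0 xy yl).
rewrite (fE y) ?in_itv/= ?(le_trans x0)//.
rewrite (fE x) ?in_itv/= ?x0 ?(le_trans xy)//; ring.
Qed.

(** Cauchy-Schwarz, from [Rintegral_sqr_ge] with c the mean slope of f; it makes f Hölder continuous
    with exponent 1/2. *)
Lemma in_H1_sqr_le l f g x y : in_H1 l f g -> 0 <= x -> x <= y -> y <= l ->
  (f y - f x) ^+ 2 <= (y - x) * fine (sqnorm l g).
Proof.
move=> fg x0 xy yl; have [_ gL2 _] := fg.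
have [->|neq] := eqVneq x y; first by rewrite !subrr expr0n mul0r.
have h0 : 0 < y - x by rewrite subr_gt0 lt_neqAle neq.
have := Rintegral_sqr_ge ((f y - f x) / (y - x)) gL2 x0 xy yl.
rewrite -(in_H1_sub fg)// => h1.
have h2 : \int[mu]_(t in `]x, y]) (g t ^+ 2) <= fine (sqnorm l g).
  rewrite -(@Rintegral_subitv l)//; last exact: in_L2_integrable_sqr.
  apply: (@le_trans _ _ (\int[mu]_(t in `[0, y]) (g t ^+ 2))).
    by rewrite lerBlDr lerDl; apply: Rintegral_ge0 => z _; exact: sqr_ge0.
  rewrite -subr_ge0 (_ : fine _ = \int[mu]_(t in `[0, l]) (g t ^+ 2))//.
  rewrite (@Rintegral_subitv l)//; first last.
  - exact: le_trans xy.
  - exact: in_L2_integrable_sqr.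
  by apply: Rintegral_ge0 => z _; exact: sqr_ge0.
have {h1}h1 := le_trans h1 h2.
rewrite mulrC -ler_pdivrMr//; apply: le_trans h1.
rewrite le_eqVlt; apply/orP; left; apply/eqP; field.
by rewrite gt_eqF.
Qed.

(** Replaces the sign of a derivative that exists only almost everywhere: n equal steps of length at
    most d lose at most e in total. *)
Lemma monotone_of_small_steps l (F : R -> R) : 0 < l ->
  (forall e, 0 < e -> exists2 d, 0 < d & forall x y, 0 <= x -> x <= y ->
    y <= l -> y - x <= d -> - e * (y - x) <= F y - F x) ->
  F 0 <= F l.
Proof.
move=> l0 H; apply/ler_addgt0Pr => e e0.
have [d d0 Hd] := H (e / l) (divr_gt0 e0 l0).
pose n := (Num.truncn (l / d)).+1.
have n0 : (0 : R) < n%:R by rewrite ltr0n.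
have nd : l / n%:R <= d.
  rewrite ler_pdivrMr// mulrC -ler_pdivrMr//.
  by rewrite ltW// truncnS_gt.
have step m : (m <= n)%N -> F 0 - e * (m%:R / n%:R) <= F (m%:R * (l / n%:R)).
  elim: m => [_|m IH mn]; first by rewrite !mul0r mulr0 subr0.
  have := IH (ltnW mn).
  have hd : 0 <= l / n%:R by rewrite divr_ge0// ltW.
  have E : m.+1%:R * (l / n%:R) - m%:R * (l / n%:R) = l / n%:R.
    by rewrite -natr1; ring.
  have := Hd (m%:R * (l / n%:R)) (m.+1%:R * (l / n%:R)).
  rewrite E mulr_ge0// ler_wpM2r ?ler_nat// nd.
  have -> : m.+1%:R * (l / n%:R) <= l.
    rewrite mulrA ler_pdivrMr// mulrC ler_wpM2l ?ler_nat//; exact: ltW.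
  move=> /(_ isT isT isT isT).
  have -> : - (e / l) * (l / n%:R) = - (e / n%:R) by field; rewrite !gt_eqF.
  have -> : m.+1%:R / n%:R = m%:R / n%:R + n%:R^-1 :> R.
    by rewrite -natr1 mulrDl mul1r.
  rewrite mulrDr; lra.
have := step n (leqnn n); rewrite divff ?gt_eqF// mulr1 mulrC divfK ?gt_eqF//.
lra.
Qed.

End edge_calculus.

Section picone.
Variable R : realType.
Notation mu := (@lebesgue_measure R).
Implicit Types (f g : R -> R) (l k a x y : R).

Lemma tan_le a b : - (pi / 2) < a -> a <= b -> b < pi / 2 -> tan a <= tan b :> R.
Proof.
move=> a0; rewrite le_eqVlt => /predU1P[->//|ab] b0.
by rewrite ltW// ltr_tan// in_itv/= ?a0 ?b0 ?(lt_trans ab)// (lt_trans a0).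
Qed.

Lemma tanB_le_lip a b M : - (pi / 2) < a -> a <= b -> b < pi / 2 ->
  `|tan a| <= M -> `|tan b| <= M ->
  tan b - tan a <= (1 + M ^+ 2) * (b - a) :> R.
Proof.
move=> a0 ab b0 aM bM.
have cpos x : x \in `[a, b] -> 0 < cos x.
  rewrite in_itv/= => /andP[ax xb]; apply: cos_gt0_pihalf.
  by rewrite (lt_le_trans a0 ax) (le_lt_trans xb b0).
have [x|x xI|c cI ->] := @MVT_segment R tan (fun x => (cos x) ^-2) _ _ ab.
- move=> /subset_itv_oo_cc xI; apply: is_derive_tan.
  by rewrite gt_eqF// cpos.
- have : {within `[a, b], continuous tan}; last exact.
  apply/continuous_in_subspaceT => z; rewrite mem_setE => zI.
  by apply: continuous_tan; rewrite gt_eqF// cpos.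
rewrite ler_wpM2r ?subr_ge0// cos2_tan2 ?gt_eqF ?cpos// lerD2l.
move: cI; rewrite in_itv/= => /andP[ac cb].
have h1 := tan_le a0 ac (le_lt_trans cb b0).
have h2 := tan_le (lt_le_trans a0 ac) cb b0.
move: aM bM; rewrite !ler_norml => /andP[? ?] /andP[? ?]; nra.
Qed.

(** Formally F' = (g - Q f)^2 >= 0 for the function [F] below, because [Q] solves the Riccati
    equation Q' = -(k^2 + Q^2). As g is only square integrable, increments of [F] over short
    intervals are estimated instead. *)
Lemma picone l f g k a : 0 < l -> 0 < k -> in_H1 l f g ->
  - (pi / 2) < a -> a + k * l < pi / 2 ->
  k * tan a * f l ^+ 2 - k * tan (a + k * l) * f 0 ^+ 2 <=
  fine (sqnorm l g) - k ^+ 2 * fine (sqnorm l f).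
Proof.
move=> l0 k0 fg a0 al; have [fL2 gL2 fE] := fg.
pose Q x := k * tan (a + k * (l - x)).
pose I2 (h : R -> R) x := \int[mu]_(t in `[0, x]) (h t ^+ 2).
pose F x := I2 g x - k ^+ 2 * I2 f x - Q x * f x ^+ 2.
suff : F 0 <= F l.
  rewrite /F /I2 /Q set_itv1 !Rintegral_set1 !subr0 subrr !mulr0 addr0 subr0.
  rewrite -![fine (sqnorm _ _)]/(\int[mu]_(t in `[0, l]) _); lra.
set N := fine (sqnorm l g).
have N0 : 0 <= N by apply: fine_ge0; apply: integral_ge0 => x _; rewrite lee_fin sqr_ge0.
have ang x : 0 <= x -> x <= l -> - (pi / 2) < a + k * (l - x) < pi / 2.
  move=> x0 xl; have := mulr_ge0 (ltW k0) x0.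
  have : 0 <= k * (l - x) by rewrite mulr_ge0 ?subr_ge0// ltW.
  by rewrite mulrBr; lra.
pose M : R := `|tan a| + `|tan (a + k * l)|.
have M0 : 0 <= M by rewrite addr_ge0.
have tM x : 0 <= x -> x <= l -> `|tan (a + k * (l - x))| <= M.
  move=> x0 xl; have /andP[h1 h2] := ang x x0 xl.
  have h3 : tan a <= tan (a + k * (l - x)).
    by apply: tan_le => //; rewrite lerDl mulr_ge0 ?subr_ge0// ltW.
  have h4 : tan (a + k * (l - x)) <= tan (a + k * l).
    by apply: tan_le => //; rewrite lerD2l ler_pM2l//; lra.
  rewrite /M ler_norml; have := ler_norm (- tan a); have := ler_norm (tan (a + k * l)).
  rewrite normrN; have := normr_ge0 (tan a); have := normr_ge0 (tan (a + k * l)); lra.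
pose B : R := `|f 0| + (1 + l * N).
have B0 : 0 <= B by rewrite /B !addr_ge0 ?mulr_ge0// ltW.
have fB x : 0 <= x -> x <= l -> `|f x| <= B.
  move=> x0 xl; have h := in_H1_sqr_le fg (lexx 0) x0 xl.
  have h2 : (x - 0) * N <= l * N by rewrite ler_wpM2r// subr0.
  have h3 := le_trans h h2.
  rewrite -[f x](subrK (f 0)) addrC (le_trans (ler_normD _ _))// lerD2l.
  rewrite (le_trans _ (_ : 1 + (f x - f 0) ^+ 2 <= _)) ?lerD2l//.
  rewrite -[in leRHS]real_normK ?num_real//.
  by have := sqr_ge0 (`|f x - f 0| - 1); have := normr_ge0 (f x - f 0); nra.
pose K : R := k * M.
pose K1 : R := k ^+ 2 * (1 + M ^+ 2).
have K0 : 0 <= K by rewrite mulr_ge0// ltW.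
have K10 : 0 <= K1 by rewrite mulr_ge0 ?addr_ge0 ?sqr_ge0.
have QK x : 0 <= x -> x <= l -> `|Q x| <= K.
  by move=> x0 xl; rewrite normrM gtr0_norm// ler_pM2l// tM.
apply: monotone_of_small_steps => // e e0.
(* The error [e] per unit length is split in two halves: [Z] pays for the variation of [Q] over a
   step, [W] for the oscillation of [f], which is at most [w] as soon as h (N + 1) <= w^2. *)
pose W : R := K ^+ 2 * B + k ^+ 2 * 2 * B + 1.
have W0 : 0 < W by rewrite ltr_wpDl// addr_ge0// !mulr_ge0// ltW.
pose w := e / (2 * W).
have w0 : 0 < w by rewrite divr_gt0// mulr_gt0.
pose Z : R := K * K1 * B ^+ 2 + 1.
have Z0 : 0 < Z by apply: ltr_wpDl => //; apply: mulr_ge0; [exact: mulr_ge0|exact: sqr_ge0].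
exists (Num.min (w ^+ 2 / (N + 1)) (e / (2 * Z))).
  by rewrite lt_min !divr_gt0// ?exprn_gt0// ?mulr_gt0// ltr_wpDl.
move=> x y x0 xy yl; rewrite le_min => /andP[d1 d2].
have xl := le_trans xy yl; have y0 := le_trans x0 xy.
set h := y - x in d1 d2 *.
have h0 : 0 <= h by rewrite subr_ge0.
have osc s t : x <= s -> s <= t -> t <= y -> `|f t - f s| <= w.
  move=> xs st ty.
  rewrite -(@ler_pXn2r _ 2)// ?nnegrE ?(ltW w0)// real_normK ?num_real//.
  have := in_H1_sqr_le fg (le_trans x0 xs) st (le_trans ty yl).
  move=> /le_trans; apply; rewrite -/N.
  have h1 : (t - s) * N <= h * (N + 1).
    by rewrite ler_pM ?subr_ge0//; [rewrite /h; lra|lra].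
  by apply: (le_trans h1); rewrite -ler_pdivlMr// ltr_wpDl.
have fxB := fB x x0 xl; have fyB := fB y y0 yl.
(* In [\int (g - c)^2 >= 0] the choice [c = Q y * (f x + f y) / 2] produces the
   increment of [Q f^2] up to small terms. *)
have Ig : I2 g y - I2 g x >= Q y * (f y ^+ 2 - f x ^+ 2) -
    (Q y * ((f x + f y) / 2)) ^+ 2 * h.
  rewrite /I2 (Rintegral_subitv (in_L2_integrable_sqr gL2))//.
  apply: le_trans (Rintegral_sqr_ge (Q y * ((f x + f y) / 2)) gL2 x0 xy yl).
  by rewrite -(in_H1_sub fg)// -/h le_eqVlt; apply/orP; left; apply/eqP; field.
have If : I2 f y - I2 f x <= (f x ^+ 2 + 2 * B * w) * h.
  rewrite /I2 (Rintegral_subitv (in_L2_integrable_sqr fL2))// -Rintegral_cst_itv//.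
  apply: le_Rintegral => //.
  - exact: (integrable_subitv (in_L2_integrable_sqr fL2)).
  - exact: integrable_cst_itv.
  move=> t /=; rewrite in_itv/= => /andP[/ltW xt ty].
  have := osc x t (lexx _) xt ty.
  have := fB t (le_trans x0 xt) (le_trans ty yl).
  move: fxB; rewrite !ler_norml => /andP[? ?] /andP[? ?] /andP[? ?].
  have [?|?] := leP 0 (f t + f x); nra.
(* The Riccati equation for increments, from [tanB_ge]. *)
have dQ1 : h * (k ^+ 2 + Q x * Q y) <= Q x - Q y.
  have /andP[a1 a2] := ang x x0 xl; have /andP[a3 a4] := ang y y0 yl.
  have := @tanB_ge _ (a + k * (l - x)) (a + k * (l - y)) a3 _ a2.
  rewrite lerD2l ler_pM2l// lerD2l lerN2 => /(_ xy).
  rewrite -(ler_pM2l k0) (_ : a + k * (l - x) - _ = k * h); last first.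
    by rewrite /h; ring.
  by rewrite /Q; nra.
have dQ2 : Q x - Q y <= K1 * h.
  have /andP[a1 a2] := ang x x0 xl; have /andP[a3 a4] := ang y y0 yl.
  have := @tanB_le_lip (a + k * (l - y)) (a + k * (l - x)) M a3 _ a2
    (tM y y0 yl) (tM x x0 xl).
  rewrite lerD2l ler_pM2l// lerD2l lerN2 => /(_ xy).
  rewrite -(ler_pM2l k0) (_ : a + k * (l - x) - _ = k * h); last first.
    by rewrite /h; ring.
  by rewrite /Q /K1 -mulrBr => /le_trans; apply; rewrite le_eqVlt; apply/orP; left; apply/eqP; ring.
have dQ0 : 0 <= Q x - Q y.
  have /andP[a1 a2] := ang x x0 xl; have /andP[a3 a4] := ang y y0 yl.
  rewrite /Q -mulrBr mulr_ge0 ?(ltW k0)// subr_ge0 tan_le//.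
  by rewrite lerD2l ler_pM2l// lerD2l lerN2.
(* The terms of order h cancel up to the variation of [Q] and [f] over the step, which was made
   small above. *)
have err : - (e * h) <= h * (Q x * Q y * f x ^+ 2 -
    (Q y * ((f x + f y) / 2)) ^+ 2 - k ^+ 2 * (2 * B * w)).
  rewrite [e * h]mulrC -mulrN ler_wpM2l//.
  have QyK := QK y y0 yl.
  have fxB2 : f x ^+ 2 <= B ^+ 2.
    by rewrite -[f x ^+ 2]real_normK ?num_real// ler_pXn2r ?nnegrE.
  have e1 : `|Q y * ((Q x - Q y) * f x ^+ 2)| <= e / 2.
    rewrite normrM; apply: (@le_trans _ _ (K * (K1 * h * B ^+ 2))).
      apply: ler_pM => //; rewrite ger0_norm ?(mulr_ge0 dQ0 (sqr_ge0 _))//.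
      by apply: ler_pM => //; exact: sqr_ge0.
    rewrite (_ : K * _ = (K * K1 * B ^+ 2) * h); last by ring.
    apply: (@le_trans _ _ (Z * h)).
      by rewrite ler_wpM2r// /Z lerDl.
    apply: (@le_trans _ _ (Z * (e / (2 * Z)))).
      by rewrite ler_wpM2l// ltW.
    by rewrite le_eqVlt; apply/orP; left; apply/eqP; field; rewrite gt_eqF.
  have e2 : `|Q y ^+ 2 * (f x ^+ 2 - ((f x + f y) / 2) ^+ 2)| <= K ^+ 2 * (B * w).
    rewrite normrM; apply: ler_pM => //.
      by rewrite normrX ler_pXn2r ?nnegrE.
    rewrite (_ : _ - _ = ((3 * f x + f y) / 4) * (f x - f y)); last by field.
    rewrite normrM; apply: ler_pM => //; last first.
      by rewrite distrC osc.
    by move: fxB fyB; rewrite !ler_norml => /andP[? ?] /andP[? ?]; lra.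
  have e3 : K ^+ 2 * (B * w) + k ^+ 2 * (2 * B * w) <= e / 2.
    rewrite (_ : _ + _ = (K ^+ 2 * B + k ^+ 2 * 2 * B) * w); last by ring.
    apply: (@le_trans _ _ (W * w)); first by rewrite ler_wpM2r ?(ltW w0)// /W lerDl.
    by rewrite /w le_eqVlt; apply/orP; left; apply/eqP; field; rewrite gt_eqF.
  move: e1 e2; rewrite !ler_norml => /andP[e1 _] /andP[e2 _].
  rewrite (_ : Q x * Q y * f x ^+ 2 - (Q y * ((f x + f y) / 2)) ^+ 2 =
    Q y * ((Q x - Q y) * f x ^+ 2) +
    Q y ^+ 2 * (f x ^+ 2 - ((f x + f y) / 2) ^+ 2)); last by ring.
  lra.
have If2 : k ^+ 2 * (I2 f y - I2 f x) <= k ^+ 2 * ((f x ^+ 2 + 2 * B * w) * h).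
  by rewrite ler_wpM2l// sqr_ge0.
have dQ3 := ler_wpM2r (sqr_ge0 (f x)) dQ1.
rewrite mulNr; apply: (le_trans err).
rewrite /F; move: Ig If2 dQ3; nra.
Qed.

(** Since [tan] is odd, reversing the edge amounts to [picone] with the phase -(a + k l). *)
Lemma picone_rev l f g k a : 0 < l -> 0 < k -> in_H1 l f g ->
  - (pi / 2) < a -> a + k * l < pi / 2 ->
  k * tan a * f 0 ^+ 2 - k * tan (a + k * l) * f l ^+ 2 <=
  fine (sqnorm l g) - k ^+ 2 * fine (sqnorm l f).
Proof.
move=> l0 k0 fg a0 al.
have := @picone l f g k (- (a + k * l)) l0 k0 fg.
rewrite (_ : - (a + k * l) + k * l = - a); last by ring.
rewrite !tanN ltrN2 ltrNl => /(_ al a0); lra.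
Qed.

End picone.

(** * Growing a finite subgraph and stripping it off *)

Section growing.
Variables (R : realType) (G : metric_graph R).
Notation V := (vertex G).
Notation E := (edge G).

(** Oriented edges. A loop gives two darts with the same tail, so counting darts counts a loop twice
    in the degree. *)
Definition dart := (E * bool)%type.
Definition dtail (d : dart) : V := if d.2 then source d.1 else target d.1.
Definition dhead (d : dart) : V := if d.2 then target d.1 else source d.1.
Definition incident (e : E) (v : V) := (v == source e) || (v == target e).

Implicit Types (B C : seq E * seq V) (d : dart) (e : E) (v w u r : V).

(* A finite subgraph is a pair of a list of edges and a list of vertices, the
   most recent ones first. *)
Inductive step B : seq E * seq V -> Prop :=
| step_leaf d : dtail d \in B.2 -> dhead d \notin B.2 -> d.1 \notin B.1 ->
    step B (d.1 :: B.1, dhead d :: B.2)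
| step_chord e : source e \in B.2 -> target e \in B.2 -> e \notin B.1 ->
    step B (e :: B.1, B.2).

Inductive grow B : seq E * seq V -> Prop :=
| grow0 : grow B B
| growS C D : grow B C -> step C D -> grow B D.

Definition ground r : seq E * seq V := ([::], [:: r]).

Definition closed_in B := forall e, e \in B.1 ->
  source e \in B.2 /\ target e \in B.2.

Lemma grow_trans B C D : grow B C -> grow C D -> grow B D.
Proof. by move=> bc; elim=> // ? ? _ bx s; exact: growS bx s. Qed.

Lemma step_sub B C : step B C -> {subset B.1 <= C.1} /\ {subset B.2 <= C.2}.
Proof. by case=> *; split=> x; rewrite /= ?inE => ->; rewrite ?orbT. Qed.

Lemma grow_sub B C : grow B C -> {subset B.1 <= C.1} /\ {subset B.2 <= C.2}.
Proof.
elim=> [|{}C D _ [h1 h2] /step_sub[h3 h4]]; first by split.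
by split=> x xB; [apply/h3/h1|apply/h4/h2].
Qed.

Lemma grow_uniq B C : grow B C -> uniq B.1 -> uniq B.2 -> uniq C.1 /\ uniq C.2.
Proof.
move=> bc u1 u2; elim: bc => // {}C D _ [h1 h2] [d _ h3 h4|e _ _ h3] /=.
  by rewrite h4 h3.
by rewrite h3.
Qed.

Lemma incident_dart e v : incident e v ->
  exists2 d : dart, d.1 = e & dtail d = v.
Proof. by case/orP => /eqP->; [exists (e, true)|exists (e, false)]. Qed.

Lemma dart_ends d : (source d.1 = dtail d /\ target d.1 = dhead d) \/
  (source d.1 = dhead d /\ target d.1 = dtail d).
Proof. by case: d => e [|]; rewrite /dtail /dhead /=; [left|right]. Qed.

Lemma step_closed B C : step B C -> closed_in B -> closed_in C.
Proof.
case=> [d tB hB dB|e sB tB eB] cB x /=; rewrite inE => /predU1P[->|/cB[h1 h2]].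
- by rewrite !inE; have [[-> ->]|[-> ->]] := dart_ends d; rewrite eqxx tB orbT.
- by rewrite !inE h1 h2 !orbT.
- by [].
- by [].
Qed.

Lemma grow_closed B C : grow B C -> closed_in B -> closed_in C.
Proof. by elim=> // {}C D _ IH s /IH; exact: step_closed. Qed.

Lemma ground_closed r : closed_in (ground r).
Proof. by []. Qed.

Lemma step_incident B e v : v \in B.2 -> incident e v -> e \notin B.1 ->
  exists2 vs, step B (e :: B.1, vs) & {subset B.2 <= vs}.
Proof.
move=> vB /incident_dart[d <- dv] eB.
have [hB|hB] := boolP (dhead d \in B.2).
  exists B.2 => //; apply: step_chord => //;
    by have [[h1 h2]|[h1 h2]] := dart_ends d; rewrite ?h1 ?h2 ?dv.
exists (dhead d :: B.2); first by apply: step_leaf; rewrite ?dv.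
by move=> x xB; rewrite inE xB orbT.
Qed.

Inductive vpath u : V -> Prop :=
| vpath0 : vpath u u
| vpathS d : vpath u (dtail d) -> vpath u (dhead d).

Lemma grow_dart B d : closed_in B -> dtail d \in B.2 ->
  exists2 C, grow B C & d.1 \in C.1 /\ dhead d \in C.2.
Proof.
move=> cB tB; have [dB|dB] := boolP (d.1 \in B.1).
  exists B; first exact: grow0.
  by split=> //; have [h1 h2] := cB _ dB; have [[_ <-]|[<- _]] := dart_ends d.
have /(step_incident tB)/(_ dB)[vs st _] : incident d.1 (dtail d).
  by rewrite /incident; have [[-> _]|[_ ->]] := dart_ends d; rewrite eqxx ?orbT.
exists (d.1 :: B.1, vs); first exact: growS (grow0 _) st.
have /(_ d.1) := step_closed st cB; rewrite /= inE eqxx => /(_ isT)[h1 h2].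
split=> //.
by have [[_ <-]|[<- _]] := dart_ends d.
Qed.

Lemma grow_vertex B u v : closed_in B -> u \in B.2 -> vpath u v ->
  exists2 C, grow B C & v \in C.2.
Proof.
move=> cB uB; elim=> [|d _ [C BC dC]]; first by exists B => //; exact: grow0.
have [D CD [_ hD]] := grow_dart (grow_closed BC cB) dC.
by exists D => //; exact: grow_trans BC CD.
Qed.

Lemma grow_edges B (F : seq E) : closed_in B -> B.2 != [::] ->
  (forall u v, vpath u v) ->
  exists2 C, grow B C & {subset F <= C.1}.
Proof.
move=> cB; case vE : B.2 => [//|r vs] _ conn.
elim: F => [|e F [C BC FC]]; first by exists B => //; exact: grow0.
have rC : r \in C.2 by apply: (grow_sub BC).2; rewrite vE inE eqxx.
have [D CD sD] := grow_vertex (grow_closed BC cB) rC (conn r (source e)).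
have cD := grow_closed CD (grow_closed BC cB).
have [K DK [eK _]] := @grow_dart D (e, true) cD sD.
exists K; first exact: grow_trans BC (grow_trans CD DK).
move=> x; rewrite inE => /predU1P[->//|/FC xC].
by apply: (grow_sub DK).1; apply: (grow_sub CD).1.
Qed.

(** Only a leaf step adds a vertex, so the growth can be cut just before [v] appears. After the leaf
    step [v] is met by one edge only, and the growth can be continued in another order. *)
Lemma first_visit B C v : grow B C -> v \in C.2 -> v \notin B.2 ->
  exists D d, [/\ grow B D, dtail d \in D.2, dhead d = v, v \notin D.2 &
    d.1 \notin D.1].
Proof.
move=> BC; elim: BC => [vB /negP//|{}C D BC IH CD vD vB].
have [vC|vC] := boolP (v \in C.2); first exact: IH.
case: CD vD => [d tC hC dC|e sC tC eC] /=; last by rewrite (negbTE vC).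
rewrite inE (negbTE vC) orbF => /eqP vE.
by exists C, d; split; rewrite // vE.
Qed.

End growing.

(** * Stripping one edge: energy, load and phase *)

Section stripping.
Variables (R : realType) (G : metric_graph R).
Notation V := (vertex G).
Notation E := (edge G).
Variables (W : E -> R) (F : V -> R) (k : R).
Hypothesis k0 : 0 < k.
Hypothesis W_ge : forall (d : dart G) a, - (pi / 2) < a ->
  a + k * len d.1 < pi / 2 ->
  k * tan a * F (dhead d) - k * tan (a + k * len d.1) * F (dtail d) <= W d.1.

Implicit Types (B C : seq E * seq V) (d : dart G) (e : E) (v w u r : V).
Implicit Types T : V -> R.

Definition total_len (s : seq E) : R := \sum_(e <- s) len e.

(* [T v] is the tangent of the phase carried by the part of the graph that has
   been stripped off at [v]. *)
Definition energy B T : R :=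
  \sum_(e <- B.1) W e - k * \sum_(v <- B.2) T v * F v.

(** The phase that the remaining edges can still produce, plus the phases already loaded. Stripping
    never increases it, and merging two branches lowers it. *)
Definition phase B T : R := k * total_len B.1 + \sum_(v <- B.2) atan (T v).

Definition load T u (X : R) v : R := if v == u then T v + X else T v.

Lemma sum_load (g : V -> R -> R) vs T u X : uniq vs -> u \in vs ->
  \sum_(v <- vs) g v (load T u X v) =
  \sum_(v <- vs) g v (T v) + (g u (T u + X) - g u (T u)).
Proof.
move=> uvs uin; rewrite !(bigD1_seq u)//= /load eqxx.
rewrite (eq_bigr (fun v => g v (T v))) => [|v /negbTE->//]; ring.
Qed.

Lemma le_load T u X v : 0 <= X -> T v <= load T u X v.
Proof. by move=> X0; rewrite /load; case: ifP => // _; rewrite lerDl. Qed.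

Lemma tan_ge0 (a : R) : 0 <= a -> a < pi / 2 -> 0 <= tan a.
Proof.
move=> a0 ap; rewrite -(@tan0 R) tan_le//.
by rewrite oppr_lt0 divr_gt0// pi_gt0.
Qed.

Lemma atanD_tan_le (x a : R) : 0 <= x -> 0 <= a -> a < pi / 2 ->
  atan (x + tan a) <= atan x + a.
Proof.
move=> x0 a0 ap; apply: le_trans (atanD_le x0 (tan_ge0 a0 ap)) _.
rewrite tanK ?in_itv/= ?ap ?andbT//.
by rewrite (lt_le_trans _ a0)// oppr_lt0 divr_gt0// pi_gt0.
Qed.

Lemma atanD_tan_le_gap (t x a : R) : 0 < t -> t <= x -> 0 <= a -> a < pi / 2 ->
  t <= tan a -> atan (x + tan a) <= atan x + a - atan_gap t.
Proof.
move=> t0 tx a0 ap ta; apply: le_trans (atanD_le_gap t0 tx ta) _.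
rewrite tanK ?in_itv/= ?ap ?andbT//.
by rewrite (lt_le_trans _ a0)// oppr_lt0 divr_gt0// pi_gt0.
Qed.

(** [a] is the phase at the free end. Only the products with [F] have to agree there: where [F]
    vanishes, any [a] is allowed, even a negative one, which is how a second Dirichlet vertex lowers
    the phase. [g] is the phase lost when the branch merges at the tail. *)
Lemma leaf_strip B d T a g : uniq B.2 -> dtail d \in B.2 ->
  - (pi / 2) < a -> a + k * len d.1 < pi / 2 ->
  T (dhead d) * F (dhead d) = tan a * F (dhead d) ->
  let X := tan (a + k * len d.1) in
  atan (T (dtail d) + X) <= atan (T (dtail d)) + (a + k * len d.1) - g ->
  let C := (d.1 :: B.1, dhead d :: B.2) in
  energy B (load T (dtail d) X) <= energy C T /\
  phase B (load T (dtail d) X) <= phase C T - atan (T (dhead d)) + a - g.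
Proof.
move=> uB tB a0 al Ta X hX C; have Wd := W_ge a0 al.
rewrite -/X in Wd; split.
  rewrite /energy /C /= !big_cons (@sum_load (fun v x => x * F v))//.
  by rewrite Ta; nra.
rewrite /phase /total_len /C /= !big_cons (@sum_load (fun v x => atan x))//.
by move: hX; rewrite mulrDr; lra.
Qed.

(** Starting with the phase -k len/2 puts the zero of the tangent in the middle of the chord, so
    both ends receive the same load. The loads are added one after the other because for a loop they
    go to the same vertex. *)
Lemma chord_strip B e T : uniq B.2 -> source e \in B.2 -> target e \in B.2 ->
  k * len e < pi ->
  let X := tan (k * len e / 2) in
  let T1 := load T (source e) X in
  let T2 := load T1 (target e) X in
  let C := (e :: B.1, B.2) in
  energy B T2 <= energy C T /\
  phase B T2 = phase C T + (atan (T (source e) + X) - atan (T (source e))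
    - k * len e / 2) +
    (atan (T1 (target e) + X) - atan (T1 (target e)) - k * len e / 2).
Proof.
move=> uB sB tB kl X T1 T2 C.
have kl0 : 0 < k * len e by rewrite mulr_gt0// len_gt0.
have pi0 := @pi_gt0 R.
have := @W_ge (e, true) (- (k * len e / 2)).
rewrite /dhead /dtail /= tanN.
rewrite (_ : - (k * len e / 2) + k * len e = k * len e / 2); last by field.
rewrite -/X => Wd.
have {}Wd : - (k * X * (F (target e) + F (source e))) <= W e by apply: le_trans (Wd _ _); lra.
split.
  rewrite /energy /C /= !big_cons (@sum_load (fun v x => x * F v))//.
  rewrite (@sum_load (fun v x => x * F v))//.
  nra.
rewrite /phase /total_len /C /= !big_cons (@sum_load (fun v x => atan x))//.
rewrite (@sum_load (fun v x => atan x))//.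
by field.
Qed.

(** Half the edge is a lower bound for the new load that holds for leaves and chords alike. The gap
    [atan_gap t] is gained when this load meets an old one of size [t], or when the two halves of a
    loop meet each other. *)
Lemma strip1 B e vs T : uniq B.2 -> step B (e :: B.1, vs) ->
  (forall v, 0 <= T v) -> k * len e < pi ->
  (forall w, w \in vs -> w \notin B.2 -> atan (T w) + k * len e < pi / 2) ->
  exists T1, [/\ forall v, T v <= T1 v, energy B T1 <= energy (e :: B.1, vs) T,
    phase B T1 <= phase (e :: B.1, vs) T &
    forall v, v \in B.2 -> incident e v ->
      T v + tan (k * len e / 2) <= T1 v /\
      forall t, 0 < t -> t <= tan (k * len e / 2) ->
        t <= T v \/ source e = target e ->
        phase B T1 <= phase (e :: B.1, vs) T - atan_gap t].
Proof.
move=> uB st T0 kl Tkl.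
have kl0 : 0 < k * len e by rewrite mulr_gt0// len_gt0.
have pi0 := @pi_gt0 R.
have X0 : 0 <= tan (k * len e / 2) by apply: tan_ge0; lra.
inversion st as [d tB hB dB [de vsE]|e' sB tB eB [e'e vsE]]; subst.
  have a0 : 0 <= atan (T (dhead d)) by exact: atan_ge0.
  have al := Tkl _ (mem_head _ _) hB.
  have aN : - (pi / 2) < atan (T (dhead d)) by exact: atan_gtNpi2.
  have S g := @leaf_strip B d T _ g uB tB aN al.
  rewrite atanK in S; have {}S g := S g erefl.
  have X1 : tan (k * len d.1 / 2) <= tan (atan (T (dhead d)) + k * len d.1).
    apply: tan_le; lra.
  have X2 := le_trans X0 X1.
  have [|S1 S2] := S 0.
    by rewrite subr0; apply: atanD_tan_le => //; rewrite addr_ge0// ltW.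
  exists (load T (dtail d) (tan (atan (T (dhead d)) + k * len d.1))); split.
  - by move=> v; exact: le_load.
  - by [].
  - by move: S2; lra.
  (* The head is new, so the tail is the only endpoint in [B]; for the same reason the edge is no
     loop. *)
  move=> v vB iv; have {iv vB}-> : v = dtail d.
    have [[h1 h2]|[h1 h2]] := dart_ends d; case/orP: iv => /eqP vE;
      rewrite vE ?h1 ?h2//; by move: vB; rewrite vE ?h1 ?h2 (negbTE hB).
  split; first by rewrite /load eqxx lerD2l.
  move=> t t0 tX [tT|loop]; last first.
    have : dtail d = dhead d by have [[<- <-]|[<- <-]] := dart_ends d.
    by move=> E; rewrite E in tB; rewrite tB in hB.
  have [|_ S3] := S (atan_gap t).
    apply: atanD_tan_le_gap => //; first by rewrite addr_ge0// ltW.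
    exact: le_trans tX X1.
  by move: S3; lra.
have [S1 S2] := chord_strip T uB sB tB kl.
set X := tan _ in S1 S2 X0 *; set T1 := load T _ _ in S1 S2.
have T10 v : T v <= T1 v by exact: le_load.
have h1 : atan (T (source e) + X) - atan (T (source e)) - k * len e / 2 <= 0.
  have := @atanD_tan_le (T (source e)) (k * len e / 2) (T0 _); rewrite -/X.
  by move=> h; have := h ltac:(lra) ltac:(lra); lra.
have h2 : atan (T1 (target e) + X) - atan (T1 (target e)) - k * len e / 2 <= 0.
  have := @atanD_tan_le (T1 (target e)) (k * len e / 2) (le_trans (T0 _) (T10 _)).
  by rewrite -/X => h; have := h ltac:(lra) ltac:(lra); lra.
exists (load T1 (target e) X); split.
- by move=> v; apply: le_trans (T10 v) _; exact: le_load.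
- by [].
- by rewrite S2; lra.
move=> v vB iv; split.
  case/orP : iv => /eqP->.
    apply: le_trans (le_load _ _ _ X0); by rewrite /T1 /load eqxx.
  by rewrite {1}/load eqxx lerD2r.
move=> t t0 tX tT; rewrite S2.
(* One of the two additions has to take place on top of a load of size at least [t]: at the source
   if [T] is large there, otherwise at the target, where for a loop the first half is already
   present. *)
suff [h|h] : (atan (T (source e) + X) - atan (T (source e)) - k * len e / 2 <=
   - atan_gap t) \/
   (atan (T1 (target e) + X) - atan (T1 (target e)) - k * len e / 2 <=
   - atan_gap t) by lra.
have [tsv|ts] := pselect (t <= T (source e)).
  left; have := @atanD_tan_le_gap t (T (source e)) (k * len e / 2) t0 tsv.
  by rewrite -/X => h; have := h ltac:(lra) ltac:(lra) tX; lra.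
right; have tT1 : t <= T1 (target e).
  case: tT => [tv|loop]; last first.
    rewrite -loop /T1 /load eqxx; have := T0 (source e); lra.
  case/orP: iv tv => /eqP-> tv; first by case: ts.
  exact: le_trans tv (T10 _).
have := @atanD_tan_le_gap t _ (k * len e / 2) t0 tT1.
by rewrite -/X => h; have := h ltac:(lra) ltac:(lra) tX; lra.
Qed.

End stripping.

(** * Stripping whole subgraphs and the phase lost at a branching *)

Section gains.
Variables (R : realType) (G : metric_graph R).
Notation V := (vertex G).
Notation E := (edge G).
Variables (W : E -> R) (F : V -> R) (k : R).
Hypothesis k0 : 0 < k.
Hypothesis W_ge : forall (d : dart G) a, - (pi / 2) < a ->
  a + k * len d.1 < pi / 2 ->
  k * tan a * F (dhead d) - k * tan (a + k * len d.1) * F (dtail d) <= W d.1.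

Implicit Types (B C : seq E * seq V) (d : dart G) (e : E) (v w u r : V).
Implicit Types T : V -> R.
Notation energy := (energy W F k).
Notation phase := (phase k).

Lemma stepE B C : step B C -> exists e, C = (e :: B.1, C.2) /\ e \notin B.1.
Proof. by case=> [d _ _ dB|e _ _ eB]; [exists d.1|exists e]. Qed.

Lemma total_len_ge0 (s : seq E) : 0 <= total_len s.
Proof. by apply: sumr_ge0 => e _; rewrite ltW// len_gt0. Qed.

Lemma total_len_step B C : step B C -> total_len B.1 <= total_len C.1.
Proof.
move=> /stepE[e [-> _]]; rewrite /total_len /= big_cons lerDr ltW//.
exact: len_gt0.
Qed.

Lemma total_len_grow B C : grow B C -> total_len B.1 <= total_len C.1.
Proof. by elim=> // {}C D _ IH /total_len_step; exact: le_trans. Qed.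

Lemma le_total_len (s : seq E) e : e \in s -> len e <= total_len s.
Proof.
move=> es; rewrite /total_len (big_rem e)//= lerDl.
by apply: sumr_ge0 => x _; rewrite ltW// len_gt0.
Qed.

Lemma atan_le_phase B T w : w \in B.2 -> (forall v, 0 <= T v) ->
  k * total_len B.1 + atan (T w) <= phase B T.
Proof.
move=> wB T0; rewrite /phase lerD2l (big_rem w)//= lerDl.
by apply: sumr_ge0 => x _; exact: atan_ge0.
Qed.

(** A phase met on the way is at most [phase C T] minus k times the length not yet stripped, and [B]
    is never stripped. Subtracting [B] in the hypothesis is what permits k |C| >= pi/2. *)
Lemma strip_all B C T : grow B C -> uniq B.1 -> uniq B.2 ->
  (forall v, 0 <= T v) -> phase C T - k * total_len B.1 < pi / 2 ->
  exists T1, [/\ forall v, T v <= T1 v, energy B T1 <= energy C T &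
    phase B T1 <= phase C T].
Proof.
move=> BC uB1 uB2; elim: BC T => [T _ _|{}C D BC IH CD T T0 ph].
  by exists T; split.
have [uC1 uC2] := grow_uniq BC uB1 uB2.
have [e [DE eC]] := stepE CD.
have lenD : total_len D.1 = len e + total_len C.1.
  by rewrite DE /total_len big_cons.
have lBC := total_len_grow BC.
have lBC' : k * total_len B.1 <= k * total_len C.1 by rewrite ler_pM2l.
have pi0 := @pi_gt0 R.
have ph0 : k * total_len D.1 <= phase D T.
  by rewrite /phase lerDl; apply: sumr_ge0 => v _; exact: atan_ge0.
have lDE : k * total_len D.1 = k * len e + k * total_len C.1.
  by rewrite lenD mulrDr.
have st : step C (e :: C.1, D.2) by rewrite -DE.
have [||T1 [T1T E1 P1 _]] := @strip1 R G W F k k0 W_ge C e D.2 T uC2 st T0.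
- lra.
- move=> w wD wC; have := atan_le_phase wD T0; rewrite lDE.
  lra.
rewrite -DE in E1 P1.
have [v||T2 [T2T E2 P2]] := IH T1.
- exact: le_trans (T0 v) (T1T v).
- lra.
exists T2; split; [|lra|lra].
by move=> v; exact: le_trans (T1T v) (T2T v).
Qed.

Lemma energy0 B : energy B (cst 0) = \sum_(e <- B.1) W e.
Proof.
by rewrite /energy [X in k * X]big1 ?mulr0 ?subr0// => v _; exact: mul0r.
Qed.

Lemma phase0 B : phase B (cst 0) = k * total_len B.1.
Proof. by rewrite /phase [X in _ + X]big1 ?addr0// => v _; rewrite atan0. Qed.

(** When only the root is left, the energy is -k T(r) F(r) and the phase is atan (T r). *)
Lemma energy_root_ge r B T b : 0 <= F r -> grow (ground r) B ->
  (forall v, 0 <= T v) -> phase B T <= b -> b < pi / 2 ->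
  - k * tan b * F r <= energy B T.
Proof.
move=> Fr rB T0 Tb bpi.
have [||||T1 [T1T E1 P1]] := @strip_all (ground r) B T rB => //.
  by rewrite /total_len big_nil mulr0 subr0; exact: le_lt_trans bpi.
apply: le_trans E1; rewrite /energy /= big_nil big_seq1 sub0r !mulNr lerN2 -mulrA.
rewrite ler_pM2l// ler_wpM2r//.
have : atan (T1 r) <= b.
  by apply: le_trans Tb; apply: le_trans P1; rewrite /phase /total_len /= big_nil mulr0 add0r big_seq1.
move=> /tan_le; rewrite atanK; apply => //; exact: atan_gtNpi2.
Qed.

Lemma spanning_energy_ge r C b : 0 <= F r -> grow (ground r) C ->
  k * total_len C.1 <= b -> b < pi / 2 ->
  - k * tan b * F r <= \sum_(e <- C.1) W e.
Proof.
move=> Fr rC Cb bpi; rewrite -energy0.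
by apply: energy_root_ge => //; rewrite phase0.
Qed.

Lemma tan_half_bounds mu l : 0 < mu -> 2 * mu <= l -> k * l < pi ->
  0 < tan (k * mu) /\ tan (k * mu) <= tan (k * l / 2).
Proof.
move=> mu0 ml kl; have pi0 := @pi_gt0 R.
have k1 : 2 * (k * mu) <= k * l by rewrite mulrCA ler_pM2l.
have kmu : 0 < k * mu by rewrite mulr_gt0.
split; last by apply: tan_le; lra.
have -> : 0 = tan 0 :> R by rewrite tan0.
by rewrite ltr_tan// in_itv/=; apply/andP; split; lra.
Qed.

(** Everything added after the loop is stripped first. The loop, of length at least 2 mu, is still
    there, so the phases stay below pi/2 - k mu; then its two halves meet at their common vertex. *)
Lemma loop_gain B C v e mu : uniq B.1 -> uniq B.2 ->
  step B (e :: B.1, B.2) -> grow (e :: B.1, B.2) C ->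
  v \in B.2 -> incident e v -> source e = target e ->
  0 < mu -> 2 * mu <= len e -> k * total_len C.1 < pi / 2 + k * mu ->
  exists T, [/\ forall u, 0 <= T u, energy B T <= \sum_(e <- C.1) W e &
    phase B T <= k * total_len C.1 - atan_gap (tan (k * mu))].
Proof.
move=> uB1 uB2 st BC vB ev loop mu0 me kC.
have pi0 := @pi_gt0 R.
have ke : 2 * (k * mu) <= k * len e by rewrite mulrCA ler_pM2l.
have kmu : 0 < k * mu by rewrite mulr_gt0.
have uB' := grow_uniq (growS (grow0 _) st) uB1 uB2.
have kl1 : k * len e <= k * total_len C.1.
  by rewrite ler_pM2l// le_total_len// (grow_sub BC).1//; exact: mem_head.
have kB : 0 <= k * total_len B.1 by rewrite mulr_ge0 ?total_len_ge0// ltW.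
have kl : k * len e < pi by lra.
have [t0 tm] := tan_half_bounds mu0 me kl.
have [||T [T0 E1 P1]] := @strip_all _ C (cst 0) BC uB'.1 uB'.2 => //.
  have kT : k * total_len (e :: B.1) = k * len e + k * total_len B.1.
    by rewrite /total_len big_cons mulrDr.
  by rewrite phase0 /= kT; lra.
rewrite energy0 in E1; rewrite phase0 in P1.
have [w wv /negP//|T1 [T1T E2 P2 H]] :=
  @strip1 R G W F k k0 W_ge B e B.2 T uB2 st T0 kl.
have [_ H2] := H v vB ev.
exists T1; split.
- by move=> u; exact: le_trans (T0 u) (T1T u).
- exact: le_trans E2 E1.
- by apply: le_trans (H2 _ t0 tm (or_intror loop)) _; rewrite lerD2r.
Qed.

(** Stripping [e2] leaves at [v] a load of at least tan (k mu); stripping [e1] afterwards adds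
    another one on top of it. *)
Lemma pair_gain B C v e1 e2 vs1 vs2 mu : uniq B.1 -> uniq B.2 ->
  step B (e1 :: B.1, vs1) -> step (e1 :: B.1, vs1) (e2 :: e1 :: B.1, vs2) ->
  grow (e2 :: e1 :: B.1, vs2) C ->
  v \in B.2 -> incident e1 v -> incident e2 v ->
  0 < mu -> 2 * mu <= len e1 -> 2 * mu <= len e2 ->
  k * total_len C.1 < pi / 2 + k * mu ->
  exists T, [/\ forall u, 0 <= T u, energy B T <= \sum_(e <- C.1) W e &
    phase B T <= k * total_len C.1 - atan_gap (tan (k * mu))].
Proof.
move=> uB1 uB2 st1 st2 BC vB i1 i2 mu0 m1 m2 kC.
have pi0 := @pi_gt0 R.
have kmu : 0 < k * mu by rewrite mulr_gt0.
have k1 : 2 * (k * mu) <= k * len e1 by rewrite mulrCA ler_pM2l.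
have k2 : 2 * (k * mu) <= k * len e2 by rewrite mulrCA ler_pM2l.
have v1 : v \in vs1 by exact: (step_sub st1).2.
have [uB1' uvs1] := grow_uniq (growS (grow0 _) st1) uB1 uB2.
have [uB2' uvs2] := grow_uniq (growS (growS (grow0 _) st1) st2) uB1 uB2.
have kT1 : k * total_len (e1 :: B.1) = k * len e1 + k * total_len B.1.
  by rewrite /total_len big_cons mulrDr.
have kT2 : k * total_len (e2 :: e1 :: B.1) =
    k * len e2 + (k * len e1 + k * total_len B.1).
  by rewrite /total_len !big_cons !mulrDr.
have kB : 0 <= k * total_len B.1 by rewrite mulr_ge0 ?total_len_ge0// ltW.
have lC : k * total_len (e2 :: e1 :: B.1) <= k * total_len C.1.
  by rewrite ler_pM2l//; exact: total_len_grow BC.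
rewrite kT2 in lC.
have kl1 : k * len e1 < pi by lra.
have kl2 : k * len e2 < pi by lra.
have [t0 tm1] := tan_half_bounds mu0 m1 kl1.
have [_ tm2] := tan_half_bounds mu0 m2 kl2.
have [||T [T0 E1 P1]] := @strip_all _ C (cst 0) BC uB2' uvs2 => //.
  by rewrite phase0 /= kT2; lra.
rewrite energy0 in E1; rewrite phase0 in P1.
have [w wv wB|T1 [T1T E2 P2 H]] :=
  @strip1 R G W F k k0 W_ge (e1 :: B.1, vs1) e2 vs2 T uvs1 st2 T0 kl2.
  have := @atan_le_phase (e2 :: e1 :: B.1, vs2) T w wv T0.
  rewrite /= kT2 => h; move: h P1 k1 kC kB kmu; clear; lra.
have [H1 _] := H v v1 i2.
have T1v : tan (k * mu) <= T1 v.
  by apply: le_trans tm2 _; apply: le_trans H1; rewrite lerDr; exact: T0.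
have T10 u : 0 <= T1 u by exact: le_trans (T0 u) (T1T u).
have P3 := le_trans P2 P1.
have [w wv wB|T2 [T2T E3 P4 H']] :=
  @strip1 R G W F k k0 W_ge B e1 vs1 T1 uB2 st1 T10 kl1.
  have wneq : w != v by apply: contraNneq wB => ->.
  (* The vertices [w] and [v] share the total phase. As [v] already holds k mu of it, less than pi/2
     is left for [w] together with [e1]. *)
  have av : k * mu <= atan (T1 v).
    rewrite -[leLHS]tanK; first exact: le_atan.
    by rewrite in_itv/=; apply/andP; split; lra.
  have : k * total_len (e1 :: B.1) + (atan (T1 w) + atan (T1 v)) <=
      phase (e1 :: B.1, vs1) T1.
    rewrite /phase lerD2l/= (big_rem w)//= lerD2l (big_rem v)/=.
      by rewrite lerDl; apply: sumr_ge0 => x _; exact: atan_ge0.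
    by rewrite mem_rem_uniq// inE/= eq_sym wneq; exact: v1.
  rewrite kT1 => h; move: h P3 av kB kC kmu; clear; lra.
have [_ H4] := H' v vB i1.
exists T2; split.
- by move=> u; exact: le_trans (T10 u) (T2T u).
- exact: le_trans E3 (le_trans E2 E1).
- by apply: le_trans (H4 _ t0 tm1 (or_introl T1v)) _; rewrite lerD2r.
Qed.

End gains.

Section two_darts.
Variables (R : realType) (G : metric_graph R).
Implicit Types (B C : seq (edge G) * seq (vertex G)) (d : dart G).
Implicit Types (v : vertex G).

Definition energy_bound (k : R) (W : edge G -> R) (F : vertex G -> R) :=
  forall (d : dart G) a, - (pi / 2) < a -> a + k * len d.1 < pi / 2 ->
  k * tan a * F (dhead d) - k * tan (a + k * len d.1) * F (dtail d) <= W d.1.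

Lemma incident_dtail d : incident d.1 (dtail d).
Proof.
by rewrite /incident; have [[-> _]|[_ ->]] := dart_ends d; rewrite eqxx ?orbT.
Qed.

(** Two darts at [v] are two edges or one loop. [B2] is chosen before the functions, the frequency
    and the rest of the growth, so the gain is uniform in all of these. *)
Lemma two_darts B v d1 d2 mu : uniq B.1 -> uniq B.2 ->
  v \in B.2 -> dtail d1 = v -> dtail d2 = v -> d1 != d2 ->
  d1.1 \notin B.1 -> d2.1 \notin B.1 ->
  0 < mu -> 2 * mu <= len d1.1 -> 2 * mu <= len d2.1 ->
  exists2 B2, grow B B2 & forall W F k C, 0 < k -> energy_bound k W F ->
    grow B2 C -> k * total_len C.1 < pi / 2 + k * mu ->
    exists T, [/\ forall u, 0 <= T u,
      energy W F k B T <= \sum_(e <- C.1) W e &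
      phase k B T <= k * total_len C.1 - atan_gap (tan (k * mu))].
Proof.
move=> uB1 uB2 vB t1 t2 d12 n1 n2 mu0 m1 m2.
have i1 : incident d1.1 v by rewrite -t1 incident_dtail.
have i2 : incident d2.1 v by rewrite -t2 incident_dtail.
have [e12|e12] := eqVneq d1.1 d2.1.
  have loop : source d1.1 = v /\ target d1.1 = v.
    case: d1 d2 t1 t2 d12 e12 {n1 n2 m1 m2 i1 i2} => [x [|]] [y [|]];
      rewrite /dtail /= => h1 h2 + xy; subst y; rewrite ?eqxx// => _.
  have st : step B (d1.1 :: B.1, B.2).
    by apply: step_chord; rewrite ?loop.1 ?loop.2.
  exists (d1.1 :: B.1, B.2); first exact: growS (grow0 _) st.
  move=> W F k C k0 WF BC kC; have lp := etrans loop.1 (esym loop.2).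
  exact: (loop_gain k0 WF uB1 uB2 st BC vB i1 lp).
have [vs1 st1 sub1] := step_incident vB i1 n1.
have n2' : d2.1 \notin (d1.1 :: B.1) by rewrite inE eq_sym (negbTE e12).
have [vs2 st2 _] := @step_incident _ _ (d1.1 :: B.1, vs1) _ _ (sub1 _ vB) i2 n2'.
exists (d2.1 :: d1.1 :: B.1, vs2); first exact: growS (growS (grow0 _) st1) st2.
move=> W F k C k0 WF BC kC.
exact: (pair_gain k0 WF uB1 uB2 st1 st2 BC vB i1 i2 mu0).
Qed.

End two_darts.

(** * The three sources of a gain: branching, Dirichlet vertex of degree two, second Dirichlet
    vertex *)

Section spectral_gains.
Variables (R : realType) (G : metric_graph R).
Notation V := (vertex G).
Notation E := (edge G).
Hypothesis conn : forall u v : V, vpath u v.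

Implicit Types (B C : seq E * seq V) (d : dart G) (e : E) (v w u r : V).

(** One of the three branches at [v] leads back to the root; the other two are grown as soon as [v]
    is reached, and [two_darts] applies to them. *)
Lemma branch_gain r v d1 d2 d3 mu : r != v ->
  dtail d1 = v -> dtail d2 = v -> dtail d3 = v -> uniq [:: d1; d2; d3] ->
  0 < mu -> (forall e, incident e v -> 2 * mu <= len e) ->
  forall s : seq E, exists2 C, grow (ground r) C /\ {subset s <= C.1} &
    forall W F k b, 0 < k -> energy_bound k W F -> 0 <= F r ->
      k * total_len C.1 < pi / 2 + k * mu ->
      k * total_len C.1 - atan_gap (tan (k * mu)) <= b -> b < pi / 2 ->
      - k * tan b * F r <= \sum_(e <- C.1) W e.
Proof.
move=> rv t1 t2 t3 u3 mu0 hmu s.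
have [A rA vA] := grow_vertex (@ground_closed _ _ r) (mem_head r _) (conn r v).
have vr : v \notin (ground r).2 by rewrite inE eq_sym.
have [D [d0 [rD tD hD vD dD]]] := first_visit rA vA vr.
have hd0 : dhead d0 \notin D.2 by rewrite hD.
have rB := growS rD (step_leaf tD hd0 dD).
set B := (_, _) in rB.
have cB := grow_closed rB (@ground_closed _ _ r).
have cD := grow_closed rD (@ground_closed _ _ r).
have [uB1 uB2] := grow_uniq rB isT isT.
have vB : v \in B.2 by rewrite /B /= hD mem_head.
have notD d : dtail d = v -> d.1 \notin D.1.
  move=> dv; apply: contraNN vD => /cD[h1 h2]; rewrite -dv.
  by have [[<- _]|[_ <-]] := dart_ends d.
have notB d : dtail d = v -> d.1 != d0.1 -> d.1 \notin B.1.
  by move=> dv dn; rewrite /B /= inE negb_or dn notD.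
(* Two different darts at [v] on the edge of [d0] would make it a loop, but its tail was reached
   before [v]. So at most one of the three darts is used up. *)
have one d d' : dtail d = v -> dtail d' = v -> d.1 = d0.1 -> d'.1 = d0.1 ->
    d = d'.
  case: d d' => [x b] [y b'] h1 h2 /= h3 h4; rewrite h3 h4 in h1 h2 *.
  congr pair; apply/eqP/negPn/negP => bb'.
  have tv : dtail d0 = v.
    case: d0 h1 h2 {tD hD hd0 dD rB B cB uB1 uB2 vB notB h3 h4} => z b0.
    by rewrite /dtail /=; case: b b' b0 bb' => [] [] [].
  by move: vD; rewrite -tv tD.
have [da [db [dav [dbv [dab [na nb]]]]]] : exists da db, dtail da = v /\
    dtail db = v /\ da != db /\ da.1 \notin B.1 /\ db.1 \notin B.1.
  move: u3; rewrite /= !inE negb_or andbT => /andP[/andP[n12 n13] n23].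
  have [e1|e1] := eqVneq d1.1 d0.1.
    have e2 : d2.1 != d0.1 by apply: contraNneq n12 => e2; rewrite (one d1 d2).
    have e3 : d3.1 != d0.1 by apply: contraNneq n13 => e3; rewrite (one d1 d3).
    by exists d2, d3; do !split => //; apply: notB.
  have [e2|e2] := eqVneq d2.1 d0.1.
    have e3 : d3.1 != d0.1 by apply: contraNneq n23 => e3; rewrite (one d2 d3).
    by exists d1, d3; do !split => //; apply: notB.
  by exists d1, d2; do !split => //; apply: notB.
have [B2 BB2 H] : exists2 B2, grow B B2 & forall W F k C, 0 < k ->
    energy_bound k W F -> grow B2 C -> k * total_len C.1 < pi / 2 + k * mu ->
    exists T, [/\ forall u, 0 <= T u, energy W F k B T <= \sum_(e <- C.1) W e &
      phase k B T <= k * total_len C.1 - atan_gap (tan (k * mu))].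
  apply: (two_darts uB1 uB2 vB dav dbv) => //; apply: hmu.
    by rewrite -dav incident_dtail.
  by rewrite -dbv incident_dtail.
have B2n : B2.2 != [::].
  by have := (grow_sub BB2).2 _ vB; case: (B2.2).
have [C B2C sC] := grow_edges s (grow_closed BB2 cB) B2n conn.
exists C; first by split=> //; exact: grow_trans (grow_trans rB BB2) B2C.
move=> W F k b k0 WF Fr kC Cb bpi.
have [T [T0 E1 P1]] := H W F k C k0 WF B2C kC.
apply: le_trans E1; apply: energy_root_ge => //.
exact: le_trans Cb.
Qed.

(** Where [F r = 0] the load at the root costs nothing, however large it is. Two branches at the
    root only have to keep their phases below pi/2 separately, which leaves room for k |C| >
    pi/2. *)
Lemma root_gain r d1 d2 mu : dtail d1 = r -> dtail d2 = r -> d1 != d2 ->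
  0 < mu -> (forall e, incident e r -> 2 * mu <= len e) ->
  forall s : seq E, exists2 C, grow (ground r) C /\ {subset s <= C.1} &
    forall W F k, 0 < k -> energy_bound k W F -> F r = 0 ->
      k * total_len C.1 < pi / 2 + k * mu -> 0 <= \sum_(e <- C.1) W e.
Proof.
move=> t1 t2 d12 mu0 hmu s.
have [B2 BB2 H] : exists2 B2, grow (ground r) B2 & forall W F k C, 0 < k ->
    energy_bound k W F -> grow B2 C -> k * total_len C.1 < pi / 2 + k * mu ->
    exists T, [/\ forall u, 0 <= T u,
      energy W F k (ground r) T <= \sum_(e <- C.1) W e &
      phase k (ground r) T <= k * total_len C.1 - atan_gap (tan (k * mu))].
  apply: (two_darts _ _ _ t1 t2 d12) => //; first exact: mem_head.
    by apply: hmu; rewrite -t1 incident_dtail.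
  by apply: hmu; rewrite -t2 incident_dtail.
have B2n : B2.2 != [::].
  by have := (grow_sub BB2).2 _ (mem_head r _); case: (B2.2).
have [C B2C sC] := grow_edges s (grow_closed BB2 (@ground_closed _ _ r)) B2n conn.
exists C; first by split=> //; exact: grow_trans BB2 B2C.
move=> W F k k0 WF Fr kC.
have [T [T0 E1 _]] := H W F k C k0 WF B2C kC.
apply: le_trans E1; rewrite /energy big_nil big_seq1 Fr !mulr0 subrr//.
Qed.

(** Since [F q = 0], the load collected at [q] may be discarded and the edge towards the root
    started with a negative phase. *)
Lemma dirichlet_gain r q mu : r != q -> 0 < mu ->
  (forall e, incident e q -> mu <= len e) ->
  forall s : seq E, exists2 C, grow (ground r) C /\ {subset s <= C.1} &
    forall W F k b, 0 < k -> energy_bound k W F -> 0 <= F r -> F q = 0 ->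
      k * total_len C.1 - k * mu <= b -> b < pi / 2 -> k * mu < pi / 2 ->
      - k * tan b * F r <= \sum_(e <- C.1) W e.
Proof.
move=> rq mu0 hmu s.
have [A rA qA] := grow_vertex (@ground_closed _ _ r) (mem_head r _) (conn r q).
have qr : q \notin (ground r).2 by rewrite inE eq_sym.
have [D [d0 [rD tD hD qD dD]]] := first_visit rA qA qr.
have hd0 : dhead d0 \notin D.2 by rewrite hD.
have rB := growS rD (step_leaf tD hd0 dD).
set B := (_, _) in rB.
have cB := grow_closed rB (@ground_closed _ _ r).
have [uB1 uB2] := grow_uniq rB isT isT.
have [uD1 uD2] := grow_uniq rD isT isT.
have B2n : B.2 != [::] by [].
have [C BC sC] := grow_edges s cB B2n conn.
exists C; first by split=> //; exact: grow_trans rB BC.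
move=> W F k b k0 WF Fr Fq Cb bpi kmu.
have mulen : mu <= len d0.1.
  by apply: hmu; rewrite /incident -hD; have [[_ ->]|[-> _]] := dart_ends d0; rewrite eqxx ?orbT.
have kmul : k * mu <= k * len d0.1 by rewrite ler_pM2l.
have kB : k * total_len B.1 = k * len d0.1 + k * total_len D.1.
  by rewrite /B /total_len big_cons mulrDr.
have kD0 : 0 <= k * total_len D.1 by rewrite mulr_ge0 ?total_len_ge0// ltW.
have kBC : k * total_len B.1 <= k * total_len C.1.
  by rewrite ler_pM2l//; exact: total_len_grow BC.
have kmu0 : 0 < k * mu by rewrite mulr_gt0.
have [||T [T0 E1 P1]] := @strip_all _ _ W F k k0 WF B C (cst 0) BC uB1 uB2 => //.
  rewrite phase0 kB; move: kmul kD0 Cb bpi; clear; lra.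
rewrite energy0 in E1; rewrite phase0 in P1.
apply: le_trans E1.
(* The starting phase at [q] is -k mu; as the edge has length at least mu, its other end still has a
   nonnegative phase, which can be merged. *)
have aN : - (pi / 2) < - (k * mu) by rewrite ltrN2.
have al : - (k * mu) + k * len d0.1 < pi / 2.
  by move: kB kBC kD0 Cb bpi; clear; lra.
have al0 : 0 <= - (k * mu) + k * len d0.1 by move: kmul; clear; lra.
have [||E2 P2] := @leaf_strip _ _ W F k WF D d0 T (- (k * mu)) 0 uD2 tD aN al.
- by rewrite hD Fq !mulr0.
- rewrite subr0; apply: atanD_tan_le => //; exact: T0.
apply: le_trans E2; apply: energy_root_ge => //.
  move=> v; apply: le_trans (T0 v) _; apply: le_load; exact: tan_ge0.
apply: le_trans P2 _; apply: le_trans Cb; rewrite subr0.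
have := atan_ge0 (T0 (dhead d0)).
by move: P1; clear; rewrite /B; lra.
Qed.

End spectral_gains.

(** * Graph functions and ends *)

Section connectivity.
Variables (R : realType) (G : metric_graph R).
Implicit Types (x y z : gpoint G) (u v w : vertex G) (e : edge G).

(** Points at finite distance from [y] form an open and closed set: a ball of radius 1 never leaves
    it. *)
Lemma connected_walk : connected [set: gpoint G] ->
  forall x y, exists l, walk y x l.
Proof.
move=> cG x y; pose A := [set x | exists l, walk y x l].
have ballA z z' : ball z 1 z' -> A z -> A z'.
  move=> /gballP[l zz' _] [k yz]; exists (l + k).
  exact: walk_cat (walk_sym zz') yz.
have oA : open A.
  rewrite openE => z Az; apply/nbhs_ballP; exists 1 => //= z' zz'.
  exact: ballA zz' Az.
have cA : closed A.
  rewrite -openC openE => z Az; apply/nbhs_ballP; exists 1 => //= z' zz' Az'.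
  by apply: Az; apply: ballA Az'; exact: ball_sym.
suff AT : A = setT by have : A x by rewrite AT.
apply: cG; first by exists y, 0; exact: walk_nil.
  by exists A; rewrite ?setTI.
by exists A; rewrite ?setTI.
Qed.

Lemma on_edge0 e : on_edge e 0 = vpoint (source e).
Proof. by rewrite /on_edge insubF ?lexx//= ltxx. Qed.

Lemma on_edge_len e : on_edge e (len e) = vpoint (target e).
Proof.
by rewrite /on_edge insubF /= ?ltxx ?andbF// leNgt len_gt0.
Qed.

Variant on_edge_spec e s : gpoint G -> Prop :=
| on_edge_source of s = 0 : on_edge_spec e s (vpoint (source e))
| on_edge_target of s = len e : on_edge_spec e s (vpoint (target e))
| on_edge_inner (p : {p : edge G * R | 0 < p.2 < len p.1}) of
    sval p = (e, s) & 0 < s < len e : on_edge_spec e s (inr p).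

Lemma on_edgeP e s : s \in `[0, len e] -> on_edge_spec e s (on_edge e s).
Proof.
rewrite in_itv/= le_eqVlt => /andP[/predU1P[<- _|s0]].
  by rewrite on_edge0; exact: on_edge_source.
rewrite le_eqVlt => /predU1P[->|sl].
  by rewrite on_edge_len; exact: on_edge_target.
rewrite /on_edge; case: insubP => [p /= _ pE|/=]; last by rewrite s0 sl.
by apply: on_edge_inner => //; rewrite s0.
Qed.

Lemma on_edge_surj x : (exists v, x = vpoint v) \/
  exists e s, 0 < s < len e /\ x = on_edge e s.
Proof.
case: x => [v|[[e s] h]]; first by left; exists v.
right; exists e, s; split=> //.
rewrite /on_edge; case: insubP => [p /= _ pE|]; last by rewrite /= h.
by congr inr; apply: val_inj.
Qed.

Lemma vpath_edge u e v w : incident e v -> incident e w -> vpath u v ->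
  vpath u w.
Proof.
have st : vpath u (source e) -> vpath u (target e).
  by move=> h; exact: (@vpathS _ _ _ (e, true)).
have ts : vpath u (target e) -> vpath u (source e).
  by move=> h; exact: (@vpathS _ _ _ (e, false)).
by move=> /orP[] /eqP-> /orP[] /eqP->.
Qed.

Lemma on_edge_vpoint e s v : s \in `[0, len e] -> on_edge e s = vpoint v ->
  incident e v.
Proof.
by case/on_edgeP => // _ [<-]; rewrite /incident eqxx ?orbT.
Qed.

(** A walk may start inside an edge, so the induction speaks of all vertices incident to an edge
    through [x]. *)
Lemma walk_vpath u x l : walk (vpoint u) x l -> forall v,
  x = vpoint v \/ (exists e s, [/\ s \in `[0, len e], x = on_edge e s &
    incident e v]) -> vpath u v.
Proof.
have sinc e : incident e (source e) by rewrite /incident eqxx.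
elim=> [v [[->]|[e [s [sI us iv]]]]|e s t {}l sI tI _ IH v H].
- exact: vpath0.
- exact: (vpath_edge (on_edge_vpoint sI (esym us)) iv (vpath0 _)).
have ue w : incident e w -> vpath u w.
  by move=> ew; apply: IH; right; exists e, t.
case: H => [/(on_edge_vpoint sI)/ue//|[e' [s' [sI' ss' ev]]]].
move: ss'; case/on_edgeP: sI => [_|_|p pE _].
- by move=> /esym/(on_edge_vpoint sI')/vpath_edge; apply => //; apply: ue; rewrite /incident eqxx.
- by move=> /esym/(on_edge_vpoint sI')/vpath_edge; apply => //; apply: ue; rewrite /incident eqxx orbT.
case/on_edgeP: sI' => // p' pE' _ [pp]; apply: ue.
by move: pE pE'; rewrite pp => -> [->].
Qed.

Lemma connected_vpath : connected [set: gpoint G] -> forall u v, vpath u v.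
Proof.
move=> cG u v; have [l] := connected_walk cG (vpoint v) (vpoint u).
by move=> /walk_vpath; apply; left.
Qed.

End connectivity.

Section esum_seq.
Variables (R : realType) (T : choiceType) (a : T -> \bar R).
Hypothesis a0 : forall x, (0 <= a x)%E.

Lemma esum_seq_ge (s : seq T) : uniq s ->
  (\sum_(x <- s) a x <= \esum_(x in [set: T]) a x)%E.
Proof.
move=> us; rewrite fsbig_seq//; apply: ereal_sup_ubound.
by exists [set` s] => //; split => //; exact: finite_seq.
Qed.

Lemma esum_le_seq (M : \bar R) :
  (forall s : seq T, uniq s -> (\sum_(x <- s) a x <= M)%E) ->
  (\esum_(x in [set: T]) a x <= M)%E.
Proof.
move=> H; apply: ge_ereal_sup => _ [A [fA _] <-].
by rewrite fsbig_finite//=; apply: H.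
Qed.

End esum_seq.

Section graph_functions.
Variables (R : realType) (G : metric_graph R).
Notation mu := (@lebesgue_measure R).
Implicit Types (f : gpoint G -> R) (g : edge G -> R -> R) (e : edge G).
Implicit Types (k : R) (v : vertex G).

Definition edge_energy k f g e : R := fine (sqnorm (len e) (g e)) -
  k ^+ 2 * fine (sqnorm (len e) (fun s => f (on_edge e s))).

Lemma graph_H1_energy_bound k f g : 0 < k -> graph_H1 f g ->
  energy_bound k (edge_energy k f g) (fun v => f (vpoint v) ^+ 2).
Proof.
move=> k0 [_ fH1 _] [e b] a a0 al; rewrite /dhead /dtail /=.
have := @picone R (len e) _ _ k a (len_gt0 e) k0 (fH1 e) a0 al.
have := @picone_rev R (len e) _ _ k a (len_gt0 e) k0 (fH1 e) a0 al.
by rewrite on_edge0 on_edge_len; case: b {al}.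
Qed.

Lemma sqnorm_ge0 l (h : R -> R) : (0 <= sqnorm l h)%E.
Proof. by apply: integral_ge0 => x _; rewrite lee_fin sqr_ge0. Qed.

Lemma in_L2_fineK l (h : R -> R) : in_L2 l h -> (fine (sqnorm l h))%:E = sqnorm l h.
Proof. by move=> [_ h2]; rewrite fineK// ge0_fin_numE// sqnorm_ge0. Qed.

Lemma graph_H1_lty f g : graph_H1 f g ->
  (graph_sqnorm g < +oo)%E /\
  (graph_sqnorm (fun e s => f (on_edge e s)) < +oo)%E.
Proof.
move=> [_ _ H]; split; apply: le_lt_trans H; apply: le_esum => e _.
  by rewrite leeDr// sqnorm_ge0.
by rewrite leeDl// sqnorm_ge0.
Qed.

Lemma sum_fine_le (h : edge G -> R -> R) (s : seq (edge G)) :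
  (forall e, in_L2 (len e) (h e)) -> (graph_sqnorm h < +oo)%E -> uniq s ->
  \sum_(e <- s) fine (sqnorm (len e) (h e)) <= fine (graph_sqnorm h).
Proof.
move=> hL2 hoo us.
have h0 : (0 <= graph_sqnorm h)%E by apply: esum_ge0 => e _; exact: sqnorm_ge0.
rewrite -lee_fin fineK ?ge0_fin_numE// -sumEFin.
under eq_bigr do rewrite in_L2_fineK//.
by apply: esum_seq_ge => // e; exact: sqnorm_ge0.
Qed.

Lemma graph_sqnorm_le (h : edge G -> R -> R) (M : R) :
  (forall e, in_L2 (len e) (h e)) ->
  (forall s, uniq s -> \sum_(e <- s) fine (sqnorm (len e) (h e)) <= M) ->
  (graph_sqnorm h <= M%:E)%E.
Proof.
move=> hL2 H; apply: esum_le_seq => // s us.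
under eq_bigr do rewrite -in_L2_fineK//.
by rewrite sumEFin lee_fin; exact: H.
Qed.

Lemma le_sum_sub (s t : seq (edge G)) (a : edge G -> R) :
  (forall e, 0 <= a e) -> uniq s -> uniq t -> {subset s <= t} ->
  \sum_(e <- s) a e <= \sum_(e <- t) a e.
Proof.
move=> a0 us ut st; rewrite [leRHS](bigID (mem s))/=.
rewrite -[X in _ <= X + _]big_filter.
rewrite (_ : \sum_(e <- s) a e = \sum_(i <- [seq x <- t | x \in s]) a i).
  by rewrite lerDl; apply: sumr_ge0.
apply: perm_big; apply: uniq_perm => //; first exact: filter_uniq.
by move=> x; rewrite mem_filter; case: (boolP (x \in s)) => //= /st ->.
Qed.

(** The norm of f is approximated on a finite [s]; enlarging [s] to [t] increases it, and on [t] it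
    is controlled by the norm of g up to eps. *)
Lemma energy_exhaustion k f g : 0 < k -> graph_H1 f g ->
  (forall (s : seq (edge G)) eps, 0 < eps -> exists t, [/\ uniq t,
    {subset s <= t} & - eps <= \sum_(e <- t) edge_energy k f g e]) ->
  k ^+ 2 * fine (graph_sqnorm (fun e s => f (on_edge e s))) <=
  fine (graph_sqnorm g).
Proof.
move=> k0 fH1 H; have [h1 h2] := graph_H1_lty fH1; have [_ fe _] := fH1.
have L2f e : in_L2 (len e) (fun s => f (on_edge e s)) by have [] := fe e.
have L2g e : in_L2 (len e) (g e) by have [] := fe e.
have k2 : 0 < k ^+ 2 by rewrite exprn_gt0.
have g0 : (0 <= graph_sqnorm (fun e s => f (on_edge e s)))%E.
  by apply: esum_ge0 => e _; exact: sqnorm_ge0.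
rewrite mulrC -ler_pdivlMr// -lee_fin fineK ?ge0_fin_numE//.
apply: graph_sqnorm_le => // s us; rewrite ler_pdivlMr//.
apply/ler_addgt0Pr => eps eps0.
have [t [ut st Ht]] := H s eps eps0.
have h3 := sum_fine_le L2g h1 ut.
have h4 : \sum_(e <- s) fine (sqnorm (len e) (fun s => f (on_edge e s))) <=
    \sum_(e <- t) fine (sqnorm (len e) (fun s => f (on_edge e s))).
  by apply: le_sum_sub => // e; apply: fine_ge0; exact: sqnorm_ge0.
move: Ht; rewrite /edge_energy sumrB -mulr_sumr.
have := ler_wpM2r (ltW k2) h4; lra.
Qed.

(** By Hölder continuity [h] changes by at most |h s0| / 2 within distance [d] of [s0], so h^2 >=
    h(s0)^2 / 4 on an interval of positive length. *)
Lemma in_H1_norm_gt0 l (h h' : R -> R) s0 : 0 < l -> in_H1 l h h' ->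
  s0 \in `[0, l] -> h s0 != 0 -> 0 < fine (sqnorm l h).
Proof.
move=> l0 hh' /[!in_itv]/= /andP[s00 s0l] hs0; have [hL2 hL2' _] := hh'.
have N0 : 0 <= fine (sqnorm l h') by apply: fine_ge0; exact: sqnorm_ge0.
have c0 : 0 < h s0 ^+ 2 by rewrite exprn_even_gt0.
pose d := h s0 ^+ 2 / 4 / (fine (sqnorm l h') + 1).
have d0 : 0 < d by rewrite !divr_gt0// ltr_wpDl.
pose x := Num.max 0 (s0 - d); pose y := Num.min l (s0 + d).
have x0 : 0 <= x by rewrite le_max lexx.
have yl : y <= l by rewrite ge_min lexx.
have xs : x <= s0 by rewrite ge_max s00 gerBl ltW.
have sy : s0 <= y by rewrite le_min s0l lerDl ltW.
have xy : x < y by rewrite /x /y lt_min !gt_max l0; apply/andP; split; [lra|lra].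
have xd : s0 - d <= x by rewrite le_max lexx orbT.
have yd : y <= s0 + d by rewrite ge_min lexx orbT.
have osc t : x <= t -> t <= y -> h s0 ^+ 2 / 4 <= h t ^+ 2.
  move=> xt ty.
  have h1 : (h t - h s0) ^+ 2 <= h s0 ^+ 2 / 4.
    have dN : d * (fine (sqnorm l h') + 1) = h s0 ^+ 2 / 4.
      by rewrite /d divfK// gt_eqF// ltr_wpDl.
    rewrite -dN.
    have [ts|st] := leP t s0.
      rewrite -sqrrN opprB; apply: le_trans (in_H1_sqr_le hh' (le_trans x0 xt) ts s0l) _.
      by apply: ler_pM => //; [rewrite subr_ge0|lra|lra].
    apply: le_trans (in_H1_sqr_le hh' s00 (ltW st) (le_trans ty yl)) _.
    by apply: ler_pM => //; [rewrite subr_ge0 ltW|lra|lra].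
  have := sqr_ge0 (2 * h t - h s0); nra.
rewrite -[fine _]/(\int[mu]_(t in `[0, l]) (h t ^+ 2)).
have hi := in_L2_integrable_sqr hL2.
apply: (@lt_le_trans _ _ (\int[mu]_(t in `]x, y]) (h t ^+ 2))).
  apply: (@lt_le_trans _ _ (h s0 ^+ 2 / 4 * (y - x))).
    by apply: mulr_gt0; [exact: divr_gt0|rewrite subr_gt0].
  rewrite -Rintegral_cst_itv; last exact: ltW.
  apply: le_Rintegral => //.
  - exact: integrable_cst_itv.
  - exact: (integrable_subitv hi).
  by move=> t /=; rewrite in_itv/= => /andP[/ltW xt ty]; exact: osc.
rewrite -(Rintegral_subitv hi x0 (ltW xy) yl).
apply: (@le_trans _ _ (\int[mu]_(t in `[0, y]) (h t ^+ 2))).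
  by rewrite gerBl; apply: Rintegral_ge0 => z _; exact: sqr_ge0.
rewrite -subr_ge0 (Rintegral_subitv hi (le_trans x0 (ltW xy)) yl (lexx l)).
by apply: Rintegral_ge0 => z _; exact: sqr_ge0.
Qed.

Hypothesis volG : (volume G < +oo)%E.

Lemma volume_ge0 : (0 <= volume G)%E.
Proof. by apply: esum_ge0 => e _; rewrite lee_fin ltW// len_gt0. Qed.

Lemma total_len_le_volume (s : seq (edge G)) : uniq s ->
  total_len s <= fine (volume G).
Proof.
move=> us; rewrite -lee_fin fineK ?ge0_fin_numE ?volume_ge0// /total_len -sumEFin.
by apply: esum_seq_ge => // e; rewrite lee_fin ltW// len_gt0.
Qed.

Lemma volume_approx d : 0 < d ->
  exists2 s : seq (edge G), uniq s & fine (volume G) - d < total_len s.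
Proof.
move=> d0; apply: contrapT => H.
have : (volume G <= (fine (volume G) - d)%:E)%E.
  apply: esum_le_seq => // s us; rewrite sumEFin lee_fin leNgt.
  by apply/negP => h; apply: H; exists s.
rewrite -[X in (X <= _)%E]fineK ?ge0_fin_numE ?volume_ge0// lee_fin; lra.
Qed.

Lemma volume_approx_len d : 0 < d ->
  exists2 s : seq (edge G), uniq s & forall e, e \notin s -> len e < d.
Proof.
move=> /volume_approx[s us hs]; exists s => // e es.
have := @total_len_le_volume (e :: s); rewrite /= es us => /(_ isT).
by rewrite /total_len big_cons; rewrite /total_len in hs; lra.
Qed.

End graph_functions.

(** * Ends and values at ends *)

Section ends.
Variables (R : realType) (G : metric_graph R).
Implicit Types (f : gpoint G -> R) (g : edge G -> R -> R) (e : edge G).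
Implicit Types (U : nat -> set (gpoint G)) (v : vertex G).

Lemma on_edge_ball e s t r : s \in `[0, len e] -> t \in `[0, len e] ->
  `|s - t| < r -> ball (on_edge e s) r (on_edge e t).
Proof.
move=> sI tI st; apply/gballP; exists `|s - t| => //.
by rewrite -[`|_|]addr0; apply: walk_cons => //; exact: walk_nil.
Qed.

Lemma end_seq_le U : end_seq U -> forall m n, (m <= n)%N -> U n `<=` U m.
Proof.
move=> [_ US _] m n; elim: n => [|n IH]; first by rewrite leqn0 => /eqP->.
rewrite leq_eqVlt ltnS => /predU1P[->//|/IH]; exact: subset_trans.
Qed.

(** Edges are compact: points of all [U n] on one edge would accumulate at a point in every closure,
    and these have empty intersection. *)
Lemma end_avoids_edge U e : end_seq U ->
  exists n, forall s, s \in `[0, len e] -> ~ U n (on_edge e s).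
Proof.
move=> EU; apply: contrapT => H.
have {}H n : exists s, s \in `[0, len e] /\ U n (on_edge e s).
  apply: contrapT => H'; apply: H; exists n => s sI Us; apply: H'; by exists s.
have [s Hs] := choice H.
have cpt := @segment_compact R 0 (len e).
have [|t [tI tc]] := cpt (s @ \oo) _.
  by exists 0 => // n _ /=; have [] := Hs n.
have [_ _ E0] := EU; suff : (\bigcap_n closure (U n)) (on_edge e t) by rewrite E0.
move=> n _ B /nbhs_ballP[r /= r0 rB].
have An : (s @ \oo) [set z | exists2 m, (n <= m)%N & z = s m].
  by exists n => // m /= nm; exists m.
have Bt : nbhs t (ball t r) by exact: nbhsx_ballx.
have [z [[m nm ->] tz]] := tc _ _ An Bt.
exists (on_edge e (s m)); split.
  by apply: (end_seq_le EU nm); have [] := Hs m.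
apply: rB; apply: on_edge_ball => //; by have [] := Hs m.
Qed.

Lemma end_avoids_edges U (s : seq (edge G)) : end_seq U ->
  exists n, forall m e t, (n <= m)%N -> e \in s -> t \in `[0, len e] ->
    ~ U m (on_edge e t).
Proof.
move=> EU; elim: s => [|e s [n IH]]; first by exists 0%N.
have [n' H] := end_avoids_edge e EU.
exists (maxn n n') => m e' t; rewrite geq_max inE => /andP[nm n'm].
move=> /predU1P[->|es] tI Ut; last exact: IH Ut.
by apply: H tI _; exact: (end_seq_le EU n'm).
Qed.

Lemma graph_end_mem (c : graph_end G) : exists2 U, end_seq U & sval c U.
Proof.
case: c => C /= [U EU ->]; exists U => //; split => // n.
by exists n, n; split.
Qed.

Lemma graph_end_seq (c : graph_end G) U : sval c U -> end_seq U.
Proof. by case: c => C /= [U0 _ ->] []. Qed.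

(** The value is defined through sequences; choosing a bad point in every [U n] shows that the
    convergence is uniform. *)
Lemma has_value_at_near f (c : graph_end G) (a : R) U :
  has_value_at f (inr c) a -> sval c U -> forall eps, 0 < eps ->
  exists n, forall m x, (n <= m)%N -> U m x -> `|f x - a| < eps.
Proof.
move=> fa cU eps eps0; have EU := graph_end_seq cU.
apply: contrapT => H.
have {}H n : exists x, U n x /\ eps <= `|f x - a|.
  apply: contrapT => H'; apply: H; exists n => m x nm Ux.
  rewrite ltNge; apply/negP => h; apply: H'; exists x; split => //.
  exact: (end_seq_le EU nm).
have [x Hx] := choice H.
have /cvgrPdist_lt/(_ eps eps0)[n _ /(_ n (leqnn n)) /=] := fa U cU x (fun n => (Hx n).1).
by rewrite distrC ltNge (Hx n).2.
Qed.

Hypothesis conn : connected [set: gpoint G].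
Hypothesis vol0 : (0 < volume G)%E.
Hypothesis voly : (volume G < +oo)%E.
Hypothesis fin : locally_finite G.

Lemma exists_edge : exists e : edge G, True.
Proof.
apply: contrapT => H; move: vol0; rewrite (_ : volume G = 0%E) ?ltxx//.
by apply: esum1 => e _; case: H; exists e.
Qed.

Lemma exists_incident v : exists e, incident e v.
Proof.
have [e0 _] := exists_edge.
have H w : vpath v w -> w = v \/ exists e, incident e v.
  elim=> [|d _ [<-|?]]; [by left| |by right].
  by right; exists d.1; exact: incident_dtail.
have [<-|//] := H _ (connected_vpath conn v (source e0)).
by exists e0; rewrite /incident eqxx.
Qed.

Lemma incident_list v : exists s : seq (edge G), forall e, incident e v -> e \in s.
Proof.
have /finite_seqP[s sE] := fin v; exists s => e ev.
have : [set e | source e = v \/ target e = v] e.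
  by case/orP: ev => /eqP->; [left|right].
by rewrite sE.
Qed.

Lemma incident_len_gt v : exists2 m, 0 < m & forall e, incident e v -> 2 * m <= len e.
Proof.
have [s sv] := incident_list v.
suff [m m0 H] : exists2 m, 0 < m & forall e, e \in s -> 2 * m <= len e.
  by exists m => // e /sv; exact: H.
elim: s {sv} => [|e s [m m0 H]]; first by exists 1.
exists (Num.min m (len e / 2)); first by rewrite lt_min m0 divr_gt0// len_gt0.
move=> e'; rewrite inE => /predU1P[->|/H].
  by rewrite -ler_pdivlMl// ge_min mulrC lexx orbT.
by apply: le_trans; rewrite ler_pM2l// ge_min lexx.
Qed.

(** For an end, a point far out lies on a short edge not incident to [v], and f varies little along
    it up to its source: f(x)^2 <= eps/4 and a squared increment of at most eps/16 give f(r)^2 <= 5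
    eps/8. *)
Lemma vertex_near VV f g p v (eps : R) : graph_H10 VV f g -> VV p ->
  p <> inl v -> 0 < eps -> exists2 r, r != v & f (vpoint r) ^+ 2 < eps.
Proof.
move=> [fH1 f0] Vp; case: p Vp => [r|c] Vp pv eps0.
  exists r; first by apply/eqP => rv; apply: pv; rewrite rv.
  by have /= -> := f0 _ Vp; rewrite expr0n.
have [U EU cU] := graph_end_mem c.
have [gy _] := graph_H1_lty fH1; have [_ fe _] := fH1.
set N := fine (graph_sqnorm g).
have N0 : 0 <= N by apply: fine_ge0; apply: esum_ge0 => e _; exact: sqnorm_ge0.
pose d := eps / 16 / (N + 1).
have d0 : 0 < d by rewrite !divr_gt0// ltr_wpDl.
have dN : d * N <= eps / 16.
  apply: (@le_trans _ _ (d * (N + 1))); first by rewrite ler_wpM2l ?(ltW d0)// lerDl.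
  by rewrite /d divfK// gt_eqF// ltr_wpDl.
have [s1 _ Hs1] := volume_approx_len voly d0.
have [s2 Hs2] := incident_list v.
have [n1 H1] := end_avoids_edges (s1 ++ s2) EU.
have [n2 H2] := has_value_at_near (f0 _ Vp) cU (ltac:(rewrite sqrtr_gt0; exact: (divr_gt0 eps0 (ltr0n _ 4))) : 0 < Num.sqrt (eps / 4)).
have [/(_ (maxn n1 n2))[[x Ux] _ _ _] _ _] := EU.
have fx : f x ^+ 2 <= eps / 4.
  have := H2 _ x (leq_maxr n1 n2) Ux; rewrite subr0 => /ltW.
  rewrite -(@ler_pXn2r _ 2) ?nnegrE ?sqrtr_ge0// real_normK ?num_real// sqr_sqrtr//.
  by rewrite divr_ge0// ltW.
have [[r xr]|[e [s [se xe]]]] := on_edge_surj x.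
  exists r.
    apply/eqP => rv; have [e ev] := exists_incident v.
    have es : e \in s1 ++ s2 by rewrite mem_cat Hs2 ?orbT.
    case/orP: ev => /eqP ve.
      apply: (H1 _ e 0 (leq_maxl n1 n2) es); last by rewrite on_edge0 -ve -rv -xr.
      by rewrite in_itv/= lexx ltW ?len_gt0.
    apply: (H1 _ e (len e) (leq_maxl n1 n2) es); last by rewrite on_edge_len -ve -rv -xr.
    by rewrite in_itv/= lexx ltW ?len_gt0.
  rewrite -xr; apply: le_lt_trans fx _; lra.
have sI : s \in `[0, len e].
  by case/andP: se => s0 sl; rewrite in_itv/= !ltW.
have es : e \notin s1 ++ s2.
  by apply/negP => es; apply: (H1 _ e s (leq_maxl n1 n2) es sI); rewrite -xe.
move: es; rewrite mem_cat negb_or => /andP[/Hs1 ed es2].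
exists (source e).
  by apply: contraNneq es2 => se'; apply: Hs2; rewrite -se' /incident eqxx.
have /andP[s0 sl] := se.
have := in_H1_sqr_le (fe e) (lexx 0) (ltW s0) (ltW sl).
rewrite on_edge0 -xe subr0 => h.
have gle : fine (sqnorm (len e) (g e)) <= N.
  have := @sum_fine_le _ _ g [:: e] _ gy isT; rewrite big_seq1; apply.
  by move=> e'; have [] := fe e'.
have g0 : 0 <= fine (sqnorm (len e) (g e)) by apply: fine_ge0; exact: sqnorm_ge0.
have h2 : (f x - f (vpoint (source e))) ^+ 2 <= eps / 16.
  by apply: le_trans dN; apply: le_trans h _; apply: ler_pM => //; apply: ltW => //;
    exact: lt_trans sl ed.
have := sqr_ge0 (2 * f x - f (vpoint (source e))); nra.
Qed.

End ends.

(** * Spectral bounds *)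

Section spectral_bounds.
Variables (R : realType) (G : metric_graph R).
Implicit Types (f : gpoint G -> R) (g : edge G -> R -> R) (e : edge G).
Implicit Types (v r q : vertex G) (VV : set (vertex G + graph_end G)).

Hypothesis conn : connected [set: gpoint G].
Hypothesis vol0 : (0 < volume G)%E.
Hypothesis voly : (volume G < +oo)%E.
Hypothesis fin : locally_finite G.

Let L := fine (volume G).

Definition spectral_bound (c : R) VV := forall f g, graph_H10 VV f g ->
  c * fine (graph_sqnorm (fun e s => f (on_edge e s))) <= fine (graph_sqnorm g).

Definition spectral_gain VV :=
  exists2 k, pi / (2 * L) < k & spectral_bound (k ^+ 2) VV.

Lemma fine_volume_gt0 : 0 < L.
Proof. by apply: fine_gt0; rewrite vol0 voly. Qed.

(** The root may depend on f and eps, but [b] may not: this keeps the factor k tan b fixed while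
    f(r)^2 tends to zero. *)
Lemma growth_bound k b VV : 0 < k -> 0 <= b -> b < pi / 2 ->
  (forall f g, graph_H10 VV f g -> forall eps, 0 < eps -> exists2 r,
    f (vpoint r) ^+ 2 < eps &
    forall s : seq (edge G), exists2 C, grow (ground r) C /\ {subset s <= C.1} &
      - k * tan b * f (vpoint r) ^+ 2 <= \sum_(e <- C.1) edge_energy k f g e) ->
  spectral_bound (k ^+ 2) VV.
Proof.
move=> k0 b0 bpi H f g fg; have [fH1 _] := fg.
apply: energy_exhaustion => // s eps eps0.
have tb : 0 <= tan b by exact: tan_ge0.
have kt : 0 < k * tan b + 1 by rewrite ltr_wpDl// mulr_ge0// ltW.
have [r fr /(_ s)[C [rC sC] h]] := H f g fg _ (divr_gt0 eps0 kt).
have [uC _] := grow_uniq rC isT isT.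
exists C.1; split => //; apply: le_trans h.
rewrite !mulNr lerN2; move: fr; rewrite ltr_pdivlMr// mulrC => /ltW.
by apply: le_trans; rewrite ler_wpM2r ?sqr_ge0// lerDl.
Qed.

Lemma vertex_near0 VV f g p (eps : R) : graph_H10 VV f g -> VV p -> 0 < eps ->
  exists r, f (vpoint r) ^+ 2 < eps.
Proof.
move=> fg Vp eps0; case: p Vp => [r|c] Vp.
  by exists r; have [_ /(_ _ Vp) /= ->] := fg; rewrite expr0n.
have [e _] := exists_edge vol0.
have [|r _ h] := vertex_near conn vol0 voly fin (v := source e) fg Vp _ eps0 => //.
by exists r.
Qed.

Lemma total_len_grow_le r C : grow (ground r) C -> total_len C.1 <= L.
Proof.
by move=> rC; apply: total_len_le_volume => //; have [] := grow_uniq rC isT isT.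
Qed.

Lemma basic_bound VV k : VV !=set0 -> 0 < k -> k * L < pi / 2 ->
  spectral_bound (k ^+ 2) VV.
Proof.
move=> [p Vp] k0 kL; have L0 := fine_volume_gt0.
apply: (@growth_bound k (k * L)) => //; first by rewrite mulr_ge0// ltW.
move=> f g fg eps eps0; have [r fr] := vertex_near0 fg Vp eps0.
exists r => // s.
have [C rC sC] := grow_edges s (@ground_closed _ _ r) isT (connected_vpath conn).
exists C => //; have [fH1 _] := fg.
apply: (spanning_energy_ge k0 (graph_H1_energy_bound k0 fH1)) => //.
  exact: sqr_ge0.
by rewrite ler_pM2l//; exact: total_len_grow_le rC.
Qed.

(** Given a phase gain [c], the frequency can be raised slightly above pi/(2L) while the phase at
    the root stays below pi/2. *)
Lemma gain_frequency m e (c : R) : 0 < m -> 2 * m <= len e -> 0 < c ->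
  exists k b, [/\ pi / (2 * L) < k, 0 < k, 0 <= b, b < pi / 2 &
    [/\ k * L < pi / 2 + k * m, k * L - c <= b, k * L - k * m <= b &
        k * m < pi / 2]].
Proof.
move=> m0 me c0; have L0 := fine_volume_gt0; have pi0 := @pi_gt0 R.
have eL : len e <= L.
  have := @total_len_le_volume _ _ voly [:: e] isT.
  by rewrite /total_len big_seq1.
set k0 := pi / (2 * L).
have k00 : 0 < k0 by rewrite divr_gt0// mulr_gt0.
have k0L : k0 * L = pi / 2 by rewrite /k0; field; rewrite gt_eqF.
have k0m : 0 < k0 * m by rewrite mulr_gt0.
have k0m2 : 2 * (k0 * m) <= pi / 2.
  by rewrite -k0L mulrCA ler_pM2l//; exact: le_trans eL.
(* With k L = pi/2 + h and b = pi/2 - h, a gain of 2h suffices; half of the minimum ensures 2h <= c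
   and 2h <= k0 m. *)
pose h := Num.min c (k0 * m) / 2.
have h0 : 0 < h by rewrite divr_gt0// lt_min c0.
have hc : 2 * h <= c by rewrite /h mulrCA divff// mulr1 ge_min lexx.
have hm : 2 * h <= k0 * m by rewrite /h mulrCA divff// mulr1 ge_min lexx orbT.
have hL : 0 < h / L by rewrite divr_gt0.
have kL : (k0 + h / L) * L = pi / 2 + h by rewrite mulrDl k0L divfK// gt_eqF.
have hLm : h / L * m <= h / 2.
  rewrite mulrAC ler_pdivrMr//; have := le_trans me eL; nra.
have km : (k0 + h / L) * m = k0 * m + h / L * m by rewrite mulrDl.
have hLm0 : 0 < h / L * m by rewrite mulr_gt0.
exists (k0 + h / L), (pi / 2 - h); split; rewrite ?kL ?km; first lra.
- lra.
- lra.
- lra.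
- by split; lra.
Qed.

(** The gain depends on k, while k is chosen according to the gain. Monotonicity of the gap allows
    the gain at pi/(2L) to be used instead. *)
Lemma tan_frequency_le (k m : R) : 0 < m -> pi / (2 * L) < k -> k * m < pi / 2 ->
  atan_gap (tan (pi / (2 * L) * m)) <= atan_gap (tan (k * m)).
Proof.
move=> m0 kk km; have L0 := fine_volume_gt0; have pi0 := @pi_gt0 R.
have k00 : 0 < pi / (2 * L) by rewrite divr_gt0// mulr_gt0.
have h1 : 0 < pi / (2 * L) * m by rewrite mulr_gt0.
have h2 : pi / (2 * L) * m < k * m by rewrite ltr_pM2r.
have t0 : 0 < tan (pi / (2 * L) * m).
  have -> : 0 = tan 0 :> R by rewrite tan0.
  by rewrite ltr_tan// in_itv/=; apply/andP; split; lra.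
have t1 : tan (pi / (2 * L) * m) <= tan (k * m) by apply: tan_le; lra.
have := atanD_le_gap t0 t1 t1; rewrite /atan_gap; lra.
Qed.

Lemma branch_spectral_gain VV p v d1 d2 d3 : VV p -> p <> inl v ->
  dtail d1 = v -> dtail d2 = v -> dtail d3 = v -> uniq [:: d1; d2; d3] ->
  spectral_gain VV.
Proof.
move=> Vp pv t1 t2 t3 u3; have [m m0 hm] := incident_len_gt fin v.
have md : 2 * m <= len d1.1 by apply: hm; rewrite -t1 incident_dtail.
have L0 := fine_volume_gt0; have pi0 := @pi_gt0 R.
have c0 : 0 < atan_gap (tan (pi / (2 * L) * m)).
  (* The gain 1 is arbitrary: only k m < pi/2 is extracted, which makes the tangent at pi/(2L) m
     positive. *)
  have [k [b [kk k0 _ _ [_ _ _ km]]]] := gain_frequency m0 md ltr01.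
  apply: atan_gap_gt0; have -> : 0 = tan 0 :> R by rewrite tan0.
  have k00 : 0 < pi / (2 * L) by rewrite divr_gt0// mulr_gt0.
  have h1 : 0 < pi / (2 * L) * m by rewrite mulr_gt0.
  have h2 : pi / (2 * L) * m < k * m by rewrite ltr_pM2r.
  by rewrite ltr_tan// in_itv/=; apply/andP; split; lra.
have [k [b [kk k0 b0 bpi [h1 h2 _ h4]]]] := gain_frequency m0 md c0.
exists k => //; apply: (@growth_bound k b) => // f g fg eps eps0.
have [r rv fr] := vertex_near conn vol0 voly fin fg Vp pv eps0.
exists r => // s.
have [C [rC sC] H] := branch_gain (connected_vpath conn) rv t1 t2 t3 u3 m0 hm s.
exists C => //; have [fH1 _] := fg.
have kC : k * total_len C.1 <= k * L by rewrite ler_pM2l// (total_len_grow_le rC).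
apply: (H _ (fun v => f (vpoint v) ^+ 2) k b k0 (graph_H1_energy_bound k0 fH1)) => //.
- exact: sqr_ge0.
- exact: le_lt_trans h1.
have := tan_frequency_le m0 kk h4; lra.
Qed.

Lemma root_spectral_gain VV r d1 d2 : VV (inl r) ->
  dtail d1 = r -> dtail d2 = r -> d1 != d2 -> spectral_gain VV.
Proof.
move=> Vr t1 t2 d12; have [m m0 hm] := incident_len_gt fin r.
have md : 2 * m <= len d1.1 by apply: hm; rewrite -t1 incident_dtail.
have [k [b [kk k0 b0 bpi [h1 _ _ _]]]] := gain_frequency m0 md ltr01.
exists k => //; apply: (@growth_bound k b) => // f g fg eps eps0.
have fr : f (vpoint r) = 0 by have [_ /(_ _ Vr)] := fg.
exists r => [|s]; first by rewrite fr expr0n.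
have [C [rC sC] H] := root_gain (connected_vpath conn) t1 t2 d12 m0 hm s.
exists C => //; have [fH1 _] := fg; rewrite fr expr0n mulr0.
apply: (H _ (fun v => f (vpoint v) ^+ 2) k k0 (graph_H1_energy_bound k0 fH1)).
  by rewrite fr expr0n.
by apply: le_lt_trans h1; rewrite ler_pM2l// (total_len_grow_le rC).
Qed.

Lemma dirichlet_spectral_gain VV p q : VV p -> VV (inl q) -> p <> inl q ->
  spectral_gain VV.
Proof.
move=> Vp Vq pq; have [m m0 hm] := incident_len_gt fin q.
have [e eq] := exists_incident conn vol0 q.
have [k [b [kk k0 b0 bpi [_ _ h3 h4]]]] := gain_frequency m0 (hm _ eq) ltr01.
exists k => //; apply: (@growth_bound k b) => // f g fg eps eps0.
have [r rq fr] := vertex_near conn vol0 voly fin fg Vp pq eps0.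
exists r => // s.
have hm1 e' : incident e' q -> m <= len e' by move=> /hm; lra.
have [C [rC sC] H] := dirichlet_gain (connected_vpath conn) rq m0 hm1 s.
exists C => //; have [fH1 fV] := fg.
have kC : k * total_len C.1 <= k * L by rewrite ler_pM2l// (total_len_grow_le rC).
apply: (H _ (fun v => f (vpoint v) ^+ 2) k b k0 (graph_H1_energy_bound k0 fH1)) => //.
- exact: sqr_ge0.
- by have /= -> := fV _ Vq; rewrite expr0n.
- lra.
Qed.

End spectral_bounds.

Section lipschitz.
Variables (R : realType) (G : metric_graph R).
Implicit Types (x y : gpoint G) (e : edge G).
Variables (F : gpoint G -> R) (c : R).
Hypothesis F_lip : forall e s t, s \in `[0, len e] -> t \in `[0, len e] ->
  `|F (on_edge e s) - F (on_edge e t)| <= c * `|s - t|.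

Lemma walk_lip x y l : walk y x l -> `|F x - F y| <= c * l.
Proof.
elim=> [|e s t {}l sI tI _ IH]; first by rewrite subrr normr0 mulr0.
rewrite -(subrK (F (on_edge e t)) (F (on_edge e s))) -addrA mulrDr.
by apply: le_trans (ler_normD _ _) _; apply: lerD => //; exact: F_lip.
Qed.

Lemma lip_continuous : 0 <= c -> continuous F.
Proof.
move=> c0 x; apply/(@cvgrPdist_lt _ _ _ (nbhs x) (nbhs_filter x)) => eps eps0.
have c1 : 0 < c + 1 by rewrite ltr_wpDl.
apply/nbhs_ballP; exists (eps / (c + 1)); first exact: divr_gt0.
move=> y /gballP[l xy]; rewrite ltr_pdivlMr// => lt.
apply: le_lt_trans (walk_lip xy) _; apply: le_lt_trans lt.
have l0 := walk_ge0 xy; nra.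
Qed.

End lipschitz.

Lemma gdist_ge_lip (R : realType) (G : metric_graph R) (F : gpoint G -> R) x y :
  (forall e s t, s \in `[0, len e] -> t \in `[0, len e] ->
    `|F (on_edge e s) - F (on_edge e t)| <= `|s - t|) ->
  (`|F x - F y|%:E <= gdist x y)%E.
Proof.
move=> FL; apply: le_ereal_inf_tmp => _ [l xy <-]; rewrite lee_fin -[leRHS]mul1r.
by apply: walk_lip xy => e s t sI tI; rewrite mul1r; exact: FL.
Qed.

Section smooth.
Variable R : realType.
Notation mu := (@lebesgue_measure R).
Implicit Types (h g : R -> R) (l : R).

Lemma continuous_in_L2 l h : continuous h -> in_L2 l h.
Proof.
move=> ch; split.
  by apply: measurable_funTS; exact: continuous_measurable_fun.
have c2 : continuous (fun x => h x ^+ 2).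
  move=> x; rewrite (_ : (fun _ => _) = (fun x => h x * h x)).
    by apply: cvgM; exact: ch.
  by apply/funext => z; rewrite expr2.
have : mu.-integrable `[0, l] (EFin \o (fun x => h x ^+ 2)).
  apply: continuous_compact_integrable; first exact: segment_compact.
  exact: continuous_subspaceT.
move=> /integrableP[_]; rewrite /sqnorm.
by under eq_integral do rewrite /= ger0_norm ?sqr_ge0//.
Qed.

Lemma Rintegral_derive h g a b : a < b ->
  (forall x, is_derive x (1 : R) h (g x)) -> continuous g ->
  \int[mu]_(t in `[a, b]) g t = h b - h a.
Proof.
move=> ab hg cg.
have dh x : derivable h x 1 by exact: ex_derive.
have ch x : {for x, continuous h}.
  by apply/differentiable_continuous/derivable1_diffP; exact: dh.
rewrite /Rintegral (@continuous_FTC2 _ g h a b ab)//.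
- exact: continuous_subspaceT.
- split.
  + by move=> x _; exact: dh.
  + by apply: cvg_at_right_filter; exact: ch.
  + by apply: cvg_at_left_filter; exact: ch.
- by move=> x _; rewrite derive1E; exact: derive_val.
Qed.

Lemma smooth_in_H1 l h g : (forall x, is_derive x (1 : R) h (g x)) ->
  continuous g -> in_H1 l h g.
Proof.
move=> hg cg.
have ch : continuous h.
  move=> x; apply/differentiable_continuous/derivable1_diffP; exact: ex_derive.
split; [exact: continuous_in_L2|exact: continuous_in_L2|].
move=> x; rewrite in_itv/= le_eqVlt => /andP[/predU1P[<- _|x0 _]].
  by rewrite set_itv1 Rintegral_set1 addr0.
by rewrite (Rintegral_derive x0 hg cg) subrKC.
Qed.

Lemma eq_sqnorm l h g : {in `[0, l], h =1 g} -> sqnorm l h = sqnorm l g.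
Proof.
by move=> hg; apply: eq_integral => x; rewrite inE => xI; rewrite hg.
Qed.

(** A smooth formula on the line and a function composed with [on_edge] agree only on the edge
    itself. *)
Lemma eq_in_H1 l h h' g g' : {in `[0, l], h =1 h'} -> {in `[0, l], g =1 g'} ->
  0 <= l -> in_H1 l h g -> in_H1 l h' g'.
Proof.
move=> hh gg l0 [[mh hy] [mg gy] hE]; split.
- split; last by rewrite -(eq_sqnorm hh).
  by apply: eq_measurable_fun mh => x; rewrite inE; exact: hh.
- split; last by rewrite -(eq_sqnorm gg).
  by apply: eq_measurable_fun mg => x; rewrite inE; exact: gg.
move=> x xI; rewrite -!hh ?in_itv/= ?lexx// hE//; congr (_ + _).
apply: eq_Rintegral => t; rewrite inE/= in_itv/= => /andP[t0 tx]; apply: gg.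
by move: xI; rewrite !in_itv/= t0/= => /andP[_]; exact: le_trans.
Qed.

End smooth.

(** * Functions supported on one edge, and bounds for the lowest eigenvalue *)

Section bump.
Variables (R : realType) (G : metric_graph R) (e0 : edge G).
Implicit Types (x y : gpoint G) (e : edge G).

Definition edge_bump (h : R -> R) x : R :=
  if x is inr p then if (sval p).1 == e0 then h (sval p).2 else 0 else 0.

Lemma edge_bump_on_edge h e s : h 0 = 0 -> h (len e0) = 0 -> s \in `[0, len e] ->
  edge_bump h (on_edge e s) = if e == e0 then h s else 0.
Proof.
move=> h0 hl; case/on_edgeP => [->|->|p pE _] /=; last by rewrite pE.
  by rewrite h0; case: ifP.
by case: eqP => [->|].
Qed.

Lemma edge_bump_lip h c : h 0 = 0 -> h (len e0) = 0 -> 0 <= c ->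
  (forall s t, s \in `[0, len e0] -> t \in `[0, len e0] ->
    `|h s - h t| <= c * `|s - t|) ->
  forall e s t, s \in `[0, len e] -> t \in `[0, len e] ->
    `|edge_bump h (on_edge e s) - edge_bump h (on_edge e t)| <= c * `|s - t|.
Proof.
move=> h0 hl c0 hL e s t sI tI; rewrite !edge_bump_on_edge//.
case: eqP sI tI => [->|_ _ _]; first exact: hL.
by rewrite subrr normr0 mulr_ge0.
Qed.

End bump.

Section lowest_eigenvalue.
Variables (R : realType) (G : metric_graph R).
Notation mu := (@lebesgue_measure R).
Implicit Types (f : gpoint G -> R) (g : edge G -> R -> R) (e : edge G).
Implicit Types (v r q : vertex G) (VV : set (vertex G + graph_end G)).

Hypothesis conn : connected [set: gpoint G].
Hypothesis vol0 : (0 < volume G)%E.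
Hypothesis voly : (volume G < +oo)%E.

Lemma sqnorm_le_bounded l (h : R -> R) (M : R) : 0 < l -> in_L2 l h ->
  {in `[0, l], forall s, `|h s| <= M} -> (sqnorm l h <= (M ^+ 2 * l)%:E)%E.
Proof.
move=> l0 hL2 hM; rewrite -in_L2_fineK// lee_fin.
rewrite -[fine _]/(\int[mu]_(t in `[0, l]) (h t ^+ 2)).
have muE := lebesgue_measure_itv `[0, l].
apply: (@le_trans _ _ (\int[mu]_(t in `[0, l]) (M ^+ 2))).
  apply: le_Rintegral => //.
  - exact: in_L2_integrable_sqr.
  - exact: (@integrable_cst_itv R (M ^+ 2) l true false 0 l).
  move=> t tI; rewrite -[h t ^+ 2]real_normK ?num_real// ler_pXn2r ?nnegrE//.
    exact: hM.
  exact: le_trans (normr_ge0 _) (hM t tI).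
by rewrite Rintegral_cst// [X in fine X]muE /= lte_fin l0 /= subr0.
Qed.

Lemma smooth_graph_H1 f g (M : R) : continuous f ->
  (forall e, exists h h' : R -> R, [/\ forall x, is_derive x (1 : R) h (h' x),
     continuous h', {in `[0, len e], h =1 fun s => f (on_edge e s)},
     {in `[0, len e], h' =1 g e} &
     {in `[0, len e], forall s, `|h s| <= M /\ `|h' s| <= M}]) ->
  graph_H1 f g.
Proof.
move=> cf H.
have fH1 e : in_H1 (len e) (fun s => f (on_edge e s)) (g e).
  have [h [h' [dh ch hf hg _]]] := H e.
  apply: (eq_in_H1 hf hg); first by rewrite ltW// len_gt0.
  exact: smooth_in_H1.
split=> //; apply: (@le_lt_trans _ _ ((2 * M ^+ 2 * fine (volume G))%:E)); last exact: ltry.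
apply: esum_le_seq => s us.
apply: (@le_trans _ _ (\sum_(e <- s) (2 * M ^+ 2 * len e)%:E)%E).
  apply: lee_sum => e _; have [h [h' [dh ch hf hg hM]]] := H e.
  have [L2f L2g _] := fH1 e.
  rewrite (_ : 2 * M ^+ 2 * len e = M ^+ 2 * len e + M ^+ 2 * len e); last by ring.
  rewrite EFinD; apply: leeD; apply: sqnorm_le_bounded; rewrite ?len_gt0// => t tI.
    by rewrite -hf//; have [] := hM t tI.
  by rewrite -hg//; have [] := hM t tI.
rewrite sumEFin lee_fin -mulr_sumr ler_wpM2l//; last exact: total_len_le_volume.
by rewrite mulr_ge0// sqr_ge0.
Qed.

Lemma graph_sqnorm_gt0 f g x : graph_H1 f g -> f x != 0 ->
  0 < fine (graph_sqnorm (fun e s => f (on_edge e s))).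
Proof.
move=> fH1 fx; have [_ gy] := graph_H1_lty fH1; have [_ fe _] := fH1.
suff [e [s [sI fs]]] : exists e s, s \in `[0, len e] /\ f (on_edge e s) != 0.
  apply: lt_le_trans (in_H1_norm_gt0 (len_gt0 e) (fe e) sI fs) _.
  have := @sum_fine_le _ _ (fun e s => f (on_edge e s)) [:: e] _ gy isT.
  by rewrite big_seq1; apply => e'; have [] := fe e'.
have [[v xv]|[e [s [/andP[s0 sl] xe]]]] := on_edge_surj x.
  have [e /orP[/eqP ev|/eqP ev]] := exists_incident conn vol0 v.
    exists e, 0; rewrite on_edge0 -ev -xv in_itv/= lexx ltW ?len_gt0//.
  exists e, (len e); rewrite on_edge_len -ev -xv in_itv/= lexx ltW ?len_gt0//.
by exists e, s; rewrite -xe in_itv/= !ltW.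
Qed.

(** Shows that the infimum defining [lambda1] is over a nonempty set. The parabola s (l - s) on one
    edge vanishes at all vertices, and near every end because ends avoid that edge. *)
Lemma bump_graph_H10 VV : exists f g, graph_H10 VV f g /\ exists x, f x != 0.
Proof.
have [e0 _] := exists_edge vol0; have l0 := len_gt0 e0.
set l := len e0 in l0 *.
pose h s := s * (l - s); pose h' s := l - 2 * s.
have h0 : h 0 = 0 by rewrite /h mul0r.
have hl : h (len e0) = 0 by rewrite /h subrr mulr0.
have dh (x : R) : is_derive x (1 : R) h (h' x).
  rewrite /h /h'; apply: is_derive_eq.
  by rewrite /GRing.scale/=; ring.
have ch' : continuous h'.
  move=> x; apply: cvgB; first exact: cvg_cst.
  by apply: cvgM; [exact: cvg_cst|exact: cvg_id].
pose g e s := if e == e0 then h' s else 0.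
exists (edge_bump e0 h), g; split; last first.
  exists (on_edge e0 (l / 2)); rewrite edge_bump_on_edge//; last first.
    by rewrite in_itv/= -/l; apply/andP; split; lra.
  by rewrite eqxx /h mulf_neq0// gt_eqF//; lra.
split.
  apply: (@smooth_graph_H1 _ _ (l + l ^+ 2)).
    apply: (@lip_continuous _ _ _ l); last exact: ltW.
    apply: edge_bump_lip => //; first exact: ltW.
    move=> s t /[!in_itv]/= /andP[s0 sl] /andP[t0 tl].
    rewrite /h (_ : s * (l - s) - t * (l - t) = (l - s - t) * (s - t)); last by ring.
    by rewrite normrM ler_wpM2r// ler_norml; apply/andP; split; rewrite -/l in sl tl; lra.
  move=> e; have [->|ee0] := eqVneq e e0.
    exists h, h'; split => //.
    - by move=> s sI; rewrite edge_bump_on_edge// eqxx.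
    - by move=> s sI; rewrite /g eqxx.
    move=> s /[!in_itv]/= /andP[s0 sl]; rewrite -/l in sl.
    by rewrite /h /h' !ler_norml; split; apply/andP; split; nra.
  exists (cst 0), (cst 0); split.
  - by move=> x; exact: is_derive_cst.
  - by move=> x; exact: cvg_cst.
  - by move=> s sI; rewrite edge_bump_on_edge// (negbTE ee0).
  - by move=> s sI; rewrite /g (negbTE ee0).
  - by move=> s _ /=; rewrite normr0 addr_ge0 ?sqr_ge0// ltW.
case=> [v _ //|c _] U cU x Ux.
have EU := graph_end_seq cU.
have [n Hn] := end_avoids_edge e0 EU.
apply: cvg_near_cst; exists n => // m /= nm.
have Un := end_seq_le EU nm (Ux m).
have [[v ->//]|[e [s [/andP[s0 sl] xe]]]] := on_edge_surj (x m).
have sI : s \in `[0, len e] by rewrite in_itv/= !ltW.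
rewrite xe edge_bump_on_edge//; case: eqP => [ee0|//].
by rewrite ee0 in xe sI; case: (Hn s sI); rewrite -xe.
Qed.

Lemma lambda1_ge VV (c : R) : spectral_bound c VV -> c <= lambda1 VV.
Proof.
move=> cV; apply: lb_le_inf.
  have [f [g [fg fx]]] := bump_graph_H10 VV.
  by exists (rayleigh f g), f, g; split.
move=> _ [f [g [fg [x fx] ->]]].
by rewrite /rayleigh ler_pdivlMr ?cV// (graph_sqnorm_gt0 fg.1 fx).
Qed.

Lemma lambda1_le VV (c : R) f g x : graph_H10 VV f g -> f x != 0 ->
  fine (graph_sqnorm g) <= c * fine (graph_sqnorm (fun e s => f (on_edge e s))) ->
  lambda1 VV <= c.
Proof.
move=> fg fx fc; apply: (@le_trans _ _ (rayleigh f g)).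
  apply: ge_inf; last by exists f, g; split => //; exists x.
  exists 0 => _ [f1 [g1 [_ _ ->]]]; rewrite /rayleigh divr_ge0// fine_ge0//;
    by apply: esum_ge0 => e _; exact: sqnorm_ge0.
by rewrite /rayleigh ler_pdivrMr// (graph_sqnorm_gt0 fg.1 fx).
Qed.

End lowest_eigenvalue.

(** * The interval *)

Section midpoint.
Variable R : realType.
Implicit Types (u : R -> R) (m s t a b : R).

Lemma dist_left a m t : t <= m -> `|a| = m - t -> `|a + m| <= t -> a = t - m.
Proof. by move=> tm; rewrite ler_norml => + /andP[_]; have [?|?] := ger0P a; lra. Qed.

Lemma dist_right a m : 0 < m -> `|a| = m -> `|a - m / 2| <= m / 2 -> a = m.
Proof. by move=> m0; rewrite ler_norml => + /andP[+ _]; have [?|?] := ger0P a; lra. Qed.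

(** The left half is fixed by the value at 0 and the Lipschitz bound, the open right half by
    injectivity, the endpoint 2m again by the Lipschitz bound. *)
Lemma midpoint_affine1 u m : 0 < m ->
  (forall s, 0 <= s -> s <= 2 * m -> `|u s - u m| = `|s - m|) ->
  (forall s t, 0 <= s -> s <= 2 * m -> 0 <= t -> t <= 2 * m ->
     `|u s - u t| <= `|s - t|) ->
  (forall s t, 0 < s -> s < 2 * m -> 0 <= t -> t <= 2 * m -> u s = u t -> s = t) ->
  u 0 - u m = - m ->
  forall s, 0 <= s -> s <= 2 * m -> u s - u m = s - m.
Proof.
move=> m0 um ul uinj u0.
have left_ t : 0 <= t -> t <= m -> u t - u m = t - m.
  move=> t0 tm; have tl : t <= 2 * m by lra.
  apply: dist_left => //; first by rewrite um// ler0_norm ?subr_le0// opprB.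
  rewrite -[X in _ + X]opprK -u0 opprB addrA subrK.
  have := ul t 0 t0 tl (lexx _) ltac:(lra).
  by rewrite subr0 [`|t|]ger0_norm.
have right_ t : m < t -> t < 2 * m -> u t - u m = t - m.
  move=> mt tl; have t0 : 0 < t by exact: lt_trans mt.
  have h1 := um t (ltW t0) (ltW tl); rewrite [`|t - m|]gtr0_norm ?subr_gt0// in h1.
  have h2 := left_ (2 * m - t) ltac:(lra) ltac:(lra).
  have [|h] := ger0P (u t - u m); first by move=> h; rewrite ger0_norm in h1.
  (* With the wrong sign [u] folds back at the midpoint and takes the value of the mirror image of
     [t]. *)
  have E : u t = u (2 * m - t).
    by rewrite ltr0_norm// in h1; move: h1 h2; clear; lra.
  have := uinj t (2 * m - t) t0 tl ltac:(lra) ltac:(lra) E; move: mt; clear; lra.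
move=> s s0; rewrite le_eqVlt => /predU1P[->|sl]; last first.
  have [sm|ms] := leP s m; [exact: left_|exact: right_].
have l0 : 0 <= 2 * m by lra.
rewrite (_ : 2 * m - m = m); last by ring.
apply: dist_right => //.
  by rewrite um// (_ : 2 * m - m = m) ?gtr0_norm//; ring.
have h2 := right_ (3 * m / 2) ltac:(lra) ltac:(lra).
have := ul (2 * m) (3 * m / 2) l0 (lexx _) ltac:(lra) ltac:(lra).
rewrite (_ : 2 * m - 3 * m / 2 = m / 2); last by field.
rewrite [`|m / 2|]gtr0_norm ?divr_gt0//.
rewrite (_ : u (2 * m) - u m - m / 2 = u (2 * m) - u (3 * m / 2))//.
by move: h2; clear; lra.
Qed.

Lemma midpoint_affine u m : 0 < m ->
  (forall s, 0 <= s -> s <= 2 * m -> `|u s - u m| = `|s - m|) ->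
  (forall s t, 0 <= s -> s <= 2 * m -> 0 <= t -> t <= 2 * m ->
     `|u s - u t| <= `|s - t|) ->
  (forall s t, 0 < s -> s < 2 * m -> 0 <= t -> t <= 2 * m -> u s = u t -> s = t) ->
  exists d, (d = 1 \/ d = -1) /\
    forall s, 0 <= s -> s <= 2 * m -> u s = u m - d * m + d * s.
Proof.
move=> m0 um ul uinj.
have l0 : 0 <= 2 * m by lra.
have := um 0 (lexx _) l0; rewrite sub0r normrN [RHS]gtr0_norm//.
have [h u0|h u0] := ger0P (u 0 - u m).
  exists (-1); split=> [|s s0 sl]; first by right.
  have := @midpoint_affine1 (fun s => - u s) m m0 _ _ _ _ s s0 sl.
  move=> H; have : - u s - - u m = s - m; last by clear; lra.
  apply: H => [t t0 tl|t t' t0 tl t0' tl'|t t' t0 tl t0' tl'|].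
  - by rewrite -opprD normrN um.
  - by rewrite -opprD normrN ul.
  - by move=> /oppr_inj; exact: uinj.
  - by rewrite -opprD u0.
exists 1; split=> [|s s0 sl]; first by left.
have := @midpoint_affine1 u m m0 um ul uinj _ s s0 sl.
by move=> H; have := H ltac:(move: u0; clear; lra); clear; lra.
Qed.

End midpoint.

(** * Isometries into the line are affine on edges *)

Section isometry.
Variables (R : realType) (G : metric_graph R) (phi : gpoint G -> R).
Implicit Types (e : edge G) (x y : gpoint G).
Hypothesis phi_iso : forall x y, gdist x y = `|phi x - phi y|%:E.

(** Supported on one edge and 1-Lipschitz, a tent bounds distances in the graph from below. *)
Definition tent (m r s : R) : R := Num.max 0 (r - `|s - m|).

Lemma tent_lip m r s t : `|tent m r s - tent m r t| <= `|s - t|.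
Proof.
have h1 := ler_dist_dist (s - m) (t - m).
rewrite (_ : s - m - (t - m) = s - t) in h1; last by ring.
rewrite /tent; move: h1; set a := `|s - m|; set b := `|t - m|.
rewrite !ler_norml => /andP[h1 h2].
have [?|?] := leP 0 (r - a); have [?|?] := leP 0 (r - b); apply/andP; split; lra.
Qed.

Lemma iso_tent_le e m r : tent m r 0 = 0 -> tent m r (len e) = 0 -> forall x y,
  `|edge_bump e (tent m r) x - edge_bump e (tent m r) y| <= `|phi x - phi y|.
Proof.
move=> h0 hl x y; rewrite -lee_fin -phi_iso; apply: gdist_ge_lip => e' s t sI tI.
rewrite -[leRHS]mul1r; apply: edge_bump_lip => // s' t' _ _.
by rewrite mul1r; exact: tent_lip.
Qed.

Lemma iso_edge_le e s t : s \in `[0, len e] -> t \in `[0, len e] ->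
  `|phi (on_edge e s) - phi (on_edge e t)| <= `|s - t|.
Proof.
move=> sI tI; rewrite -lee_fin -phi_iso; apply: ereal_inf_lbound.
exists `|s - t| => //; rewrite -[`|_|]addr0.
by apply: walk_cons => //; exact: walk_nil.
Qed.

(** A tent with its peak at the point [s], as wide as the edge permits, separates this point from
    all others. *)
Lemma iso_inj_inner e e' s t : 0 < s < len e -> t \in `[0, len e'] ->
  phi (on_edge e s) = phi (on_edge e' t) -> e = e' /\ s = t.
Proof.
move=> /andP[s0 sl] tI pst.
have sI : s \in `[0, len e] by rewrite in_itv/= !ltW.
pose r := Num.min s (len e - s).
have r0 : 0 < r by rewrite lt_min s0 subr_gt0.
have rs : r <= s by rewrite ge_min lexx.
have rl : r <= len e - s by rewrite ge_min lexx orbT.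
have h0 : tent s r 0 = 0.
  by rewrite /tent sub0r normrN gtr0_norm// max_l// subr_le0.
have hl : tent s r (len e) = 0.
  by rewrite /tent gtr0_norm ?subr_gt0// max_l// subr_le0.
have := iso_tent_le h0 hl (on_edge e s) (on_edge e' t).
rewrite pst subrr normr0 !edge_bump_on_edge// eqxx.
have -> : tent s r s = r by rewrite /tent subrr normr0 subr0 max_r// ltW.
rewrite normr_le0 subr_eq0 => /eqP; case: eqP => [-> rt|_ r00]; last first.
  by move: r0; rewrite r00 ltxx.
split=> //; apply/eqP; rewrite eq_sym -subr_eq0 -normr_le0.
by move: rt; rewrite /tent; have [?|?] := leP 0 (r - `|t - s|); lra.
Qed.

(** An edge need not be known to be a shortest path between its endpoints, but from its midpoint
    every distance along it is exact: the tent over the whole edge gives the lower bound. *)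
Lemma iso_edge_affine e : exists c d, (d = 1 \/ d = -1) /\
  forall s, s \in `[0, len e] -> phi (on_edge e s) = c + d * s.
Proof.
have l0 := len_gt0 e; set l := len e in l0 *.
pose u s := phi (on_edge e s); pose m := l / 2.
have m0 : 0 < m by rewrite divr_gt0.
have ml : l = 2 * m by rewrite /m; field.
have inI s : 0 <= s -> s <= l -> s \in `[0, len e] by move=> ? ?; rewrite in_itv/= -/l; apply/andP.
have h0 : tent m m 0 = 0.
  by rewrite /tent sub0r normrN gtr0_norm// subrr maxxx.
have hl : tent m m (len e) = 0.
  by rewrite /tent -/l (_ : l - m = m) ?gtr0_norm ?subrr ?maxxx//; lra.
have um s : 0 <= s -> s <= l -> `|u s - u m| = `|s - m|.
  move=> s0 sl; apply/eqP; rewrite eq_le iso_edge_le ?inI//=; [|lra..].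
  have := iso_tent_le h0 hl (on_edge e s) (on_edge e m).
  rewrite !edge_bump_on_edge ?inI// ?eqxx; [|lra..].
  apply: le_trans; rewrite /tent subrr normr0 subr0 (max_r (ltW m0)).
  have [?|?] := leP s m.
    rewrite [`|s - m|]ler0_norm ?subr_le0//.
    rewrite max_r; last lra.
    rewrite ler0_norm; lra.
  rewrite [`|s - m|]gtr0_norm ?subr_gt0// max_r; last lra.
  rewrite ler0_norm; lra.
have [|||d [dd dE]] := @midpoint_affine R u m m0.
- by rewrite -ml; exact: um.
- by rewrite -ml => s t ? ? ? ?; apply: iso_edge_le; exact: inI.
- rewrite -ml => s t s0 sl t0 tl ut.
  by have [] := @iso_inj_inner e e s t (introT andP (conj s0 sl)) (inI _ t0 tl) ut.
exists (u m - d * m), d; split=> // s; rewrite in_itv/= -/l ml => /andP[s0 sl].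
exact: dE.
Qed.

End isometry.

(** * The sine as a test function on the interval *)

Section packing.
Variables (R : realType) (T : eqType) (a b : T -> R) (D : R -> R).
Hypothesis D_homo : forall x y, x <= y -> D x <= D y.

Lemma sum_disjoint_intervals (s : seq T) A B : A <= B -> uniq s ->
  (forall e, e \in s -> [/\ A <= a e, a e <= b e & b e <= B]) ->
  {in s &, forall e e', e != e' -> b e <= a e' \/ b e' <= a e} ->
  \sum_(e <- s) (D (b e) - D (a e)) <= D B - D A.
Proof.
(* Induction on a bound for the number of intervals: the first one separates the others into those
   to its left and those to its right. *)
elim: (size s) {-2}s (leqnn (size s)) A B => {s} [|n IH] s sn A B AB us sAB dis.
  by move: sn; rewrite leqn0 => /nilP->; rewrite big_nil subr_ge0 D_homo.
case: s sn us sAB dis => [|e s] /= sn us sAB dis.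
  by rewrite big_nil subr_ge0 D_homo.
have /andP[es us'] := us; have [Ae eb eB] := sAB e (mem_head _ _).
pose P x := b x <= a e.
have sizeP (Q : pred T) : (size [seq x <- s | Q x] <= n)%N.
  by rewrite size_filter (leq_trans (count_size _ _)).
have disP (Q : pred T) : {in [seq x <- s | Q x] &, forall x x', x != x' ->
    b x <= a x' \/ b x' <= a x}.
  move=> x x'; rewrite !mem_filter => /andP[_ xs] /andP[_ x's].
  by apply: dis; rewrite inE ?xs ?x's orbT.
have left_ : \sum_(x <- [seq x <- s | P x]) (D (b x) - D (a x)) <= D (a e) - D A.
  apply: IH => //; first exact: filter_uniq.
  move=> x; rewrite mem_filter => /andP[Px xs].
  by have [|h1 h2 h3] := sAB x; first by rewrite inE xs orbT.
have right_ : \sum_(x <- [seq x <- s | ~~ P x]) (D (b x) - D (a x)) <= D B - D (b e).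
  apply: IH => //; first exact: filter_uniq.
  move=> x; rewrite mem_filter => /andP[Px xs].
  have [|h1 h2 h3] := sAB x; first by rewrite inE xs orbT.
  split=> //; have [|||h|//] := dis x e.
  - by rewrite inE xs orbT.
  - exact: mem_head.
  - by apply: contraNneq es => <-.
  by move: Px; rewrite /P h.
rewrite big_cons (bigID P)/= -[X in _ + (X + _)]big_filter.
rewrite -[X in _ + (_ + X)]big_filter; lra.
Qed.

End packing.

Section interval_upper_bound.
Variables (R : realType) (G : metric_graph R) (psi : gpoint G -> R).
Notation mu := (@lebesgue_measure R).
Implicit Types (e : edge G) (x y : gpoint G).

Hypothesis conn : connected [set: gpoint G].
Hypothesis vol0 : (0 < volume G)%E.
Hypothesis voly : (volume G < +oo)%E.
Let L := fine (volume G).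
Let k : R := pi / (2 * L).
Hypothesis psi_iso : forall x y, gdist x y = `|psi x - psi y|%:E.
Hypothesis psi_onto : [set` `]0, L[] `<=` range psi.
Hypothesis psi_range : range psi `<=` [set` `[0, L]].
Variable p : vertex G + graph_end G.
Hypothesis psi_p : has_value_at psi p 0.

(** A primitive of cos^2(k x). *)
Let primitive (x : R) := x / 2 + sin (2 * k * x) / (4 * k).

Let L0 : 0 < L. Proof. exact: fine_volume_gt0. Qed.

Let k0 : 0 < k. Proof. by rewrite divr_gt0 ?pi_gt0// mulr_gt0. Qed.

Lemma primitive_derive c d (x : R) : d = 1 \/ d = -1 ->
  is_derive x (1 : R) (fun s => d * primitive (c + d * s)) (cos (k * (c + d * x)) ^+ 2).
Proof.
move=> dd; rewrite /primitive; apply: is_derive_eq.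
have d2 : d * d = 1 by case: dd => ->; rewrite ?mulr1// mulrNN mulr1.
have -> : cos (2 * k * (c + d * x)) = 2 * cos (k * (c + d * x)) ^+ 2 - 1.
  rewrite (_ : 2 * k * (c + d * x) = (k * (c + d * x)) *+ 2); last by ring.
  by rewrite cos_mulr2n; ring.
rewrite /GRing.scale/=; set C := cos _.
transitivity (d * d * C ^+ 2); last by rewrite d2 mul1r.
by field; rewrite gt_eqF.
Qed.

Lemma primitive_homo (x y : R) : x <= y -> primitive x <= primitive y.
Proof.
move=> xy.
pose F s := 1 * primitive (0 + 1 * s).
pose dF (s : R) := cos (k * (0 + 1 * s)) ^+ 2.
have dFP (s : R) : is_derive s (1 : R) F (dF s).
  by apply: primitive_derive; left.
have [c _] := @MVT_segment R F dF x y xy (fun z _ => dFP z)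
  (@derivable_within_continuous _ _ F _ (fun z _ => @ex_derive _ _ _ _ _ _ _ (dFP z))).
rewrite /F !mul1r !add0r => h; rewrite -subr_ge0 h mulr_ge0 ?subr_ge0//.
exact: sqr_ge0.
Qed.

Lemma primitiveL : primitive L - primitive 0 = L / 2.
Proof.
rewrite /primitive mulr0 sin0 (_ : 2 * k * L = pi); last first.
  by rewrite /k; field; rewrite gt_eqF.
by rewrite sinpi !mul0r; lra.
Qed.

Let f x := sin (k * psi x).

Lemma edge_coords : exists cd : edge G -> R * R, forall e,
  ((cd e).2 = 1 \/ (cd e).2 = -1) /\
  forall s, s \in `[0, len e] -> psi (on_edge e s) = (cd e).1 + (cd e).2 * s.
Proof.
have H e : exists cd : R * R, (cd.2 = 1 \/ cd.2 = -1) /\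
    forall s, s \in `[0, len e] -> psi (on_edge e s) = cd.1 + cd.2 * s.
  by have [c [d H]] := iso_edge_affine psi_iso e; exists (c, d).
by have [cd Hcd] := choice H; exists cd.
Qed.

Lemma continuous_affine_comp (h : R -> R) (c d : R) : continuous h ->
  continuous (fun s => h (k * (c + d * s))).
Proof.
move=> ch s; apply: (@continuous_comp _ _ _ (fun s => k * (c + d * s)) h); last exact: ch.
by apply: cvgM; [exact: cvg_cst|apply: cvgD; [exact: cvg_cst|apply: cvgM; [exact: cvg_cst|exact: cvg_id]]].
Qed.

Lemma interval_lambda1_le VV : VV = [set p] -> lambda1 VV <= k ^+ 2.
Proof.
move=> VVp; have [cd Hcd] := edge_coords.
pose c e := (cd e).1; pose d e := (cd e).2.
have dd e : d e = 1 \/ d e = -1 by have [] := Hcd e.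
have cdE e s : s \in `[0, len e] -> psi (on_edge e s) = c e + d e * s.
  by have [_] := Hcd e; apply.
pose g e s := k * d e * cos (k * (c e + d e * s)).
have psi_cont : continuous psi.
  apply: (@lip_continuous _ _ _ 1); last exact: ler01.
  by move=> e s t sI tI; rewrite mul1r; exact: iso_edge_le.
have fH1 : graph_H1 f g.
  apply: (@smooth_graph_H1 _ _ voly _ _ (1 + k)).
    move=> x; apply: (@continuous_comp _ _ _ psi (fun z => sin (k * z))); first exact: psi_cont.
    have := @continuous_affine_comp sin 0 1 (@continuous_sin R) (psi x).
    rewrite (_ : (fun s => sin (k * (0 + 1 * s))) = (fun z => sin (k * z)))//.
    by apply/funext => z; rewrite add0r mul1r.
  move=> e; exists (fun s => sin (k * (c e + d e * s))), (g e); split.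
  - move=> x; rewrite /g; apply: is_derive_eq; rewrite /GRing.scale/=; ring.
  - move=> x; apply: cvgM; first exact: cvg_cst.
    exact: (@continuous_affine_comp cos (c e) (d e) (@continuous_cos R)).
  - by move=> s sI; rewrite /f cdE.
  - by [].
  move=> s sI; split.
    by apply: le_trans (sin_max _) _; rewrite lerDl ltW.
  rewrite /g normrM.
  have -> : `|k * d e| = k.
    by case: (dd e) => ->; rewrite ?mulr1 ?mulrN1 ?normrN gtr0_norm.
  apply: (@le_trans _ _ (k * 1)); last by rewrite mulr1 lerDr.
  by rewrite ler_wpM2l ?(ltW k0)// cos_max.
have fH10 : graph_H10 VV f g.
  split=> // q; rewrite VVp => ->.
  move: psi_p; rewrite /has_value_at; case: (p) => [v pv|ce pc U cU x Ux].
    by rewrite /f pv mulr0 sin0.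
  have h := pc U cU x Ux.
  have ck : {for (0 : R), continuous (fun z : R => sin (k * z))}.
    have := @continuous_affine_comp sin 0 1 (@continuous_sin R) 0.
    rewrite (_ : (fun s => sin (k * (0 + 1 * s))) = (fun z => sin (k * z)))//.
    by apply/funext => z; rewrite add0r mul1r.
  have := cvg_comp (psi \o x) (fun z : R => sin (k * z)) h ck.
  by rewrite mulr0 sin0.
pose a e := Num.min (c e) (c e + d e * len e).
pose b e := Num.max (c e) (c e + d e * len e).
have ends e : d e * primitive (c e + d e * len e) - d e * primitive (c e + d e * 0) =
    primitive (b e) - primitive (a e).
  rewrite -mulrBr mulr0 addr0 /a /b; have l0 := len_gt0 e.
  by case: (dd e) => ->; rewrite ?mul1r ?mulN1r;
    [rewrite max_r ?min_l ?lerDl ?ltW//|rewrite max_l ?min_r ?gerBl ?ltW//; ring].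
have cc e : continuous (fun s => cos (k * (c e + d e * s)) ^+ 2).
  have h := @continuous_affine_comp cos (c e) (d e) (@continuous_cos R).
  move=> x; rewrite (_ : (fun s => _) =
    (fun s => cos (k * (c e + d e * s)) * cos (k * (c e + d e * s)))).
    by apply: cvgM; exact: h.
  by apply/funext => z; rewrite expr2.
have cos2 e : fine (sqnorm (len e) (g e)) =
    k ^+ 2 * (primitive (b e) - primitive (a e)).
  rewrite -[fine _]/(\int[mu]_(t in `[0, len e]) (g e t ^+ 2)).
  rewrite (_ : (fun t => g e t ^+ 2) =
    (fun t => k ^+ 2 * cos (k * (c e + d e * t)) ^+ 2)); last first.
    by apply/funext => t; rewrite /g; case: (dd e) => ->; ring.
  have dG (x : R) : is_derive x (1 : R)
      (fun s => k ^+ 2 * (d e * primitive (c e + d e * s)))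
      (k ^+ 2 * cos (k * (c e + d e * x)) ^+ 2).
    by have H := @primitive_derive (c e) (d e) x (dd e); exact: is_deriveZ.
  have cG : continuous (fun t => k ^+ 2 * cos (k * (c e + d e * t)) ^+ 2).
    by move=> x; apply: cvgM; [exact: cvg_cst|exact: cc].
  by rewrite (Rintegral_derive (len_gt0 e) dG cG) -mulrBr ends.
have sin2 e : fine (sqnorm (len e) (fun s => f (on_edge e s))) =
    len e - (primitive (b e) - primitive (a e)).
  rewrite -[fine _]/(\int[mu]_(t in `[0, len e]) (f (on_edge e t) ^+ 2)).
  transitivity (\int[mu]_(t in `[0, len e]) (1 - cos (k * (c e + d e * t)) ^+ 2)).
    by apply: eq_Rintegral => t; rewrite inE => tI; rewrite /f cdE// sin2cos2.
  have dG (x : R) : is_derive x (1 : R)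
      (fun s => s - d e * primitive (c e + d e * s))
      (1 - cos (k * (c e + d e * x)) ^+ 2).
    by have H := @primitive_derive (c e) (d e) x (dd e); exact: is_deriveB.
  have cG : continuous (fun t => 1 - cos (k * (c e + d e * t)) ^+ 2).
    by move=> x; apply: cvgB; [exact: cvg_cst|exact: cc].
  by rewrite (Rintegral_derive (len_gt0 e) dG cG) -ends; ring.
have ab e : b e - a e = len e.
  rewrite /a /b; have l0 := len_gt0 e; case: (dd e) => ->; rewrite ?mul1r ?mulN1r.
    by rewrite max_r ?min_l ?lerDl ?(ltW l0)//; ring.
  by rewrite max_l ?min_r ?gerBl ?(ltW l0)//; ring.
have inner e z : a e < z -> z < b e -> exists2 s, 0 < s < len e & psi (on_edge e s) = z.
  move=> az zb; have := cdE e; have := ab e; move: az zb; rewrite /a /b.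
  case: (dd e) => ->; rewrite ?mul1r ?mulN1r; have l0 := len_gt0 e.
    rewrite max_r ?min_l ?lerDl ?(ltW l0)// => az zb _ H.
    exists (z - c e); first by apply/andP; split; lra.
    by rewrite H ?in_itv/=; [ring|apply/andP; split; lra].
  rewrite max_l ?min_r ?gerBl ?(ltW l0)// => az zb _ H.
  exists (c e - z); first by apply/andP; split; lra.
  by rewrite H ?in_itv/=; [ring|apply/andP; split; lra].
have endpt e : 0 <= a e /\ b e <= L.
  have l0 := len_gt0 e.
  have E0 := cdE e 0; have El := cdE e (len e).
  rewrite !in_itv/= !lexx (ltW l0) /= mulr0 addr0 in E0 El.
  have RI x : 0 <= psi x <= L.
    have : [set` `[0, L]] (psi x) by apply: psi_range; exists x.
    by rewrite /= in_itv.
  have R0 : 0 <= c e <= L by rewrite -E0.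
  have Rl : 0 <= c e + d e * len e <= L by rewrite -El.
  by move: R0 Rl; rewrite /a /b le_min ge_max => /andP[-> ->] /andP[-> ->].
(* Overlapping images would share a point coming from the interior of two edges, against
   [iso_inj_inner]. *)
have cos_sum (s : seq (edge G)) : uniq s ->
    \sum_(e <- s) (primitive (b e) - primitive (a e)) <= L / 2.
  move=> us; rewrite -primitiveL.
  apply: (sum_disjoint_intervals primitive_homo (ltW L0) us).
    move=> e _; have [h1 h2] := endpt e; split=> //.
    by rewrite -subr_ge0 ab ltW// len_gt0.
  move=> e e' _ _ ee'; apply: contrapT => H.
  have h1 : a e' < b e by rewrite ltNge; apply/negP => h; apply: H; left.
  have h2 : a e < b e' by rewrite ltNge; apply/negP => h; apply: H; right.
  have [h3 h4] : a e < b e /\ a e' < b e' by rewrite -subr_gt0 ab -[a e' < _]subr_gt0 ab !len_gt0.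
  pose z := (Num.max (a e) (a e') + Num.min (b e) (b e')) / 2.
  have zz : Num.max (a e) (a e') < Num.min (b e) (b e') by rewrite gt_max !lt_min h1 h2 h3 h4.
  have z1 : Num.max (a e) (a e') < z by rewrite /z; lra.
  have z2 : z < Num.min (b e) (b e') by rewrite /z; lra.
  move: z1 z2; rewrite gt_max lt_min => /andP[z1 z2] /andP[z3 z4].
  have [s0 sI es] := inner e z z1 z3; have [t /andP[t0 tl] et] := inner e' z z2 z4.
  have tI : t \in `[0, len e'] by rewrite in_itv/= !ltW.
  have [ee _] := iso_inj_inner psi_iso sI tI (etrans es (esym et)).
  by rewrite ee eqxx in ee'.
have [x0 fx0] : exists x, f x != 0.
  have L1 : 0 < L by exact: L0.
  have [x _ xL] : range psi (L / 2) by apply: psi_onto; rewrite /= in_itv/=; apply/andP; split; lra.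
  exists x; rewrite /f xL gt_eqF// sin_gt0_pihalf//; have pi0 := @pi_gt0 R.
  rewrite (_ : k * (L / 2) = pi / 4); last by rewrite /k; field; rewrite gt_eqF.
  by apply/andP; split; lra.
apply: (lambda1_le conn vol0 fH10 fx0).
have [gy fy] := graph_H1_lty fH1; have [_ fe _] := fH1.
have L2f e : in_L2 (len e) (fun s => f (on_edge e s)) by have [] := fe e.
have L2g e : in_L2 (len e) (g e) by have [] := fe e.
have k2 : 0 < k ^+ 2 by rewrite exprn_gt0.
have g0 : (0 <= graph_sqnorm g)%E by apply: esum_ge0 => e _; exact: sqnorm_ge0.
have gle : fine (graph_sqnorm g) <= k ^+ 2 * (L / 2).
  rewrite -lee_fin fineK ?ge0_fin_numE//.
  apply: graph_sqnorm_le => // s us; under eq_bigr do rewrite cos2.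
  by rewrite -mulr_sumr ler_pM2l// cos_sum.
apply: le_trans gle _; rewrite ler_pM2l//.
apply/ler_addgt0Pr => eps eps0.
have [s us sL] := volume_approx voly eps0.
have := sum_fine_le L2f fy us; under eq_bigr do rewrite sin2.
rewrite sumrB; have := cos_sum s us; rewrite /total_len -/L in sL *; lra.
Qed.

End interval_upper_bound.

(** * Reconstruction of the interval *)

Section lines.
Variables (R : realType) (G : metric_graph R).
Notation V := (vertex G).
Notation E := (edge G).
Implicit Types (B C : seq E * seq V) (d : dart G) (e : E) (v w u r a b : V).
Implicit Types (x y : gpoint G) (phi : gpoint G -> R).

(** The points of the finite subgraph; the first alternative accounts for the root before any edge
    is present. *)
Definition cov B x := (exists2 v, v \in B.2 & x = vpoint v) \/
  exists e s, [/\ e \in B.1, s \in `[0, len e] & x = on_edge e s].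

Definition on_dart d (t : R) := on_edge d.1 (if d.2 then t else len d.1 - t).

Lemma on_dart0 d : on_dart d 0 = vpoint (dtail d).
Proof.
by case: d => e [|]; rewrite /on_dart /dtail /= ?subr0 ?on_edge0 ?on_edge_len.
Qed.

Lemma on_dart_len d : on_dart d (len d.1) = vpoint (dhead d).
Proof.
by case: d => e [|]; rewrite /on_dart /dhead /= ?subrr ?on_edge0 ?on_edge_len.
Qed.

Lemma dart_itv d (t : R) : t \in `[0, len d.1] ->
  (if d.2 then t else len d.1 - t) \in `[0, len d.1].
Proof. by case: d => e [|] //=; rewrite !in_itv/= => /andP[? ?]; apply/andP; split; lra. Qed.

Lemma on_edge_dart d s : s \in `[0, len d.1] ->
  exists2 t, t \in `[0, len d.1] & on_edge d.1 s = on_dart d t.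
Proof.
move=> sI; exists (if d.2 then s else len d.1 - s); first exact: dart_itv.
by rewrite /on_dart; case: d.2; rewrite ?subKr.
Qed.

Lemma on_dart_walk d (s t : R) : s \in `[0, len d.1] -> t \in `[0, len d.1] ->
  walk (on_dart d t) (on_dart d s) `|s - t|.
Proof.
move=> sI tI; rewrite -[`|_|]addr0.
have -> : `|s - t| = `|(if d.2 then s else len d.1 - s) - (if d.2 then t else len d.1 - t)|.
  case: d.2 => //; rewrite (_ : _ - _ - (_ - _) = t - s); last by ring.
  exact: distrC.
by apply: walk_cons; [exact: dart_itv|exact: dart_itv|exact: walk_nil].
Qed.

(** When all degrees are at most two, no further edge can be attached at such a vertex. *)
Definition saturated B v := exists d1 d2, [/\ d1 != d2,
  dtail d1 = v /\ dtail d2 = v, d1.1 \in B.1 & d2.1 \in B.1].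

Definition line_ends B a b := [/\ a \in B.2, b \in B.2,
  forall v, v \in B.2 -> v != a -> v != b -> saturated B v &
  (a = b /\ B = ground a) \/ (a != b /\ exists da db,
    [/\ dtail da = a, dtail db = b, da.1 \in B.1 & db.1 \in B.1])].

(** Walks only bound distances from above. The lower bound is global and follows later, once [phi]
    is 1-Lipschitz on all edges. *)
Definition line_coords B phi a b := [/\
  forall e, e \in B.1 -> exists c g : R, (g = 1 \/ g = -1) /\
    forall s, s \in `[0, len e] -> phi (on_edge e s) = c + g * s,
  forall x y, cov B x -> cov B y -> walk y x `|phi x - phi y|,
  forall x, cov B x -> phi (vpoint a) <= phi x <= phi (vpoint b),
  phi (vpoint b) - phi (vpoint a) = total_len B.1 &
  forall t, phi (vpoint a) <= t -> t <= phi (vpoint b) ->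
    exists2 x, cov B x & phi x = t].

(** Picone's inequality along the whole line. The phase may change sign, which two Dirichlet ends
    require. *)
Definition line_energy B a b := forall k W F th, 0 < k -> energy_bound k W F ->
  th < pi / 2 -> - (pi / 2) < th - k * total_len B.1 ->
  k * tan (th - k * total_len B.1) * F b - k * tan th * F a <=
  \sum_(e <- B.1) W e.

Definition line B phi a b := [/\ closed_in B, line_ends B a b,
  line_coords B phi a b & line_energy B a b].

Lemma line_rev B phi a b : line B phi a b -> line B (fun x => - phi x) b a.
Proof.
move=> [cB [aB bB sat ends] [M1 M2 M3 M4 M5] PE]; split=> //.
- split=> //; first by move=> v vB va vb; exact: sat.
  case: ends => [[-> ->]|[ab [da [db [h1 h2 h3 h4]]]]]; first by left.
  by right; split; [rewrite eq_sym|exists db, da].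
- split=> [e /M1[c [d [dd H]]]|x y xB yB|x /M3/andP[h1 h2]| |t t1 t2].
  + exists (- c), (- d); split=> [|s /H ->]; last by ring.
    by case: dd => ->; [right|left; rewrite opprK].
  + by rewrite -opprD normrN; exact: M2.
  + by rewrite !lerN2 h1 h2.
  + by rewrite -M4; ring.
  + have [||x xB xt] := M5 (- t); [lra|lra|].
    by exists x => //; rewrite xt opprK.
move=> k W F th k0 WF th1 th2.
have := PE k W F (k * total_len B.1 - th) k0 WF.
rewrite (_ : k * total_len B.1 - th - k * total_len B.1 = - th); last by ring.
rewrite (_ : k * total_len B.1 - th = - (th - k * total_len B.1)); last by ring.
rewrite !tanN => H; have := H ltac:(lra) ltac:(lra); lra.
Qed.

Lemma cov_step B C x : step B C -> cov B x -> cov C x.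
Proof.
move=> /step_sub[h1 h2] [[v /h2 vC ->]|[e [s [/h1 eC sI ->]]]]; first by left; exists v.
by right; exists e, s.
Qed.

Definition extend phi d x : R :=
  match x with
  | inl v => if v == dhead d then phi (vpoint (dtail d)) + len d.1 else phi x
  | inr p => if (sval p).1 == d.1 then phi (vpoint (dtail d)) +
      (if d.2 then (sval p).2 else len d.1 - (sval p).2) else phi x
  end.

Lemma extend_on_dart phi d t : dtail d != dhead d -> t \in `[0, len d.1] ->
  extend phi d (on_dart d t) = phi (vpoint (dtail d)) + t.
Proof.
move=> dd tI; have := tI; rewrite in_itv/= => /andP[].
rewrite le_eqVlt => /predU1P[<- _|t0].
  by rewrite on_dart0 /extend /vpoint (negbTE dd) addr0.
rewrite le_eqVlt => /predU1P[->|tl].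
  by rewrite on_dart_len /extend /vpoint eqxx.
rewrite /on_dart; case/on_edgeP: (dart_itv tI) => [h|h|p pE _].
- by exfalso; move: h; case: d.2; lra.
- by exfalso; move: h; case: d.2; lra.
by rewrite /extend pE /= eqxx; case: d.2; rewrite ?subKr.
Qed.

Lemma extend_cov B phi d x : closed_in B -> dhead d \notin B.2 ->
  d.1 \notin B.1 -> cov B x -> extend phi d x = phi x.
Proof.
move=> cB hB dB.
have ev v : v \in B.2 -> extend phi d (vpoint v) = phi (vpoint v).
  by move=> vB; rewrite /extend /vpoint; case: eqP => // vd; rewrite vd (negbTE hB) in vB.
case=> [[v vB ->]|[e [s [eB sI ->]]]]; first exact: ev.
have [h1 h2] := cB e eB.
case/on_edgeP: sI => [_|_|p pE _]; [exact: ev|exact: ev|].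
rewrite /extend pE /=; case: eqP => // ed; by rewrite -ed eB in dB.
Qed.

(** The new edge continues the coordinate with slope one away from [b], the maximum so far, so that
    walks through [b] realise differences of coordinates. *)
Lemma line_extend B phi a b d : line B phi a b -> dtail d = b ->
  dhead d \notin B.2 -> d.1 \notin B.1 ->
  line (d.1 :: B.1, dhead d :: B.2) (extend phi d) a (dhead d).
Proof.
move=> [cB [aB bB sat ends] [M1 M2 M3 M4 M5] PE] db hB dB.
set C := (_, _); set w := dhead d in hB C *; set phi' := extend phi d.
have tB : dtail d \in B.2 by rewrite db.
have st : step B C by exact: step_leaf.
have cC : closed_in C by exact: step_closed st cB.
have bw : b != w by apply: contraNneq hB => <-.
have aw : a != w by apply: contraNneq hB => <-.
have old x : cov B x -> phi' x = phi x by exact: extend_cov.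
have new t : t \in `[0, len d.1] -> phi' (on_dart d t) = phi (vpoint b) + t.
  by move=> tI; rewrite /phi' extend_on_dart ?db.
have l0 := len_gt0 d.1.
have cova : cov B (vpoint a) by left; exists a.
have covb : cov B (vpoint b) by left; exists b.
have lI : len d.1 \in `[0, len d.1] by rewrite in_itv/= lexx ltW.
have lI0 : 0 \in `[0, len d.1] by rewrite in_itv/= lexx ltW.
have phiw : phi' (vpoint w) = phi (vpoint b) + len d.1 by rewrite -on_dart_len new.
have phia : phi' (vpoint a) = phi (vpoint a) by exact: old.
have covC x : cov C x <-> cov B x \/ exists2 t, t \in `[0, len d.1] & x = on_dart d t.
  split.
    case=> [[v]|[e [s [+ sI xE]]]]; rewrite inE => /predU1P[].
    - by move=> -> ->; right; exists (len d.1); rewrite ?on_dart_len.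
    - by move=> vB ->; left; left; exists v.
    - by move=> ed; right; rewrite ed in sI xE; rewrite xE; exact: on_edge_dart.
    - by move=> eB; left; right; exists e, s.
  case=> [xB|[t tI ->]]; first exact: cov_step xB.
  right; exists d.1; rewrite /on_dart; eexists; split; [exact: mem_head| |reflexivity].
  exact: dart_itv.
have wOn x t : cov B x -> t \in `[0, len d.1] ->
    walk (on_dart d t) x (phi (vpoint b) + t - phi x).
  move=> xB tI; have /andP[_ xb] := M3 x xB.
  have h1 := M2 x (vpoint b) xB covb.
  have h2 := on_dart_walk lI0 tI.
  rewrite on_dart0 db in h2; have := walk_cat h1 h2.
  have t0 : 0 <= t by move: tI; rewrite in_itv/= => /andP[].
  rewrite sub0r normrN [`|t|]ger0_norm// distrC ger0_norm ?subr_ge0//.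
  by rewrite addrAC.
split=> //.
- split; [by rewrite inE aB orbT|exact: mem_head| |].
  + move=> v; rewrite inE => /predU1P[->|vB] va vw; first by rewrite eqxx in vw.
    have [vb|vb] := eqVneq v b; last first.
      have [d1 [d2 [h1 h2 h3 h4]]] := sat v vB va vb.
      by exists d1, d2; split; rewrite // inE ?h3 ?h4 orbT.
    case: ends => [[ab BE]|[ab [da [db' [h1 h2 h3 h4]]]]]; first by rewrite vb ab eqxx in va.
    exists db', d; split; [|by rewrite db vb| |exact: mem_head].
      by apply: contraNneq dB => <-.
    by rewrite inE h4 orbT.
  + right; split=> //.
    have [d' d'd d'h] : exists2 d', d'.1 = d.1 & dtail d' = w.
      by exists (d.1, ~~ d.2) => //; rewrite /w; case: (d) => e [|].
    case: ends => [[ab BE]|[ab [da [db' [h1 h2 h3 h4]]]]].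
      by exists d, d'; split => //; rewrite ?db ?ab// ?d'd mem_head.
    by exists da, d'; split => //; rewrite inE ?h3 ?orbT// d'd eqxx.
- split.
  + move=> e; rewrite inE => /predU1P[->|eB].
      exists (phi (vpoint b) + (if d.2 then 0 else len d.1)), (if d.2 then 1 else -1).
      split; first by case: d.2; [left|right].
      move=> s sI; have [t tI st'] := on_edge_dart sI.
      have := new _ (dart_itv sI); rewrite /on_dart; case: d.2; rewrite ?subKr => ->; ring.
    have [c [d' [dd H]]] := M1 e eB; exists c, d'; split=> // s sI.
    by rewrite old ?H//; right; exists e, s.
  + move=> x y /covC[xB|[t tI ->]] /covC[yB|[t' tI' ->]].
    * by rewrite !old//; exact: M2.
    * rewrite (old _ xB) (new _ tI') distrC ger0_norm; first exact: wOn.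
      by apply: walk_ge0 (wOn x t' xB tI').
    * rewrite (old _ yB) (new _ tI) ger0_norm; first exact: walk_sym (wOn y t yB tI).
      by apply: walk_ge0 (wOn y t yB tI).
    * rewrite !new// (_ : _ + t - _ = t - t'); last by ring.
      exact: on_dart_walk.
  + move=> x; rewrite phia phiw => /covC[xB|[t + ->]].
      rewrite old//; have /andP[-> h] := M3 x xB; rewrite /=; lra.
    move=> tI; rewrite new//; move: tI; rewrite in_itv/= => /andP[t0 tl].
    by have /andP[h _] := M3 _ covb; apply/andP; split; lra.
  + by rewrite phia phiw /C /total_len big_cons -/(total_len _) -M4; ring.
  + move=> t; rewrite phia phiw => t1 t2.
    have [tb|bt] := leP t (phi (vpoint b)).
      have [x xB xt] := M5 t t1 tb.
      by exists x; [apply/covC; left|rewrite old].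
    have tI : t - phi (vpoint b) \in `[0, len d.1].
      by rewrite in_itv/=; apply/andP; split; lra.
    exists (on_dart d (t - phi (vpoint b))).
      by apply/covC; right; exists (t - phi (vpoint b)).
    by rewrite new//; ring.
move=> k W F th k0 WF th1 th2.
have lC : k * total_len C.1 = k * len d.1 + k * total_len B.1.
  by rewrite /C /total_len big_cons mulrDr.
have kl0 : 0 < k * len d.1 by rewrite mulr_gt0.
have kB0 : 0 <= k * total_len B.1 by rewrite mulr_ge0 ?total_len_ge0// ltW.
rewrite lC in th2 *; rewrite /C big_cons /=.
have h1 := PE k W F th k0 WF th1 ltac:(lra).
(* The phase at the new end is chosen so that, after this edge, it matches the phase of the old line
   at [b]. *)
have := WF d (th - (k * len d.1 + k * total_len B.1)) th2.
rewrite (_ : th - (k * len d.1 + k * total_len B.1) + k * len d.1 = th - k * total_len B.1); last by ring.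
move=> /(_ ltac:(lra)); rewrite db -/w; move: h1; clear; lra.
Qed.

End lines.

(** * Exhaustion by lines *)

Section line_limit.
Variables (R : realType) (G : metric_graph R).
Notation V := (vertex G).
Notation E := (edge G).
Implicit Types (B C : seq E * seq V) (d : dart G) (e : E) (v w u r a b : V).
Implicit Types (x y : gpoint G) (phi : gpoint G -> R).

Hypothesis conn : connected [set: gpoint G].
Hypothesis vol0 : (0 < volume G)%E.
Hypothesis voly : (volume G < +oo)%E.
Let L := fine (volume G).
Hypothesis deg2 : forall v d1 d2 d3, dtail d1 = v -> dtail d2 = v ->
  dtail d3 = v -> ~~ uniq [:: d1; d2; d3].
(* [G] is not a cycle. *)
Hypothesis noncyclic : forall s : seq E, (forall e, e \in s) ->
  (forall v, saturated (s, [::] : seq V) v) -> False.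

Lemma saturated_dart B v d : saturated B v -> dtail d = v -> d.1 \in B.1.
Proof.
move=> [d1 [d2 [d12 [t1 t2] h1 h2]]] dv.
have := deg2 dv t1 t2; rewrite /= !inE d12 !andbT negbK.
by move=> /orP[/eqP->|/eqP->].
Qed.

(** By connectedness a subgraph with no free place is all of G, which is then a cycle. *)
Lemma all_saturated B v : closed_in B -> v \in B.2 ->
  (forall w, w \in B.2 -> saturated B w) -> False.
Proof.
move=> cB vB sat.
have allV w : w \in B.2.
  elim: (connected_vpath conn v w) => // d _ dB.
  have dE := saturated_dart (sat _ dB) erefl.
  by have [h1 h2] := cB _ dE; have [[_ <-]|[<- _]] := dart_ends d.
apply: (noncyclic (s := B.1)) => [e|w]; last by have := sat w (allV w).
exact: (saturated_dart (d := (e, true)) (sat _ (allV (source e))) erefl).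
Qed.

Lemma saturated_step B C v : step B C -> saturated B v -> saturated C v.
Proof.
move=> /step_sub[sB _] [d1 [d2 [h1 h2 h3 h4]]].
by exists d1, d2; split; rewrite // sB.
Qed.

(** A chord can only use the two unsaturated ends, or be a loop at the initial vertex; in both cases
    it closes a cycle. *)
Lemma line_no_chord B phi a b e : line B phi a b -> step B (e :: B.1, B.2) ->
  e \notin B.1 -> source e \in B.2 -> target e \in B.2 -> False.
Proof.
move=> [cB [aB bB sat ends] _ _] st eB sB tB.
set C := (e :: B.1, B.2) in st.
have notsat v : incident e v -> ~ saturated B v.
  move=> /incident_dart[d de dv] /saturated_dart/(_ dv); rewrite de.
  by apply/negP.
have inab v : incident e v -> v \in B.2 -> v = a \/ v = b.
  move=> ev vB; apply: contrapT => H; apply: (notsat v ev); apply: sat => //.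
    by apply/eqP => va; apply: H; left.
  by apply/eqP => vb; apply: H; right.
have is_ : incident e (source e) by rewrite /incident eqxx.
have it : incident e (target e) by rewrite /incident eqxx orbT.
have cC : closed_in C by exact: step_closed st cB.
have loop_sat v : source e = v -> target e = v -> saturated C v.
  move=> sv tv; exists (e, true), (e, false).
  by split; [rewrite xpair_eqE andbF|exact: conj sv tv|exact: mem_head..].
apply: (all_saturated cC sB) => v vB.
case: ends => [[ab BE]|[ab [da [db [h1 h2 h3 h4]]]]].
  have Bv w : w \in B.2 -> w = a by rewrite BE /= inE => /eqP.
  by apply: loop_sat; rewrite (Bv _ vB) ?(Bv _ sB) ?(Bv _ tB).
have at_end v' d0 : dtail d0 = v' -> d0.1 \in B.1 -> incident e v' -> saturated C v'.
  move=> d0v d0B /incident_dart[d de dv]; exists d0, d; split => //.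
  - by apply: contraNneq eB => d0d; rewrite -de -d0d.
  - by rewrite /= inE d0B orbT.
  - by rewrite de mem_head.
(* A loop at an end of a line with edges would be the second and third dart there. *)
have noloop : source e <> target e.
  move=> st'; have [v' [d0 [d0v d0B sv']]] : exists v' d0, [/\ dtail d0 = v', d0.1 \in B.1 & source e = v'].
    by case: (inab _ is_ sB) => ->; [exists a, da|exists b, db].
  have := deg2 (v := v') (d1 := (e, true)) (d2 := (e, false)) (d3 := d0) sv'.
  rewrite /dtail /= -st' => /(_ sv' d0v); rewrite /= !inE.
  have n1 : (e, true) != d0.
    by apply: contraNneq eB => h; rewrite -h in d0B.
  have n2 : (e, false) != d0.
    by apply: contraNneq eB => h; rewrite -h in d0B.
  by rewrite xpair_eqE andbF (negbTE n1) (negbTE n2).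
have [va|va] := eqVneq v a.
  apply: (at_end v da); rewrite ?va// /incident.
  case: (inab _ is_ sB) => sa; first by rewrite sa eqxx.
  case: (inab _ it tB) => ta; first by rewrite ta eqxx orbT.
  by case: noloop; rewrite sa ta.
have [vb|vb] := eqVneq v b.
  apply: (at_end v db); rewrite ?vb// /incident.
  case: (inab _ it tB) => ta; last by rewrite ta eqxx orbT.
  case: (inab _ is_ sB) => sa; last by rewrite sa eqxx.
  by case: noloop; rewrite sa ta.
exact: saturated_step st (sat v vB va vb).
Qed.

Lemma line_step B C phi a b : line B phi a b -> step B C ->
  exists phi' a' b', line C phi' a' b' /\ forall x, cov B x -> phi' x = phi x.
Proof.
move=> ln st; have [cB [aB bB sat ends] _ _] := ln.
case: st => [d tB hB dB|e sB tB eB]; last first.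
  by case: (line_no_chord ln (step_chord sB tB eB) eB sB tB).
have [ub|ub] := eqVneq (dtail d) b.
  exists (extend phi d), a, (dhead d); split; first exact: line_extend ln ub hB dB.
  by move=> x xB; rewrite (extend_cov (B := B)).
have [ua|ua] := eqVneq (dtail d) a; last first.
  by have := saturated_dart (sat _ tB ua ub) erefl; rewrite (negbTE dB).
exists (fun x => - extend (fun x => - phi x) d x), (dhead d), b; split.
  by apply: line_rev; exact: line_extend (line_rev ln) ua hB dB.
by move=> x xB; rewrite (extend_cov (B := B))// opprK.
Qed.

Lemma line_grow B C phi a b : grow B C -> line B phi a b ->
  exists phi' a' b', line C phi' a' b' /\ forall x, cov B x -> phi' x = phi x.
Proof.
move=> + ln; elim=> [|{}C D BC [phi1 [a1 [b1 [ln1 H1]]]] CD].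
  by exists phi, a, b.
have [phi2 [a2 [b2 [ln2 H2]]]] := line_step ln1 CD.
exists phi2, a2, b2; split=> // x xB; rewrite H2 ?H1//.
elim: BC xB {ln1 H1 CD ln2 H2} => // {}C {}D _ IH CD xB.
by apply: cov_step CD _; exact: IH.
Qed.

Lemma cov_grow B C x : grow B C -> cov B x -> cov C x.
Proof. by move=> + xB; elim=> // {}C D _ xC /cov_step; exact. Qed.

Lemma line_ground r : line (ground r) (fun=> 0) r r.
Proof.
split=> //.
- split; [exact: mem_head|exact: mem_head| |by left].
  by move=> v; rewrite inE => /eqP-> /eqP.
- split => //.
  + move=> x y [[v + ->]|[e [s []//]]] [[w + ->]|[e [s []//]]].
    rewrite !inE => /eqP-> /eqP->; rewrite subrr normr0; exact: walk_nil.
  + by move=> x _; rewrite lexx.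
  + by rewrite /total_len big_nil subrr.
  + move=> t t1 t2; exists (vpoint r); first by left; exists r; rewrite ?mem_head.
    by apply/eqP; rewrite eq_le t1 t2.
move=> k W F th k0 WF _ _; rewrite /total_len !big_nil mulr0 subr0 subrr//.
Qed.

Definition exhaustion (B : nat -> seq E * seq V) (phi : gpoint G -> R)
    (a b : nat -> V) := [/\
  forall n, line (B n) phi (a n) (b n) /\ uniq (B n).1,
  forall m n x, (m <= n)%N -> cov (B m) x -> cov (B n) x,
  forall s : seq E, exists n, forall m, (n <= m)%N -> {subset s <= (B m).1} &
  forall x, exists n, cov (B n) x].

Lemma line_coords_eq B phi psi a b : line B phi a b ->
  (forall x, cov B x -> psi x = phi x) -> line B psi a b.
Proof.
move=> [cB ends [M1 M2 M3 M4 M5] PE] eq; split=> //.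
have [aB bB _ _] := ends.
have ea : psi (vpoint a) = phi (vpoint a) by apply: eq; left; exists a.
have eb : psi (vpoint b) = phi (vpoint b) by apply: eq; left; exists b.
split.
- move=> e eB; have [c [g [gg H]]] := M1 e eB; exists c, g; split=> // s sI.
  by rewrite -H// eq//; right; exists e, s.
- by move=> x y xB yB; rewrite !eq//; exact: M2.
- by move=> x xB; rewrite ea eb eq//; exact: M3.
- by rewrite ea eb.
- move=> t; rewrite ea eb => t1 t2; have [x xB xt] := M5 t t1 t2.
  by exists x; rewrite ?eq.
Qed.

(** Stage n + 1 absorbs the edge with code n. Coordinates are never changed once assigned, so they
    glue. *)
Lemma exists_exhaustion : exists (B : nat -> seq E * seq V) phi (a b : nat -> V),
  exhaustion B phi a b.
Proof.
have [e0 _] := exists_edge vol0; pose r := source e0.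
pose state := ((seq E * seq V) * (gpoint G -> R) * V * V)%type.
pose ok (s : state) := line s.1.1.1 s.1.1.2 s.1.2 s.2.
pose ext (s t : state) := grow s.1.1.1 t.1.1.1 /\
  forall x, cov s.1.1.1 x -> t.1.1.2 x = s.1.1.2 x.
have next (sn : state * nat) : exists t : state, ok sn.1 ->
    [/\ ok t, ext sn.1 t & forall e, pickle e = sn.2 -> e \in t.1.1.1.1].
  case: sn => [[[[B phi] a] b] n] /=.
  have [ln|nl] := pselect (line B phi a b); last by exists (B, phi, a, b).
  have [cB [aB _ _ _] _ _] := ln.
  have Bn : B.2 != [::] by apply: contraTneq aB => ->.
  pose F : seq E := if unpickle n is Some e then [:: e] else [::].
  have [C BC FC] := grow_edges F cB Bn (connected_vpath conn).
  have [phi' [a' [b' [ln' H]]]] := line_grow BC ln.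
  exists (C, phi', a', b') => _; split=> //= e en.
  by apply: FC; rewrite /F -en pickleK mem_head.
have [nxt Hnxt] := choice next.
pose st := fix st n : state := if n is m.+1 then nxt (st m, m)
  else (ground r, (fun=> 0), r, r).
have okst n : ok (st n).
  elim: n => [|n IH]; first exact: line_ground.
  by have [] := Hnxt (st n, n) IH.
have extst n : ext (st n) (st n.+1) by have [] := Hnxt (st n, n) (okst n).
have Est n e : pickle e = n -> e \in (st n.+1).1.1.1.1.
  by have [_ _] := Hnxt (st n, n) (okst n); apply.
pose B n := (st n).1.1.1; pose ph n := (st n).1.1.2.
have growB m n : (m <= n)%N -> grow (B m) (B n).
  elim: n => [|n IH]; first by rewrite leqn0 => /eqP->; exact: grow0.
  rewrite leq_eqVlt ltnS => /predU1P[->|/IH h]; first exact: grow0.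
  by apply: grow_trans h _; have [] := extst n.
have agree m n x : (m <= n)%N -> cov (B m) x -> ph n x = ph m x.
  elim: n => [|n IH]; first by rewrite leqn0 => /eqP->.
  rewrite leq_eqVlt ltnS => /predU1P[->//|mn] xm.
  have [_ H] := extst n; transitivity (ph n x); last exact: IH.
  apply: H; exact: (cov_grow (growB m n mn) xm).
have inB e n : (pickle e < n)%N -> e \in (B n).1.
  by move=> en; apply: (grow_sub (growB _ _ en)).1; exact: Est.
have covB x : exists n, cov (B n) x.
  have [[v ->]|[e [s [/andP[s0 sl] ->]]]] := on_edge_surj x.
    have [e ev] := exists_incident conn vol0 v.
    exists (pickle e).+1; left; exists v => //.
    have [cB _ _ _] := okst (pickle e).+1; have [h1 h2] := cB e (inB _ _ (leqnn _)).
    by case/orP: ev => /eqP->.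
  exists (pickle e).+1; right; exists e, s; split => //; first exact: inB.
  by rewrite in_itv/= !ltW.
have [N HN] := choice covB.
(* Any stage covering [x] gives the same value; [N x] is one of them. *)
pose phi x := ph (N x) x.
have phiE n x : cov (B n) x -> phi x = ph n x.
  move=> xn; have [h|/ltnW h] := leqP n (N x); first exact: agree.
  by rewrite [RHS](agree (N x))//; exact: HN.
exists B, phi, (fun n => (st n).1.2), (fun n => (st n).2); split.
- move=> n; split; last by have [] := grow_uniq (growB 0%N n (leq0n n)) isT isT.
  by apply: line_coords_eq (okst n) _ => x; exact: phiE.
- by move=> m n x mn; exact: (cov_grow (growB m n mn)).
- elim=> [|e s [n IH]]; first by exists 0%N.
  exists (maxn n (pickle e).+1) => m; rewrite geq_max => /andP[nm em] x.
  by rewrite inE => /predU1P[->|]; [exact: inB|exact: IH].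
- exact: covB.
Qed.

End line_limit.

(** * The limit coordinate and the position of ends *)

Section coordinates.
Variables (R : realType) (G : metric_graph R).
Notation V := (vertex G).
Notation E := (edge G).
Implicit Types (e : E) (v w u r : V) (d : R).
Implicit Types (x y z : gpoint G) (phi psi : gpoint G -> R).
Implicit Types (B : nat -> seq E * seq V) (a b : nat -> V).
Implicit Types (U : nat -> set (gpoint G)).

Hypothesis conn : connected [set: gpoint G].
Hypothesis vol0 : (0 < volume G)%E.
Hypothesis voly : (volume G < +oo)%E.
Let L := fine (volume G).

Definition coordinate B psi a b := [/\ exhaustion B psi a b,
  forall x y, gdist x y = `|psi x - psi y|%:E,
  [set` `]0, L[] `<=` range psi, range psi `<=` [set` `[0, L]] &
  forall d, 0 < d -> exists n, forall m, (n <= m)%N ->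
    psi (vpoint (a m)) < d /\ L - d < psi (vpoint (b m))].

Lemma addrBB (s t c : R) : s + c - (t + c) = s - t.
Proof. by ring. Qed.

Lemma line_shift (S : seq E * seq V) phi u v (c : R) : line S phi u v ->
  line S (fun x => phi x + c) u v.
Proof.
move=> [cB ends [M1 M2 M3 M4 M5] PE]; split=> //; split.
- move=> e /M1[c' [g [gg H]]]; exists (c' + c), g; split=> // s /H ->; ring.
- by move=> x y xB yB /=; rewrite addrBB; exact: M2.
- by move=> x /M3; rewrite !lerD2r.
- by rewrite addrBB.
- move=> t t1 t2; have [||x xB xt] := M5 (t - c); [lra|lra|].
  by exists x => //; rewrite xt subrK.
Qed.

Lemma exhaustion_shift B phi a b (c : R) : exhaustion B phi a b ->
  exhaustion B (fun x => phi x + c) a b.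
Proof.
move=> [H1 H2 H3 H4]; split=> // n; have [h1 h2] := H1 n; split=> //.
exact: line_shift.
Qed.

Lemma exhaustion_rev B phi a b : exhaustion B phi a b ->
  exhaustion B (fun x => - phi x) b a.
Proof.
move=> [H1 H2 H3 H4]; split=> // n; have [h1 h2] := H1 n; split=> //.
exact: line_rev.
Qed.

Lemma exhaustion_lip B phi a b e s t : exhaustion B phi a b ->
  s \in `[0, len e] -> t \in `[0, len e] ->
  `|phi (on_edge e s) - phi (on_edge e t)| <= `|s - t|.
Proof.
move=> [H1 _ H3 _] sI tI; have [n Hn] := H3 [:: e].
have [[_ _ [M1 _ _ _ _] _] _] := H1 n.
have [c [g [gg H]]] := M1 e (Hn n (leqnn n) e (mem_head _ _)).
rewrite !H// ![c + _]addrC addrBB -mulrBr normrM.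
by case: gg => ->; rewrite ?normrN normr1 mul1r.
Qed.

Lemma exhaustion_iso B phi a b : exhaustion B phi a b ->
  forall x y, gdist x y = `|phi x - phi y|%:E.
Proof.
move=> ex x y; apply/eqP; rewrite eq_le; apply/andP; split; last first.
  by apply: gdist_ge_lip => e s t; exact: exhaustion_lip ex.
have [H1 H2 _ H4] := ex; have [m xm] := H4 x; have [n yn] := H4 y.
have [[_ _ [_ M2 _ _ _] _] _] := H1 (maxn m n).
apply: ereal_inf_lbound; exists `|phi x - phi y| => //; apply: M2.
  exact: H2 (leq_maxl m n) xm.
exact: H2 (leq_maxr m n) yn.
Qed.

(** The left end of the interval need not be a point of G, hence the normalisation by an infimum. *)
Lemma exhaustion_coordinate B phi a b : exhaustion B phi a b ->
  exists psi, coordinate B psi a b.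
Proof.
move=> ex; have [H1 H2 H3 H4] := ex.
pose lo := inf (range phi).
have [e0 _] := exists_edge vol0.
have tlen n : total_len (B n).1 <= L.
  by apply: total_len_le_volume => //; have [] := H1 n.
have span x y : phi x - phi y <= L.
  have [m xm] := H4 x; have [n yn] := H4 y.
  have [[_ _ [_ _ M3 M4 _] _] _] := H1 (maxn m n).
  have /andP[_ h1] := M3 x (H2 _ _ _ (leq_maxl m n) xm).
  have /andP[h2 _] := M3 y (H2 _ _ _ (leq_maxr m n) yn).
  have := tlen (maxn m n); rewrite -M4; move: h1 h2; clear; lra.
have ne : range phi !=set0 by exists (phi (vpoint (source e0))), (vpoint (source e0)).
have lb : has_lbound (range phi).
  exists (phi (vpoint (source e0)) - L) => _ [y _ <-].
  by have := span (vpoint (source e0)) y; clear; lra.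
have lo_le x : lo <= phi x by apply: ge_inf => //; exists x.
have lo_ge x : phi x - L <= lo.
  by apply: lb_le_inf => // _ [y _ <-]; have := span x y; clear; lra.
have near d : 0 < d -> exists y, phi y < lo + d.
  move=> d0; have [|_ [y _ <-] h] := inf_lt ne (x := lo + d).
    by rewrite ltrDl.
  by exists y.
(* [a m] is minimal on a line that contains a point close to the infimum; [b m] follows because the
   length of the line is close to the volume. *)
have appr d : 0 < d -> exists n, forall m, (n <= m)%N ->
    phi (vpoint (a m)) - lo < d /\ L - d < phi (vpoint (b m)) - lo.
  move=> d0; have [y yd] := near d d0; have [n1 yn] := H4 y.
  have [s us sL] := volume_approx voly d0; have [n2 sn] := H3 s.
  exists (maxn n1 n2) => m; rewrite geq_max => /andP[m1 m2].
  have [[_ _ [_ _ M3 M4 _] _] uB] := H1 m.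
  have /andP[h1 _] := M3 y (H2 _ _ _ m1 yn).
  have h2 : total_len s <= total_len (B m).1.
    apply: le_sum_sub => //; last exact: sn.
    by move=> e; rewrite ltW// len_gt0.
  have h3 := lo_le (vpoint (a m)).
  by move: yd h1 h2 h3 M4 sL; rewrite /L; clear; lra.
exists (fun x => phi x - lo); split.
- exact: exhaustion_shift.
- by move=> x y; rewrite addrBB; exact: exhaustion_iso ex x y.
- move=> t /=; rewrite in_itv/= => /andP[t0 tL].
  have [n Hn] := appr (Num.min t (L - t)) ltac:(by rewrite lt_min t0 subr_gt0).
  have [h1 h2] := Hn n (leqnn n).
  have h3 : Num.min t (L - t) <= t by rewrite ge_min lexx.
  have h4 : Num.min t (L - t) <= L - t by rewrite ge_min lexx orbT.
  have [[_ _ [_ _ _ _ M5] _] _] := H1 n.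
  have [||x _ xt] := M5 (lo + t); [lra|lra|].
  by exists x => //; rewrite xt addrC addKr.
- move=> _ [x _ <-] /=; rewrite in_itv/= subr_ge0 lo_le/=.
  by have := lo_ge x; clear; lra.
- exact: appr.
Qed.

Lemma coordinate_rev B psi a b : coordinate B psi a b ->
  coordinate B (fun x => L - psi x) b a.
Proof.
move=> [ex iso onto rng appr]; split.
- have := exhaustion_shift L (exhaustion_rev ex).
  by congr exhaustion; apply/funext => x; rewrite addrC.
- by move=> x y; rewrite iso distrC; congr (`|_|%:E); ring.
- move=> t /=; rewrite in_itv/= => /andP[t0 tL].
  have [|x _ xt] := onto (L - t); first by rewrite /= in_itv/=; apply/andP; split; lra.
  by exists x => //; rewrite xt; ring.
- move=> _ [x _ <-] /=; have : [set` `[0, L]] (psi x) by apply: rng; exists x.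
  by rewrite /= !in_itv/= => /andP[h1 h2]; apply/andP; split; lra.
- move=> d d0; have [n Hn] := appr d d0; exists n => m nm.
  by have [h1 h2] := Hn m nm; split; lra.
Qed.

Section one_coordinate.
Variables (B : nat -> seq E * seq V) (psi : gpoint G -> R) (a b : nat -> V).
Hypothesis co : coordinate B psi a b.

Lemma coordinate_range x : 0 <= psi x <= L.
Proof.
have [_ _ _ rng _] := co.
have : [set` `[0, L]] (psi x) by apply: rng; exists x.
by rewrite /= in_itv.
Qed.

Lemma coordinate_continuous : continuous psi.
Proof.
have [ex _ _ _ _] := co; apply: (@lip_continuous _ _ _ 1) => // e s t sI tI.
by rewrite mul1r; exact: exhaustion_lip ex sI tI.
Qed.

Lemma cov_vertex n v : cov (B n) (vpoint v) -> v \in (B n).2.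
Proof.
have [[H1 _ _ _] _ _ _ _] := co; have [[cB _ _ _] _] := H1 n.
case=> [[w wB [->]//]|[e [s [eB sI /esym/(on_edge_vpoint sI) ev]]]].
by have [h1 h2] := cB e eB; case/orP: ev => /eqP->.
Qed.

(** The ends of the lines tend to 0 and L, so [v] is eventually different from both. *)
Lemma inner_vertex_saturated v : 0 < psi (vpoint v) -> psi (vpoint v) < L ->
  exists n, saturated (B n) v.
Proof.
move=> v0 vL; have [[H1 H2 H3 H4] _ _ _ appr] := co.
have [n1 h1] := H4 (vpoint v); have [n2 h2] := appr _ v0.
have [n3 h3] : exists n3, forall m, (n3 <= m)%N -> psi (vpoint v) < psi (vpoint (b m)).
  have [|n3 h3] := appr (L - psi (vpoint v)); first by rewrite subr_gt0.
  by exists n3 => m /h3[_]; rewrite subKr.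
pose n := maxn n1 (maxn n2 n3); exists n.
have [[_ [_ _ sat _] _ _] _] := H1 n.
apply: sat.
- by apply: cov_vertex; apply: H2 h1; rewrite leq_maxl.
- apply/eqP => va; have [] := h2 n; first by rewrite /n leq_max leq_max leqnn orbT.
  by rewrite -va ltxx.
- apply/eqP => vb; have := h3 n; rewrite -vb ltxx /n !leq_max leqnn !orbT.
  by move=> /(_ isT).
Qed.

Lemma end_avoids_cov U n : end_seq U -> exists m0, forall m x, (m0 <= m)%N ->
  U m x -> ~ cov (B n) x.
Proof.
move=> EU; have [inc Hinc] := choice (exists_incident conn vol0).
have [m0 H] := end_avoids_edges ((B n).1 ++ [seq inc v | v <- (B n).2]) EU.
exists m0 => m x mm Ux [[v vB xv]|[e [s [eB sI xe]]]]; last first.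
  by apply: (H m e s mm _ sI); rewrite ?mem_cat ?eB// -xe.
have incI : inc v \in (B n).1 ++ [seq inc v | v <- (B n).2].
  by rewrite mem_cat map_f ?orbT.
have l0 := len_gt0 (inc v).
have := H m _ 0 mm incI; have := H m _ (len (inc v)) mm incI.
rewrite !in_itv/= !lexx ltW// on_edge0 on_edge_len => /(_ isT) h1 /(_ isT) h2.
by case/orP: (Hinc v) => /eqP ve; rewrite -ve -xv in h1 h2.
Qed.

(** Points with equal coordinate have distance zero and lie in the same open sets, so injectivity of
    [psi] never has to be shown. *)
Lemma end_indist U m x y : end_seq U -> U m x -> psi x = psi y -> U m y.
Proof.
move=> [/(_ m)[_ oU _ _] _ _] Ux xy; have [_ iso _ _ _] := co.
move: oU; rewrite openE => /(_ x Ux) /nbhs_ballP[r /= r0 rU].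
by apply: rU; rewrite /ball /= /gball iso xy subrr normr0 lte_fin.
Qed.

(** If [z] were missing, the points of [U m] with smaller coordinate would form a proper nonempty
    open and closed part of a connected set. *)
Lemma end_convex U m x y z : end_seq U -> U m x -> U m y ->
  psi x <= psi z -> psi z <= psi y -> U m z.
Proof.
move=> EU Ux Uy xz zy; apply: contrapT => Uz.
have nz t : U m t -> psi t != psi z.
  by move=> Ut; apply/eqP => tz; apply: Uz; exact: end_indist tz.
have [/(_ m)[_ _ cU _] _ _] := EU.
suff /seteqP[_ /(_ y Uy)[_ /= h]] : U m `&` [set t | psi t < psi z] = U m.
  by move: (le_lt_trans zy h); rewrite ltxx.
apply: cU.
- by exists x; split=> //=; rewrite lt_neqAle xz andbT nz.
- exists (psi @^-1` [set t | t < psi z]) => //.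
  by apply: open_comp; [move=> t _; exact: coordinate_continuous|exact: open_lt].
- exists (psi @^-1` [set t | t <= psi z]).
    by apply: closed_comp; [move=> t _; exact: coordinate_continuous|exact: closed_le].
  apply/seteqP; split=> t [Ut /= h]; split=> //=; first exact: ltW.
  by rewrite lt_neqAle h andbT nz.
Qed.

Definition end_left U := forall d, 0 < d -> exists m, forall k x, (m <= k)%N ->
  U k x -> psi x < d.

(** By convexity the sets cannot jump over [a 0]; avoiding ever longer lines, they are pushed to the
    left of each [a n]. *)
Lemma end_left_of U m0 x0 : end_seq U ->
  (forall m x, (m0 <= m)%N -> U m x -> ~ cov (B 0%N) x) ->
  U m0 x0 -> psi x0 < psi (vpoint (a 0%N)) -> end_left U.
Proof.
move=> EU av Ux0 x0a d d0; have [[H1 H2 H3 H4] _ _ _ appr] := co.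
have cova n : cov (B n) (vpoint (a n)).
  by have [[_ [aB _ _ _] _ _] _] := H1 n; left; exists (a n).
have [n1 h1] := appr d d0; have [m1 h2] := end_avoids_cov n1 EU.
exists (maxn m0 m1) => m x; rewrite geq_max => /andP[mm0 mm1] Ux.
have xa : psi x < psi (vpoint (a 0%N)).
  rewrite ltNge; apply/negP => h.
  have := av m0 (vpoint (a 0%N)) (leqnn _); apply => //.
  by apply: (end_convex EU Ux0 (end_seq_le EU mm0 Ux)) => //; exact: ltW.
have [h _] := h1 n1 (leqnn _); apply: lt_trans h.
rewrite ltNge; apply/negP => h.
have [[_ _ [_ _ M3 _ M5] _] _] := H1 n1.
have /andP[_ h3] := M3 _ (H2 _ _ _ (leq0n n1) (cova 0%N)).
have [y yB yx] := M5 (psi x) h (le_trans (ltW xa) h3).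
by apply: (h2 m y mm1 _ yB); apply: end_indist EU Ux _.
Qed.

Lemma end_left_pos U : end_seq U -> end_left U -> forall y, 0 < psi y.
Proof.
move=> EU lU y; have /andP[y0 _] := coordinate_range y.
rewrite lt_neqAle y0 andbT; apply/eqP => y00; have [_ iso _ _ _] := co.
have [EU1 _ E0] := EU; suff : (\bigcap_n closure (U n)) y by rewrite E0.
move=> n _ D /nbhs_ballP[r /= r0 rD].
have [m Hm] := lU r r0; have [[x Ux] _ _ _] := EU1 (maxn m n).
exists x; split; first exact: end_seq_le EU _ _ (leq_maxr m n) _ Ux.
apply: rD; rewrite /ball /= /gball iso -y00 sub0r normrN lte_fin.
rewrite ger0_norm; first exact: Hm (leq_maxl m n) Ux.
by have /andP[] := coordinate_range x.
Qed.

(** No point has coordinate 0, so a later set reaches to the left of any given [y], and convexity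
    fills the gap. *)
Lemma end_left_nbhs U m : end_seq U -> end_left U ->
  exists2 d, 0 < d & forall y, psi y < d -> U m y.
Proof.
move=> EU lU; have [EU1 _ _] := EU; have [[x Ux] _ _ _] := EU1 m.
have pos := end_left_pos EU lU.
exists (psi x) => // y yx; have [k Hk] := lU (psi y) (pos y).
have [[z Uz] _ _ _] := EU1 (maxn k m).
have Uz' := end_seq_le EU (leq_maxr k m) Uz.
apply: (end_convex EU Uz' Ux); last exact: ltW.
by apply: ltW; exact: Hk (leq_maxl k m) Uz.
Qed.

Lemma end_left_equiv U U' : end_seq U -> end_seq U' -> end_left U ->
  end_left U' -> end_equiv U U'.
Proof.
move=> EU EU' lU lU' n.
have [d d0 H] := end_left_nbhs n EU lU; have [j Hj] := lU' d d0.
have [d' d0' H'] := end_left_nbhs n EU' lU'; have [k Hk] := lU d' d0'.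
exists j, k; split=> x Ux; first exact/H/(Hj j x (leqnn _)).
exact/H'/(Hk k x (leqnn _)).
Qed.

Lemma graph_end_sub (c : graph_end G) U U' m : sval c U -> sval c U' ->
  exists j, U' j `<=` U m.
Proof.
case: c => C /= [U0 EU0 ->] [_ U0U] [_ U0U'].
have [_ [k [_ kU]]] := U0U m; have [j [_ [jU' _]]] := U0U' k.
by exists j; exact: subset_trans kU.
Qed.

Lemma end_left_transfer (c : graph_end G) U U' : sval c U -> sval c U' ->
  end_left U -> end_left U'.
Proof.
move=> cU cU' lU d d0; have [m Hm] := lU d d0.
have [j jm] := graph_end_sub m cU cU'.
exists j => k x jk U'x; apply: (Hm m x (leqnn _)); apply: jm.
exact: end_seq_le (graph_end_seq cU') _ _ jk _ U'x.
Qed.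

Lemma end_left_value (c : graph_end G) U : sval c U -> end_left U ->
  has_value_at psi (inr c) 0.
Proof.
move=> cU lU U' cU' x Ux; apply/cvgrPdist_lt => eps eps0.
have [m Hm] := end_left_transfer cU cU' lU eps0.
exists m => // k /= mk; rewrite sub0r normrN ger0_norm; first exact: Hm mk (Ux k).
by have /andP[] := coordinate_range (x k).
Qed.

(** All sequences escaping to the left are equivalent, and an end is its own equivalence class. *)
Lemma end_left_unique (c c' : graph_end G) U U' : sval c U -> sval c' U' ->
  end_left U -> end_left U' -> c = c'.
Proof.
move=> cU cU' lU lU'.
have sub (c1 c2 : graph_end G) U1 U2 : sval c1 U1 -> sval c2 U2 ->
    end_left U1 -> end_left U2 -> sval c1 `<=` sval c2.
  move=> cU1 cU2 lU1 lU2 W cW.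
  have lW := end_left_transfer cU1 cW lU1; have EW := graph_end_seq cW.
  case: c2 cU2 => C /= [U0 EU0 CE] CU2; have CU0 : C U0.
    by rewrite CE; split=> // n; exists n, n; split.
  rewrite CE; split=> //; apply: end_left_equiv => //.
  have [_ U02] : end_seq U2 /\ end_equiv U0 U2 by move: CU2; rewrite CE.
  move=> d d0; have [m Hm] := lU2 d d0; have [_ [k [_ kU]]] := U02 m.
  exists k => k' x kk' Ux; apply: (Hm m x (leqnn _)); apply: kU.
  exact: end_seq_le EU0 _ _ kk' _ Ux.
have : sval c = sval c'.
  by apply/seteqP; split; [exact: sub cU cU' lU lU'|exact: sub cU' cU lU' lU].
case: c c' {cU cU'} => [C pC] [C' pC'] /= CC'; subst C'.
by congr exist; exact: Prop_irrelevance.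
Qed.

Lemma end_left_small (f : gpoint G -> R) (c : graph_end G) U eps :
  sval c U -> end_left U -> has_value_at f (inr c) 0 -> 0 < eps ->
  exists n, forall m, (n <= m)%N -> f (vpoint (a m)) ^+ 2 < eps.
Proof.
move=> cU lU fc eps0; have [_ _ _ _ appr] := co.
have s0 : 0 < Num.sqrt eps by rewrite sqrtr_gt0.
have [k Hk] := has_value_at_near fc cU s0.
have [d d0 Hd] := end_left_nbhs k (graph_end_seq cU) lU.
have [n Hn] := appr d d0; exists n => m nm; have [h _] := Hn m nm.
have := Hk k _ (leqnn _) (Hd _ h).
rewrite subr0 -(@ltr_pXn2r _ 2) ?nnegrE ?sqrtr_ge0// real_normK ?num_real//.
by rewrite sqr_sqrtr// ltW.
Qed.

End one_coordinate.
End coordinates.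

(** * The case of equality *)

Section equality_case.
Variables (R : realType) (G : metric_graph R).
Variable VV : set (vertex G + graph_end G).
Implicit Types (e : edge G) (v r q : vertex G) (U : nat -> set (gpoint G)).
Implicit Types (psi : gpoint G -> R).

Hypothesis conn : connected [set: gpoint G].
Hypothesis vol0 : (0 < volume G)%E.
Hypothesis voly : (volume G < +oo)%E.
Hypothesis fin : locally_finite G.
Let L := fine (volume G).

(** Picone's inequality along a long line; f is small at both of its ends. *)
Lemma two_ends_gain B psi a b (c c' : graph_end G) U U' :
  coordinate B psi a b -> sval c U -> sval c' U' ->
  end_left psi U -> end_left (fun x => L - psi x) U' ->
  VV (inr c) -> VV (inr c') -> spectral_gain VV.
Proof.
move=> co cU cU' lU lU' Vc Vc'.
have L0 : 0 < L by exact: fine_volume_gt0.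
have pi0 := @pi_gt0 R.
(* Between pi/(2L) and the Dirichlet value pi/L: the phase runs from 3 pi/8 down to at least -3 pi/8
   and stays inside the domain of the tangent. *)
pose k : R := 3 / 4 * pi / L.
have k0 : 0 < k by rewrite /k divr_gt0// mulr_gt0.
have kL : k * L = 3 / 4 * pi by rewrite /k divfK// gt_eqF.
exists k.
  by rewrite -(ltr_pM2r L0) kL /L invfM mulrA divfK ?gt_eqF//; lra.
move=> f g [fH1 fV]; apply: energy_exhaustion => // s eps eps0.
pose t0 : R := tan (3 / 8 * pi).
have t00 : 0 <= t0 by apply: tan_ge0; lra.
have kt : 0 < 2 * k * t0 + 1.
  by apply: ltr_wpDl => //; apply: mulr_ge0 => //; rewrite mulr_ge0// ltW.
have eta0 := divr_gt0 eps0 kt.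
have [n1 h1] := end_left_small co cU lU (fV _ Vc) eta0.
have [n2 h2] := end_left_small (coordinate_rev co) cU' lU' (fV _ Vc') eta0.
have [[H1 _ H3 _] _ _ _ _] := co; have [n3 h3] := H3 s.
pose n := maxn n1 (maxn n2 n3).
have [[_ _ _ PE] uB] := H1 n.
exists (B n).1; split=> //.
  by apply: h3; rewrite /n !leq_max leqnn !orbT.
have {h1}h1 := h1 n (leq_maxl _ _).
have {h2}h2 : f (vpoint (b n)) ^+ 2 < eps / (2 * k * t0 + 1).
  by apply: h2; rewrite /n !leq_max leqnn orbT.
have kB : k * total_len (B n).1 <= 3 / 4 * pi.
  by rewrite -kL ler_pM2l//; exact: total_len_le_volume.
have kB0 : 0 <= k * total_len (B n).1 by rewrite mulr_ge0 ?total_len_ge0// ltW.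
have := PE k (edge_energy k f g) (fun v => f (vpoint v) ^+ 2) (3 / 8 * pi) k0
  (graph_H1_energy_bound k0 fH1).
move=> /(_ ltac:(lra) ltac:(lra)); apply: le_trans.
have tB : - t0 <= tan (3 / 8 * pi - k * total_len (B n).1).
  by rewrite /t0 -tanN; apply: tan_le; lra.
have {tB}tB : - (k * t0 * f (vpoint (b n)) ^+ 2) <=
    k * tan (3 / 8 * pi - k * total_len (B n).1) * f (vpoint (b n)) ^+ 2.
  by rewrite -mulNr ler_wpM2r ?sqr_ge0// -mulrN ler_wpM2l// ltW.
rewrite -/t0; move: h1 h2; rewrite !ltr_pdivlMr// => h1 h2.
have h3' := sqr_ge0 (f (vpoint (a n))); have h4 := sqr_ge0 (f (vpoint (b n))).
by move: tB h1 h2 h3' h4; clear; lra.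
Qed.

(** A late set of the end avoids the first line, so each of its points lies to the left or to the
    right of it. *)
Lemma end_side B psi a b (c : graph_end G) : coordinate B psi a b ->
  exists2 U, sval c U & end_left psi U \/ end_left (fun x => L - psi x) U.
Proof.
move=> co; have [U EU cU] := graph_end_mem c; exists U => //.
have [m0 av] := end_avoids_cov conn vol0 B 0%N EU.
have [/(_ m0)[[x Ux] _ _ _] _ _] := EU.
have [[H1 _ _ _] _ _ _ _] := co; have [[_ _ [_ _ _ _ M5] _] _] := H1 0%N.
have [xa|ax] := ltP (psi x) (psi (vpoint (a 0%N))).
  by left; apply: (end_left_of conn vol0 co EU av Ux).
have [xb|bx] := leP (psi x) (psi (vpoint (b 0%N))).
  have [y yB yx] := M5 _ ax xb.
  case: (av m0 y (leqnn _) (end_indist co EU Ux (esym yx)) yB).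
right; apply: (end_left_of conn vol0 (coordinate_rev co) EU av Ux).
by rewrite ltrD2l ltrN2.
Qed.

Lemma not_gain_root r d1 d2 : ~ spectral_gain VV -> VV (inl r) ->
  dtail d1 = r -> dtail d2 = r -> d1 = d2.
Proof.
move=> ng Vr t1 t2; apply/eqP/negPn/negP => d12; apply: ng.
exact: root_spectral_gain Vr t1 t2 d12.
Qed.

Lemma mixed_interval_of_not_gain : VV !=set0 -> ~ spectral_gain VV ->
  mixed_interval VV L.
Proof.
move=> [p Vp] ng.
have deg2 v d1 d2 d3 : dtail d1 = v -> dtail d2 = v -> dtail d3 = v ->
    ~~ uniq [:: d1; d2; d3].
  move=> t1 t2 t3; apply/negP => u3.
  have [pv|pv] := pselect (p = inl v).
    rewrite pv in Vp; move: u3; rewrite /= inE (not_gain_root ng Vp t1 t2).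
    by rewrite eqxx.
  by apply: ng; exact: branch_spectral_gain Vp pv t1 t2 t3 u3.
have noncyclic (s : seq (edge G)) : (forall e, e \in s) ->
    (forall v, saturated (s, [::] : seq (vertex G)) v) -> False.
  (* On a cycle a Dirichlet vertex would have two darts; a Dirichlet end would have to avoid all of
     the finitely many edges. *)
  move=> all_s sat; case: p Vp => [r|c] Vp.
    have [d1 [d2 [d12 [t1 t2] _ _]]] := sat r.
    by move: d12; rewrite (not_gain_root ng Vp t1 t2) eqxx.
  have [U EU _] := graph_end_mem c; have [n Hn] := end_avoids_edges s EU.
  have [/(_ n)[[x Ux] _ _ _] _ _] := EU.
  have [[v xv]|[e [t [/andP[t0 tl] xe]]]] := on_edge_surj x.
    have [e ev] := exists_incident conn vol0 v; have l0 := len_gt0 e.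
    have h1 := Hn n e 0 (leqnn n) (all_s e).
    have h2 := Hn n e (len e) (leqnn n) (all_s e).
    rewrite on_edge0 in h1; rewrite on_edge_len in h2.
    rewrite !in_itv/= !lexx (ltW l0) in h1 h2.
    by case/orP: ev => /eqP ve; rewrite -ve -xv in h1 h2; [apply: h1|apply: h2].
  by apply: (Hn n e t (leqnn n) (all_s e)); rewrite -?xe// in_itv/= !ltW.
have [B [phi [a [b ex]]]] := exists_exhaustion conn vol0 deg2 noncyclic.
have [psi co] := exhaustion_coordinate vol0 voly ex.
have [_ iso onto rng _] := co.
exists psi; split=> //; exists p; split.
  apply/seteqP; split=> [q Vq|q -> //] /=; apply: contrapT => qp.
  case: q qp Vq => [q|c] qp Vq.
    by apply: ng; apply: dirichlet_spectral_gain Vp Vq _ => // pq; apply: qp.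
  case: p Vp qp => [r|c'] Vp qp.
    by apply: ng; apply: dirichlet_spectral_gain Vq Vp _.
  have [U cU sU] := end_side c co; have [U' cU' sU'] := end_side c' co.
  case: sU sU' => [lU|rU] [lU'|rU'].
  - apply: qp; congr inr. exact (end_left_unique co cU cU' lU lU').
  - by apply: ng; exact: two_ends_gain co cU cU' lU rU' Vq Vp.
  - by apply: ng; exact: two_ends_gain co cU' cU lU' rU Vp Vq.
  - apply: qp; congr inr.
    exact (end_left_unique (coordinate_rev co) cU cU' rU rU').
case: p Vp => [r|c] Vp.
  have /andP[r0 rL] := coordinate_range co (vpoint r) => /=.
  apply: contrapT => /not_orP[n0 nL].
  have v0 : 0 < psi (vpoint r) by rewrite lt_neqAle r0 andbT eq_sym; apply/eqP.
  have vL : psi (vpoint r) < L by rewrite lt_neqAle rL andbT; apply/eqP.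
  have [n [d1 [d2 [d12 [t1 t2] _ _]]]] := inner_vertex_saturated co v0 vL.
  by move: d12; rewrite (not_gain_root ng Vp t1 t2) eqxx.
have [U cU [lU|rU]] := end_side c co.
  by left; exact (@end_left_value _ _ _ _ _ _ co _ _ cU lU).
right=> U' cU' x Ux.
have h := @end_left_value _ _ _ _ _ _ (coordinate_rev co) _ _ cU rU U' cU' x Ux.
have : (fun n => L - (L - psi (x n))) n @[n --> \oo] --> L - 0.
  by apply: cvgB; [exact: cvg_cst|exact: h].
rewrite subr0; apply: cvg_trans; apply: near_eq_cvg; apply: nearW => n /=.
by rewrite subKr.
Qed.

End equality_case.

Theorem theorem4p2 (R : realType) (G : metric_graph R)
    (VV : set (vertex G + graph_end G)) :
  locally_finite G ->
  connected [set: gpoint G] ->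
  (0 < volume G)%E -> (volume G < +oo)%E ->
  VV !=set0 ->
  pi ^+ 2 / (4 * fine (volume G) ^+ 2) <= lambda1 VV /\
  (lambda1 VV = pi ^+ 2 / (4 * fine (volume G) ^+ 2) <->
   mixed_interval VV (fine (volume G))).
Proof.
move=> fin conn vol0 voly V0; set L := fine (volume G).
have L0 : 0 < L by exact: fine_volume_gt0.
have pi0 := @pi_gt0 R.
have [k kE] : exists k : R, k = pi / (2 * L) by exists (pi / (2 * L)).
have k0 : 0 < k by rewrite kE divr_gt0// mulr_gt0.
have -> : pi ^+ 2 / (4 * L ^+ 2) = k ^+ 2 by rewrite kE; field; rewrite gt_eqF.
have lower : k ^+ 2 <= lambda1 VV.
  apply/ler_addgt0Pr => eps eps0.
  (* [basic_bound] requires k L < pi/2 strictly, so it is applied to k - d, and (k - d)^2 >= k^2 - 2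
     k d >= k^2 - eps. *)
  pose d := Num.min (k / 2) (eps / (2 * k)).
  have d0 : 0 < d by rewrite lt_min !divr_gt0// mulr_gt0.
  have dk : d <= k / 2 by rewrite ge_min lexx.
  have de : 2 * k * d <= eps.
    have k20 : 0 < 2 * k by rewrite mulr_gt0.
    have h : d <= eps / (2 * k) by rewrite ge_min lexx orbT.
    by have := ler_wpM2l (ltW k20) h; rewrite mulrCA divff ?gt_eqF// mulr1.
  have kd : 0 < k - d by lra.
  have := lambda1_ge conn vol0 voly (basic_bound conn vol0 voly fin V0 kd _).
  have kL : (k - d) * L < pi / 2.
    rewrite (_ : pi / 2 = k * L); last by rewrite kE; field; rewrite gt_eqF.
    by rewrite ltr_pM2r// gtrBl.
  by move=> /(_ kL); have := sqr_ge0 d; nra.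
split=> //; split=> [eq|].
  apply: mixed_interval_of_not_gain => // -[k1 kk1 /(lambda1_ge conn vol0 voly)].
  by rewrite eq -/L -kE in kk1 *; nra.
move=> [phi [iso onto rng [p [Vp pv]]]]; apply/eqP; rewrite eq_le lower andbT.
rewrite kE; case: pv => pv.
  exact (interval_lambda1_le conn vol0 voly iso onto rng pv Vp).
(* If the Dirichlet point sits at L, the interval is reflected. *)
apply: (@interval_lambda1_le _ _ (fun x => L - phi x) conn vol0 voly _ _ _ p) => //.
- by move=> x y; rewrite iso distrC; congr (`|_|%:E); ring.
- move=> t /=; rewrite in_itv/= -/L => /andP[t0 tL].
  have [|x _ xt] := onto (L - t); first by rewrite /= in_itv/=; apply/andP; split; lra.
  by exists x => //; rewrite xt; ring.
- move=> _ [x _ <-] /=; have : [set` `[0, L]] (phi x) by apply: rng; exists x.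
  by rewrite /= !in_itv/= -/L => /andP[h1 h2]; apply/andP; split; lra.
case: (p) pv => [v /= ->|c H U cU x Ux]; first by rewrite subrr.
have h := H U cU x Ux; rewrite -[X in _ --> X](subrr L).
by apply: cvgB; [exact: cvg_cst|exact: h].
Qed.
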